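(* Let $(x_n)_{n\in\mathbb Z}$ be an odd sequence of real numbers, that is $x_{-n}=-x_n$ for all $n\in\mathbb Z$, such that there exist $k\in\mathbb N^*=\{1,2,\dots\}$, $\delta\in(0,\frac14)$ and $N_0\ge0$ for which $$n\ge N_0\implies\Bigl|x_n-n-\frac k2\Bigr|\le\frac14-\delta.$$ Then, choosing distinct real numbers $x'_1,\dots,x'_k\notin\{x_n,\ n\in\mathbb Z\}$, the set $$\{e^{ix'_1t},\dots,e^{ix'_kt}\}\cup\{e^{ix_nt},\ n\in\mathbb Z\}$$ is a Riesz basis of $L^2(-\pi,\pi)$.
   Context: $L^2(-\pi,\pi)$ is the space of complex-valued square-integrable functions of $t\in(-\pi,\pi)$.
   Formalization: The formal theorem additionally assumes that the numbers x_n are pairwise distinct; without this the claim is false, e.g. k=1, x_0=x_1=x_{-1}=0 and x_n=n+1/2 for n≥2, where the set of exponentials is incomplete. *)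

(* Defs.v *)
From HB Require Import structures.
From mathcomp Require Import all_boot all_order all_algebra.
From mathcomp Require Import all_classical all_reals all_analysis.
From mathcomp Require Import complex.

Set Implicit Arguments.
Unset Strict Implicit.
Unset Printing Implicit Defensive.

Import Order.TTheory GRing.Theory Num.Theory.
Import numFieldNormedType.Exports.

Local Open Scope classical_set_scope.
Local Open Scope ring_scope.
Local Open Scope complex_scope.

(* Elements of L^2(-pi,pi) are represented by functions R -> R[i]; only their
   values on ]-pi,pi[ matter, and equality in L^2 is [eqL2], i.e. equality
   almost everywhere on ]-pi,pi[. *)
Section L2.
Context {R : realType}.

Definition Ipi : set R := `]- pi, pi[%classic.

Definition normsq (z : R[i]) : R := complex.Re z ^+ 2 + complex.Im z ^+ 2.

Definition inL2 (f : R -> R[i]) : Prop :=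
  [/\ measurable_fun Ipi (fun t => complex.Re (f t)),
      measurable_fun Ipi (fun t => complex.Im (f t)) &
      (\int[lebesgue_measure]_(t in Ipi) (normsq (f t))%:E < +oo)%E].

Definition eqL2 (f g : R -> R[i]) : Prop :=
  {ae lebesgue_measure, forall t, Ipi t -> f t = g t}.

Definition normL2 (f : R -> R[i]) : R :=
  Num.sqrt (\int[lebesgue_measure]_(t in Ipi) normsq (f t)).

(* \int_(-pi)^pi f(t) conj(g(t)) dt, unnormalised *)
Definition innerL2 (f g : R -> R[i]) : R[i] :=
  (\int[lebesgue_measure]_(t in Ipi) complex.Re (f t * (g t)^*)) +i*
  (\int[lebesgue_measure]_(t in Ipi) complex.Im (f t * (g t)^*)).

(* Compatibility with [eqL2] follows from linearity and boundedness. *)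
Definition bounded_operator (U : (R -> R[i]) -> (R -> R[i])) : Prop :=
  [/\ forall f, inL2 f -> inL2 (U f),
      forall (a : R[i]) f g, inL2 f -> inL2 g ->
        eqL2 (U (fun t => a * f t + g t)) (fun t => a * U f t + U g t) &
      exists C : R, forall f, inL2 f -> normL2 (U f) <= C * normL2 f].

Definition bounded_invertible (U : (R -> R[i]) -> (R -> R[i])) : Prop :=
  bounded_operator U /\
  exists V, [/\ bounded_operator V,
    forall f, inL2 f -> eqL2 (V (U f)) f &
    forall f, inL2 f -> eqL2 (U (V f)) f].

Definition orthonormal_basis (I : eqType) (e : I -> R -> R[i]) : Prop :=
  [/\ forall i, inL2 (e i),
      forall i j, innerL2 (e i) (e j) = (i == j)%:R &
      forall f, inL2 f -> forall eps : R, 0 < eps ->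
        exists (s : seq I) (c : I -> R[i]),
          normL2 (fun t => f t - \sum_(i <- s) c i * e i t) < eps].

(* A Riesz basis is the image of an orthonormal basis under a bounded
   invertible operator. *)
Definition riesz_basis (I : eqType) (f : I -> R -> R[i]) : Prop :=
  (forall i, inL2 (f i)) /\
  exists (e : I -> R -> R[i]) (U : (R -> R[i]) -> (R -> R[i])),
    [/\ orthonormal_basis e, bounded_invertible U &
        forall i, eqL2 (U (e i)) (f i)].

Definition expi (a : R) : R -> R[i] := fun t => cos (a * t) +i* sin (a * t).

End L2.

(* Main.v *)
Require Import Defs.
From HB Require Import structures.
From mathcomp Require Import all_boot all_order all_algebra.
From mathcomp Require Import all_classical all_reals all_analysis.
From mathcomp Require Import measurable_realfun complex ring lra zify.

(** The oddness of [x] turns the hypothesis on [x n] for large [n] into one on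
    [x (- n)], namely that it is within [1 / 4 - delta] of [- n - k / 2].
    Measured against the lattice [k / 2 + Z] the negative half of the sequence
    is therefore displaced by [k] places, which leaves a hole of exactly [k]
    lattice points, and the [k] extra frequencies fill it. So, after a
    relabelling by the integers ([place]), the frequencies form a sequence which
    stays within [1 / 4 - delta] of the lattice with finitely many exceptions.
    Two facts finish the proof.

    A family of exponentials all of whose frequencies lie within [L < 1 / 4] of the
    points of a translate of [Z] is a Riesz basis ([kadec]). By the Paley-Wiener
    criterion ([riesz_of_close]) it is enough that the synthesis operators of this
    family and of the orthonormal exponentials differ by an operator of norm less
    than one. That difference is the sum of two operators, even and odd in the
    displacements. The matrix of the first one in the orthonormal basis, and that
    of the second one in the basis shifted by [1 / 2], have entries dominated by
    those of a convolution kernel, so that Schur's test ([schur_test]) applies.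
    The sums of the two kernels come out of Parseval's identity, which for
    exponentials is a partial fraction expansion ([sum_alpha_le],
    [sum_beta_le]); the norm is at most [1 - cos (pi L) + sin (pi L)], which is
    less than one because [L < 1 / 4].

    Finitely many frequencies of a Riesz basis of exponentials may be replaced by
    other ones, as long as all frequencies stay distinct
    ([riesz_replace_frequencies]). A member of a Riesz basis can be replaced by
    any vector outside the closed span [W] of the other members
    ([riesz_replaced]). That [expi b] is outside [W] when [b] is not a frequency
    ([exponential_not_in_span]) comes from a Volterra operator whose
    eigenvectors modulo [expi b] are the exponentials: if [expi b] were in [W]
    this operator would act on the one-dimensional quotient by [W] as a scalar,
    although it multiplies different exponentials by different scalars, and all
    exponentials but one, which still span a dense subspace, would be in [W].

    The Hilbert space structure rests on three facts: completeness
    ([L2_complete]), the density of trigonometric polynomials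
    ([trigonometric_density]), and the extension of bounded operators from finite
    linear combinations, which turns the two-sided inequality defining [riesz]
    into the operator form of a Riesz basis ([riesz_basis_of_riesz]). *)

Set Implicit Arguments.
Unset Strict Implicit.
Unset Printing Implicit Defensive.

Import Order.TTheory GRing.Theory Num.Theory.
Import numFieldNormedType.Exports.

Local Open Scope classical_set_scope.
Local Open Scope ring_scope.
Local Open Scope complex_scope.
Local Notation Re := complex.Re.
Local Notation Im := complex.Im.

(** * Square-integrable functions as a module *)

Section SquareIntegrable.
Context {R : realType}.
Local Notation mu := (@lebesgue_measure R).
Local Notation Ipi := (@Ipi R).
Implicit Types (f g h : R -> R[i]) (z w : R[i]).

Lemma measurable_Ipi : measurable Ipi.
Proof. exact: measurable_itv. Qed.
Hint Resolve measurable_Ipi : core.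

Lemma lebesgue_Ipi : mu Ipi = (pi *+ 2)%:E.
Proof.
rewrite /Defs.Ipi lebesgue_measure_itv/= lte_fin gtrN ?pi_gt0//.
by rewrite -EFinD opprK mulr2n.
Qed.

Lemma bounded_integrable_Ipi (G : R -> R) (M : R) : measurable_fun Ipi G ->
  (forall t, Ipi t -> `|G t| <= M) -> mu.-integrable Ipi (EFin \o G).
Proof.
move=> mG GM; apply: measurable_bounded_integrable => //.
  exact: (eq_ind_r (fun x => (x < +oo)%E) (ltry _) lebesgue_Ipi).
exists M; split; first exact: num_real.
by move=> x Mx t It; exact: le_trans (GM _ It) (ltW Mx).
Qed.

Lemma normsq_ge0 z : 0 <= normsq z.
Proof. by rewrite /normsq addr_ge0 ?sqr_ge0. Qed.
Hint Resolve normsq_ge0 : core.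

Lemma cReM z w : Re (z * w) = Re z * Re w - Im z * Im w.
Proof. by case: z w => [a b] [c d]. Qed.
Lemma cImM z w : Im (z * w) = Re z * Im w + Im z * Re w.
Proof. by case: z w => [a b] [c d]. Qed.
Lemma cReD z w : Re (z + w) = Re z + Re w.
Proof. by case: z w => [a b] [c d]. Qed.
Lemma cImD z w : Im (z + w) = Im z + Im w.
Proof. by case: z w => [a b] [c d]. Qed.
Lemma cRe_conj z : Re z^* = Re z.
Proof. by case: z. Qed.
Lemma cIm_conj z : Im z^* = - Im z.
Proof. by case: z. Qed.

Lemma normsqM z w : normsq (z * w) = normsq z * normsq w.
Proof. by rewrite /normsq cReM cImM; ring. Qed.

Lemma normsqD_le z w : normsq (z + w) <= 2 * normsq z + 2 * normsq w.
Proof.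
rewrite /normsq cReD cImD -subr_ge0.
have -> : 2 * (Re z ^+ 2 + Im z ^+ 2) + 2 * (Re w ^+ 2 + Im w ^+ 2)
  - ((Re z + Re w) ^+ 2 + (Im z + Im w) ^+ 2)
  = (Re z - Re w) ^+ 2 + (Im z - Im w) ^+ 2 by ring.
by rewrite addr_ge0 ?sqr_ge0.
Qed.

Lemma measurable_normsq f : measurable_fun Ipi (fun t => Re (f t)) ->
  measurable_fun Ipi (fun t => Im (f t)) ->
  measurable_fun Ipi (fun t => normsq (f t)).
Proof.
move=> mr mi; rewrite /normsq.
by apply: measurable_funD; apply: measurable_funX.
Qed.

Lemma inL2_integrable f : inL2 f -> mu.-integrable Ipi (fun t => (normsq (f t))%:E).
Proof.
move=> [mr mi fin]; apply/integrableP; split.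
  by apply/measurable_EFinP; apply: measurable_normsq.
by under eq_integral do rewrite gee0_abs ?lee_fin//.
Qed.

Lemma inL2_dominated f (G : R -> R) :
  measurable_fun Ipi (fun t => Re (f t)) ->
  measurable_fun Ipi (fun t => Im (f t)) ->
  mu.-integrable Ipi (EFin \o G) ->
  (forall t, Ipi t -> normsq (f t) <= G t) -> inL2 f.
Proof.
move=> mr mi iG fG; split=> //.
have : mu.-integrable Ipi (fun t => (normsq (f t))%:E).
  apply: le_integrable iG => //.
    by apply/measurable_EFinP; apply: measurable_normsq.
  move=> t It /=; rewrite lee_fin ger0_norm// (le_trans (fG _ It))//.
  exact: ler_norm.
move=> /integrableP[_]; under eq_integral do rewrite gee0_abs ?lee_fin//.
by [].
Qed.

Lemma inL2_bounded f (M : R) :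
  measurable_fun Ipi (fun t => Re (f t)) ->
  measurable_fun Ipi (fun t => Im (f t)) ->
  (forall t, Ipi t -> normsq (f t) <= M) -> inL2 f.
Proof.
move=> mr mi fM; apply: (inL2_dominated mr mi _ fM).
apply: (@bounded_integrable_Ipi (cst M) `|M|) => // t _; exact: measurable_cst.
Qed.

Lemma inL2D f g : inL2 f -> inL2 g -> inL2 (f + g).
Proof.
move=> f2 g2; have [fr fi _] := f2; have [gr gi _] := g2.
apply: (@inL2_dominated _ (fun t => 2 * normsq (f t) + 2 * normsq (g t))).
- by under eq_fun do rewrite cReD; exact: measurable_funD.
- by under eq_fun do rewrite cImD; exact: measurable_funD.
- under [X in integrable _ _ X]eq_fun do rewrite EFinD !EFinM.
  by apply: integrableD => //; apply: integrableZl => //; exact: inL2_integrable.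
- by move=> t _; exact: normsqD_le.
Qed.

Lemma inL2M (u : R -> R[i]) (M : R) f :
  measurable_fun Ipi (fun t => Re (u t)) ->
  measurable_fun Ipi (fun t => Im (u t)) ->
  (forall t, Ipi t -> normsq (u t) <= M) -> inL2 f -> inL2 (u * f).
Proof.
move=> ur ui uM f2; have [fr fi _] := f2.
apply: (@inL2_dominated _ (fun t => M * normsq (f t))).
- under eq_fun do rewrite cReM.
  by apply: measurable_funB; apply: measurable_funM.
- under eq_fun do rewrite cImM.
  by apply: measurable_funD; apply: measurable_funM.
- under [X in integrable _ _ X]eq_fun do rewrite EFinM.
  by apply: integrableZl => //; exact: inL2_integrable.
- by move=> t It; rewrite normsqM ler_wpM2r// uM.
Qed.

Lemma inL2Z z f : inL2 f -> inL2 (z *: f).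
Proof. by apply: (@inL2M (cst z) (normsq z)). Qed.

Lemma inL20 : inL2 (0 : R -> R[i]).
Proof.
apply: (@inL2_bounded _ 0); [exact: measurable_cst..|].
by move=> t _; rewrite /normsq /= expr0n addr0.
Qed.

(** Functions equal almost everywhere are not identified, so that [innerL2] is only a
    semi-inner product on the type [L2] below. *)
Definition L2_pred : {pred R -> R[i]} := [pred f | `[< inL2 f >]].

Lemma L2_predE f : (f \in L2_pred) = `[< inL2 f >].
Proof. by []. Qed.

Lemma L2_submod_closed : submod_closed L2_pred.
Proof.
split=> [|a f g]; rewrite !L2_predE; first exact/asboolP/inL20.
by move=> /asboolP f2 /asboolP g2; apply/asboolP/inL2D => //; exact: inL2Z.
Qed.

HB.instance Definition _ := GRing.isSubmodClosed.Build _ _ L2_pred L2_submod_closed.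

Record L2 := MkL2 { L2fun :> R -> R[i]; L2funP : L2fun \in L2_pred }.

HB.instance Definition _ := [isSub for L2fun].
HB.instance Definition _ := [Choice of L2 by <:].
HB.instance Definition _ := [SubChoice_isSubLmodule of L2 by <:].

Implicit Types u v : L2.

Lemma L2P u : inL2 u. Proof. exact/asboolP/(L2funP u). Qed.

Definition toL2 f (f2 : inL2 f) : L2 := MkL2 (asboolT f2).

Lemma L2DE u v t : (u + v) t = u t + v t. Proof. by []. Qed.
Lemma L2ZE z u t : (z *: u) t = z * u t. Proof. by []. Qed.
Lemma L2NE u t : (- u) t = - u t. Proof. by []. Qed.

Lemma L2_ext u v : (forall t, u t = v t) -> u = v.
Proof. by move=> uv; apply: val_inj; exact: funext uv. Qed.

Lemma L2_sumE (I : Type) (s : seq I) (F : I -> L2) t :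
  (\sum_(i <- s) F i) t = \sum_(i <- s) F i t.
Proof. by elim/big_rec2 : _ => // i y u _ <-. Qed.

End SquareIntegrable.

(** * The inner product *)

Section InnerProduct.
Context {R : realType}.
Local Notation mu := (@lebesgue_measure R).
Local Notation Ipi := (@Ipi R).
Implicit Types (f g h : R -> R[i]) (z : R[i]) (u v w : @L2 R).

Lemma normsqE z : normsq z = Re (z * z^*).
Proof. by case: z => a b /=; rewrite /normsq /=; ring. Qed.

Lemma normr_Re_mulJ_le z (w : R[i]) : `|Re (z * w^*)| <= normsq z + normsq w.
Proof.
rewrite cReM cRe_conj cIm_conj /normsq mulrN opprK.
move: (Re z) (Im z) (Re w) (Im w) => a b c d.
have [h1 h2] := (sqr_ge0 (a + c), sqr_ge0 (b + d)).
have [h3 h4] := (sqr_ge0 (a - c), sqr_ge0 (b - d)).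
have [h5 h6] := (sqr_ge0 a, sqr_ge0 b); have [h7 h8] := (sqr_ge0 c, sqr_ge0 d).
by rewrite ler_norml; apply/andP; split; nra.
Qed.

Lemma normr_Im_mulJ_le z (w : R[i]) : `|Im (z * w^*)| <= normsq z + normsq w.
Proof.
rewrite cImM cRe_conj cIm_conj /normsq.
move: (Re z) (Im z) (Re w) (Im w) => a b c d.
have [h1 h2] := (sqr_ge0 (a + d), sqr_ge0 (b + c)).
have [h3 h4] := (sqr_ge0 (a - d), sqr_ge0 (b - c)).
have [h5 h6] := (sqr_ge0 a, sqr_ge0 b); have [h7 h8] := (sqr_ge0 c, sqr_ge0 d).
by rewrite ler_norml; apply/andP; split; nra.
Qed.

Lemma integrable_dominatedL2 f g (F : R -> R) : inL2 f -> inL2 g ->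
  measurable_fun Ipi F ->
  (forall t, Ipi t -> `|F t| <= normsq (f t) + normsq (g t)) ->
  mu.-integrable Ipi (EFin \o F).
Proof.
move=> f2 g2 mF Ffg.
have iG : mu.-integrable Ipi (fun t => (normsq (f t))%:E + (normsq (g t))%:E)%E.
  by apply: integrableD; [exact: measurable_Ipi|exact: inL2_integrable..].
apply: le_integrable iG; [exact: measurable_Ipi|exact/measurable_EFinP|].
move=> t It /=; rewrite lee_fin [leRHS]ger0_norm ?addr_ge0 ?sqr_ge0//.
exact: Ffg.
Qed.

Lemma integrable_Re_mulJ f g : inL2 f -> inL2 g ->
  mu.-integrable Ipi (EFin \o (fun t => Re (f t * (g t)^*))).
Proof.
move=> f2 g2; have [fr fi _] := f2; have [gr gi _] := g2.
apply: (integrable_dominatedL2 f2 g2) => [|t _]; last exact: normr_Re_mulJ_le.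
under eq_fun do rewrite cReM cRe_conj cIm_conj mulrN opprK.
by apply: measurable_funD; apply: measurable_funM.
Qed.

Lemma integrable_Im_mulJ f g : inL2 f -> inL2 g ->
  mu.-integrable Ipi (EFin \o (fun t => Im (f t * (g t)^*))).
Proof.
move=> f2 g2; have [fr fi _] := f2; have [gr gi _] := g2.
apply: (integrable_dominatedL2 f2 g2) => [|t _]; last exact: normr_Im_mulJ_le.
under eq_fun do rewrite cImM cRe_conj cIm_conj mulrN addrC.
by apply: measurable_funB; apply: measurable_funM.
Qed.

Lemma integrable_IpiZ (a : R) (F : R -> R) : mu.-integrable Ipi (EFin \o F) ->
  mu.-integrable Ipi (EFin \o (fun t => a * F t)).
Proof.
move=> iF; rewrite (_ : EFin \o _ = fun t => (a%:E * (EFin \o F) t)%E)//.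
by apply: integrableZl => //; exact: measurable_Ipi.
Qed.

Lemma integrable_IpiD (F G : R -> R) : mu.-integrable Ipi (EFin \o F) ->
  mu.-integrable Ipi (EFin \o G) ->
  mu.-integrable Ipi (EFin \o (fun t => F t + G t)).
Proof.
move=> iF iG; rewrite (_ : EFin \o _ = (EFin \o F) \+ (EFin \o G))%E//.
by apply: integrableD => //; exact: measurable_Ipi.
Qed.

Lemma RintegralDZ (a b : R) (F G H : R -> R) :
  mu.-integrable Ipi (EFin \o F) -> mu.-integrable Ipi (EFin \o G) ->
  mu.-integrable Ipi (EFin \o H) ->
  \int[mu]_(t in Ipi) (a * F t + b * G t + H t) =
  a * (\int[mu]_(t in Ipi) F t) + b * (\int[mu]_(t in Ipi) G t) +
  \int[mu]_(t in Ipi) H t.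
Proof.
move=> iF iG iH.
have [iaF ibG] := (integrable_IpiZ a iF, integrable_IpiZ b iG).
have iab := integrable_IpiD iaF ibG.
rewrite RintegralD//; last exact: measurable_Ipi.
rewrite RintegralD//; last exact: measurable_Ipi.
by rewrite !RintegralZl//; exact: measurable_Ipi.
Qed.

Definition ip u v : R[i] := innerL2 u v.
Definition nrm u : R := normL2 u.

Lemma Re_ip u v : Re (ip u v) = \int[mu]_(t in Ipi) Re (u t * (v t)^*).
Proof. by []. Qed.

Lemma Im_ip u v : Im (ip u v) = \int[mu]_(t in Ipi) Im (u t * (v t)^*).
Proof. by []. Qed.

Lemma ip_linearl z u v w : ip (z *: u + v) w = z * ip u w + ip v w.
Proof.
have [iR iI] := (integrable_Re_mulJ (L2P u) (L2P w), integrable_Im_mulJ (L2P u) (L2P w)).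
have [jR jI] := (integrable_Re_mulJ (L2P v) (L2P w), integrable_Im_mulJ (L2P v) (L2P w)).
case: z => a b; apply/eqP; rewrite eq_complex; apply/andP; split; apply/eqP.
  rewrite cReD cReM !Re_ip !Im_ip -mulNr [Re (_ +i* _)]/= [Im (_ +i* _)]/=.
  rewrite -RintegralDZ//; apply: eq_Rintegral => t _.
  by rewrite L2DE L2ZE mulrDl cReD -mulrA (cReM (_ +i* _)) mulNr.
rewrite cImD cImM !Re_ip !Im_ip [Re (_ +i* _)]/= [Im (_ +i* _)]/=.
rewrite -RintegralDZ//; apply: eq_Rintegral => t _.
by rewrite L2DE L2ZE mulrDl cImD -mulrA (cImM (_ +i* _)).
Qed.

Lemma ipC u v : ip v u = (ip u v)^*.
Proof.
apply/eqP; rewrite eq_complex /=; apply/andP; split; apply/eqP.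
  apply: eq_Rintegral => t _.
  by rewrite !cReM !cRe_conj !cIm_conj; ring.
rewrite -mulN1r -RintegralZl//; first last.
- exact: integrable_Im_mulJ (L2P u) (L2P v).
- exact: measurable_Ipi.
apply: eq_Rintegral => t _.
by rewrite !cImM !cRe_conj !cIm_conj; ring.
Qed.

Lemma ip_self u : ip u u = (nrm u ^+ 2)%:C.
Proof.
rewrite /nrm /normL2 sqr_sqrtr; last first.
  by apply: Rintegral_ge0 => t _; exact: normsq_ge0.
apply/eqP; rewrite eq_complex /=; apply/andP; split; apply/eqP.
  by apply: eq_Rintegral => t _; rewrite normsqE.
under eq_Rintegral do rewrite cImM cRe_conj cIm_conj mulrN mulrC addNr.
by rewrite Rintegral_cst; [rewrite mul0r|exact: measurable_Ipi].
Qed.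

Lemma nrm_ge0 u : 0 <= nrm u. Proof. exact: sqrtr_ge0. Qed.

End InnerProduct.


Section SemiInnerProduct.
Context {R : realType}.
Implicit Types (z : R[i]) (u v w : @L2 R).

Lemma ipDl u v w : ip (u + v) w = ip u w + ip v w.
Proof. by rewrite -[u]scale1r ip_linearl mul1r scale1r. Qed.

Lemma ip0l w : ip 0 w = 0.
Proof. by apply: (addrI (ip 0 w)); rewrite -ipDl !addr0. Qed.

Lemma ipZl z u w : ip (z *: u) w = z * ip u w.
Proof. by rewrite -[z *: u]addr0 ip_linearl ip0l addr0. Qed.

Lemma ipNl u w : ip (- u) w = - ip u w.
Proof. by rewrite -scaleN1r ipZl mulN1r. Qed.

Lemma ipBl u v w : ip (u - v) w = ip u w - ip v w.
Proof. by rewrite ipDl ipNl. Qed.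

Lemma ip_suml (I : Type) (s : seq I) (F : I -> L2) w :
  ip (\sum_(i <- s) F i) w = \sum_(i <- s) ip (F i) w.
Proof.
elim: s => [|i s IH]; first by rewrite !big_nil ip0l.
by rewrite !big_cons ipDl IH.
Qed.

Lemma ipDr u v w : ip w (u + v) = ip w u + ip w v.
Proof. by rewrite ipC ipDl [ip w u]ipC [ip w v]ipC rmorphD. Qed.

Lemma ipZr z u w : ip w (z *: u) = conjc z * ip w u.
Proof. by rewrite ipC ipZl [ip w u]ipC rmorphM. Qed.

Lemma ip_sumr (I : Type) (s : seq I) (F : I -> L2) w :
  ip w (\sum_(i <- s) F i) = \sum_(i <- s) ip w (F i).
Proof.
rewrite ipC ip_suml rmorph_sum; apply: eq_bigr => i _.
by rewrite [RHS]ipC.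
Qed.

Lemma sqr_nrm u : nrm u ^+ 2 = Re (ip u u).
Proof. by rewrite ip_self. Qed.

Lemma sqr_nrmD u v :
  nrm (u + v) ^+ 2 = nrm u ^+ 2 + 2 * Re (ip u v) + nrm v ^+ 2.
Proof.
rewrite !sqr_nrm ipDl !ipDr !cReD [ip v u]ipC cRe_conj; ring.
Qed.

Definition cabs z : R := Num.sqrt (normsq z).

Lemma cabs_ge0 z : 0 <= cabs z. Proof. exact: sqrtr_ge0. Qed.

Lemma sqr_cabs z : cabs z ^+ 2 = normsq z.
Proof. by rewrite sqr_sqrtr// normsq_ge0. Qed.

Lemma cabsM z z' : cabs (z * z') = cabs z * cabs z'.
Proof. by rewrite /cabs normsqM sqrtrM ?normsq_ge0. Qed.

Lemma cabsR (a : R) : cabs a%:C = `|a|.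
Proof. by rewrite /cabs /normsq /= expr0n addr0 sqrtr_sqr. Qed.

Lemma cabs0 : cabs 0 = 0. Proof. by rewrite (cabsR 0) normr0. Qed.
Lemma cabs1 : cabs 1 = 1. Proof. by rewrite (cabsR 1) normr1. Qed.

Lemma cabs_eq0 z : (cabs z == 0) = (z == 0).
Proof.
apply/eqP/eqP => [z0|->]; last exact: cabs0.
have : normsq z == 0 by rewrite -sqr_cabs z0 expr0n.
case: z {z0} => a b; rewrite /normsq /= paddr_eq0 ?sqr_ge0// !sqrf_eq0.
by move=> /andP[/eqP -> /eqP ->].
Qed.

Lemma cabsV z : cabs z^-1 = (cabs z)^-1.
Proof.
have [->|z0] := eqVneq z 0; first by rewrite invr0 cabs0 invr0.
have c0 : cabs z != 0 by rewrite cabs_eq0.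
by apply: (mulfI c0); rewrite -cabsM !divff// cabs1.
Qed.

Lemma Re_le_cabs z : `|Re z| <= cabs z.
Proof.
by rewrite -(ler_pXn2r (_ : (0 < 2)%N)) ?nnegrE ?normr_ge0 ?cabs_ge0//
  sqr_cabs real_normK ?num_real// /normsq lerDl sqr_ge0.
Qed.

Lemma Im_le_cabs z : `|Im z| <= cabs z.
Proof.
by rewrite -(ler_pXn2r (_ : (0 < 2)%N)) ?nnegrE ?normr_ge0 ?cabs_ge0//
  sqr_cabs real_normK ?num_real// /normsq lerDr sqr_ge0.
Qed.

Lemma mulcJ z : z * conjc z = (normsq z)%:C.
Proof.
case: z => a b; apply/eqP; rewrite eq_complex /normsq /=.
by apply/andP; split; apply/eqP; ring.
Qed.

Lemma nrmZ z u : nrm (z *: u) = cabs z * nrm u.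
Proof.
apply/eqP; rewrite -(eqrXn2 (_ : 0 < 2)%N) ?mulr_ge0 ?nrm_ge0 ?cabs_ge0//.
rewrite exprMn sqr_nrm ipZl ipZr mulrA mulcJ ip_self sqr_cabs.
by rewrite cReM /= mulr0 subr0.
Qed.

Lemma nrm0 : nrm (0 : @L2 R) = 0.
Proof. by apply/eqP; rewrite -sqrf_eq0 sqr_nrm ip0l. Qed.

Lemma nrmN u : nrm (- u) = nrm u.
Proof. by rewrite -scaleN1r nrmZ -(rmorphN1 (real_complex R)) cabsR normrN1 mul1r. Qed.

Lemma nrmB u v : nrm (u - v) = nrm (v - u).
Proof. by rewrite -nrmN opprB. Qed.

(** The nonnegative quadratic polynomial [s |-> nrm (u - s * ip u v *: v) ^+ 2]
    has a nonpositive discriminant. *)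
Lemma cauchy_schwarz u v : normsq (ip u v) <= nrm u ^+ 2 * nrm v ^+ 2.
Proof.
have H s : 0 <= nrm u ^+ 2 - 2 * s * normsq (ip u v) + s ^+ 2 * normsq (ip u v) * nrm v ^+ 2.
  have := sqr_ge0 (nrm (u + ((- s)%:C * ip u v) *: v)).
  rewrite sqr_nrmD nrmZ cabsM exprMn exprMn cabsR real_normK ?num_real// sqr_cabs sqrrN.
  have -> : ip u (((- s)%:C * ip u v) *: v) = (- s * normsq (ip u v))%:C.
    rewrite ipZr; case: (ip u v) => a b; apply/eqP; rewrite eq_complex /normsq /=.
    by apply/andP; split; apply/eqP; ring.
  move=> h; apply: le_trans h _; rewrite le_eqVlt; apply/orP; left; apply/eqP.
  by rewrite /=; ring.
(* If [nrm v = 0] the polynomial is affine, and negative at the point below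
   unless its slope vanishes. *)
have [v0|v0] := eqVneq (nrm v) 0.
  have [->|u0] := eqVneq (normsq (ip u v)) 0; first by rewrite mulr_ge0 ?sqr_ge0.
  have := H ((nrm u ^+ 2 + 1) / (2 * normsq (ip u v))).
  rewrite v0 expr0n /= mulr0 addr0.
  have -> : 2 * ((nrm u ^+ 2 + 1) / (2 * normsq (ip u v))) * normsq (ip u v) =
    nrm u ^+ 2 + 1 by field.
  by rewrite opprD addrA subrr sub0r ler0N1.
have := H (nrm v ^- 2).
have vp : 0 < nrm v ^+ 2 by rewrite exprn_gt0// lt_neqAle eq_sym v0 nrm_ge0.
have -> : nrm u ^+ 2 - 2 * nrm v ^- 2 * normsq (ip u v) +
    nrm v ^- 2 ^+ 2 * normsq (ip u v) * nrm v ^+ 2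
  = nrm u ^+ 2 - normsq (ip u v) / nrm v ^+ 2 by field.
by rewrite subr_ge0 ler_pdivrMr.
Qed.

Lemma cabs_ip_le u v : cabs (ip u v) <= nrm u * nrm v.
Proof.
by rewrite -(ler_pXn2r (_ : (0 < 2)%N)) ?nnegrE ?mulr_ge0 ?nrm_ge0 ?cabs_ge0//
  sqr_cabs exprMn cauchy_schwarz.
Qed.

Lemma nrmD_le u v : nrm (u + v) <= nrm u + nrm v.
Proof.
rewrite -(ler_pXn2r (_ : (0 < 2)%N)) ?nnegrE ?addr_ge0 ?nrm_ge0//.
rewrite sqr_nrmD sqrrD lerD2r lerD2l -[_ * _ *+ 2]mulr_natl ler_pM2l//.
exact: le_trans (ler_norm _) (le_trans (Re_le_cabs _) (cabs_ip_le _ _)).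
Qed.

Lemma nrm_triangle w u v : nrm (u - v) <= nrm (u - w) + nrm (w - v).
Proof. by rewrite -[u - v](subrKA w) nrmD_le. Qed.

End SemiInnerProduct.

(** * Completeness of the space of square-integrable functions *)

Section Completeness.
Context {R : realType}.
Local Notation mu := (@lebesgue_measure R).
Local Notation Ipi := (@Ipi R).
Implicit Types (u v w : @L2 R).

Lemma sqr_nrm_integral u :
  (nrm u ^+ 2)%:E = (\int[mu]_(t in Ipi) (normsq (u t))%:E)%E.
Proof.
have [_ _ fin] := L2P u.
rewrite /nrm /normL2 sqr_sqrtr; last first.
  by apply: Rintegral_ge0 => t _; exact: normsq_ge0.
rewrite /Rintegral fineK// ge0_fin_numE//.
by apply: integral_ge0 => t _; rewrite lee_fin normsq_ge0.
Qed.

(** The nested intervals [[r j - 2 c q^j, r j + 2 c q^j]] with [q = 1/2] have a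
    common point. *)
Lemma geometric_cauchy (r : nat -> R) (c : R) :
  (forall j, `|r j.+1 - r j| <= c * 2^-1 ^+ j) ->
  exists l, forall j, `|r j - l| <= 2 * c * 2^-1 ^+ j.
Proof.
move=> rc; pose e j : R := 2 * c * 2^-1 ^+ j.
have eS j : e j.+1 = e j - c * 2^-1 ^+ j by rewrite /e exprS; field.
have loS j : r j - e j <= r j.+1 - e j.+1.
  by rewrite eS; have := rc j; rewrite ler_norml => /andP[h1 h2]; lra.
have hiS j : r j.+1 + e j.+1 <= r j + e j.
  by rewrite eS; have := rc j; rewrite ler_norml => /andP[h1 h2]; lra.
have c0 : 0 <= c.
  by have := le_trans (normr_ge0 _) (rc 0%N); rewrite expr0 mulr1.
have e0 j : 0 <= e j by rewrite !mulr_ge0// exprn_ge0.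
have lo : nondecreasing_seq (fun j => r j - e j) by apply/nondecreasing_seqP.
have hi : nonincreasing_seq (fun j => r j + e j) by apply/nonincreasing_seqP.
have lohi i j : r i - e i <= r j + e j.
  apply: (@le_trans _ _ (r (maxn i j) - e (maxn i j))); first exact: lo (leq_maxl _ _).
  apply: (@le_trans _ _ (r (maxn i j) + e (maxn i j))); last exact: hi (leq_maxr _ _).
  by have := e0 (maxn i j); lra.
pose S := range (fun j => r j - e j).
have S0 : S !=set0 by exists (r 0%N - e 0%N), 0%N.
have Sub j : ubound S (r j + e j) by move=> _ [i _ <-].
have hS : has_sup S by split => //; exists (r 0%N + e 0%N); exact: Sub.
exists (sup S) => j; rewrite ler_norml.
have h1 : r j - e j <= sup S by apply: sup_upper_bound => //; exists j.
have h2 : sup S <= r j + e j by apply: ge_sup => //; exact: Sub.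
by rewrite -/(e j); apply/andP; split; lra.
Qed.

Lemma geometric_cvg (r : nat -> R) (c l : R) :
  (forall j, `|r j - l| <= c * 2^-1 ^+ j) -> r @ \oo --> l.
Proof.
move=> rc; apply/cvgrPdist_le => e e0.
have : (fun j => c * 2^-1 ^+ j) @ \oo --> (0 : R).
  rewrite -[0](mulr0 c); apply: cvgMr; apply: cvg_expr.
  by rewrite ger0_norm// invf_lt1// ltr1n.
move=> /cvgrPdist_le /(_ _ e0); apply: filterS => j.
rewrite sub0r normrN distrC => h; apply: le_trans (rc j) _.
exact: le_trans (ler_norm _) h.
Qed.

Lemma nrm_ae_le u (G : R -> \bar R) (N : set R) :
  measurable_fun Ipi G -> (forall t, Ipi t -> (0 <= G t)%E) ->
  measurable N -> mu N = 0%E ->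
  (forall t, Ipi t -> ~ N t -> ((normsq (u t))%:E <= G t)%E) ->
  ((nrm u ^+ 2)%:E <= \int[mu]_(t in Ipi) G t)%E.
Proof.
move=> mG G0 mN N0 uG; rewrite sqr_nrm_integral.
have [mr mi _] := L2P u.
apply: ae_ge0_le_integral => //.
- exact: measurable_Ipi.
- by move=> t _; rewrite lee_fin normsq_ge0.
- by apply/measurable_EFinP; apply: measurable_normsq.
- exists N; split => // t /= /not_implyP[It]; apply: contra_notP => Nt.
  exact: uG.
Qed.

Lemma normsqB_le (z w : R[i]) (c : R) :
  `|Re z - Re w| <= c -> `|Im z - Im w| <= c -> normsq (z - w) <= 2 * c ^+ 2.
Proof.
move=> h1 h2; have c0 := le_trans (normr_ge0 _) h1.
rewrite /normsq; have -> : Re (z - w) = Re z - Re w by case: z w {h1 h2} => [? ?] [].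
have -> : Im (z - w) = Im z - Im w by case: z w {h1 h2} => [? ?] [].
rewrite -[X in X + _]real_normK ?num_real// -[X in _ + X]real_normK ?num_real//.
rewrite mulr_natl mulr2n.
by apply: lerD; rewrite ler_pXn2r ?nnegrE.
Qed.

(** Riesz and Fischer. The weights [4 ^+ i] make the sum [S] of the squared
    increments integrable although they grow; where [S] is finite the increments are
    bounded by a geometric sequence, so [u] converges almost everywhere, with an
    error controlled by [S] that can be integrated. *)
Lemma L2_complete (u : nat -> @L2 R) :
  (forall j, nrm (u j.+1 - u j) <= 4^-1 ^+ j) ->
  exists w K, forall j, nrm (u j - w) <= K * 2^-1 ^+ j.
Proof.
move=> uC; pose d (i : nat) (t : R) : R := 4 ^+ i * normsq ((u i.+1 - u i) t).
have mRe v : measurable_fun Ipi (fun t => Re (v t)) by have [] := L2P v.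
have mIm v : measurable_fun Ipi (fun t => Im (v t)) by have [] := L2P v.
have d0 i t : 0 <= d i t by rewrite mulr_ge0 ?exprn_ge0 ?normsq_ge0.
have md i : measurable_fun Ipi (EFin \o d i).
  apply/measurable_EFinP; apply: measurable_funM; first exact: measurable_cst.
  exact: measurable_normsq.
pose S t := (\sum_(i <oo) (EFin \o d i) t)%E.
have mS : measurable_fun Ipi S.
  apply: (@ge0_emeasurable_sum _ _ _ _ (fun i => EFin \o d i) xpredT) => // i t _ _.
  by rewrite lee_fin.
have S0 t : (0 <= S t)%E by apply: nneseries_ge0 => i _ _; rewrite lee_fin.
have intd i : (\int[mu]_(t in Ipi) (d i t)%:E <= (4^-1 ^+ i)%:E)%E.
  under eq_integral do rewrite EFinM.
  rewrite ge0_integralZl_EFin ?exprn_ge0//; first last.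
  - by apply/measurable_EFinP; apply: measurable_normsq.
  - by move=> t _; rewrite lee_fin normsq_ge0.
  - exact: measurable_Ipi.
  rewrite -sqr_nrm_integral -EFinM lee_fin.
  apply: (@le_trans _ _ (4 ^+ i * (4^-1 ^+ i) ^+ 2)).
    by rewrite ler_pM2l ?exprn_gt0// ler_pXn2r ?nnegrE ?nrm_ge0 ?exprn_ge0.
  by rewrite expr2 mulrA -exprMn divff ?pnatr_eq0// expr1n mul1r.
have intS : (\int[mu]_(t in Ipi) S t <= 2%:E)%E.
  rewrite integral_nneseries//; first last.
  - by move=> i t _; rewrite lee_fin.
  - exact: measurable_Ipi.
  apply: lime_le.
    by apply: is_cvg_nneseries => i _ _; apply: integral_ge0 => t _; rewrite lee_fin.
  apply: nearW => n; apply: le_trans (lee_sum _ (fun i _ => intd i)) _.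
  rewrite sumEFin lee_fin.
  suff -> : \sum_(0 <= i < n) 4^-1 ^+ i = 4 / 3 * (1 - 4^-1 ^+ n) :> R.
    have : 0 <= (4^-1 : R) ^+ n by rewrite exprn_ge0.
    lra.
  elim: n => [|n IH]; first by rewrite big_geq// expr0 subrr mulr0.
  by rewrite big_nat_recr//= IH exprS; field.
have iS : mu.-integrable Ipi S.
  apply/integrableP; split => //.
  under eq_integral do rewrite gee0_abs//.
  by apply: le_lt_trans intS _; rewrite ltry.
have [|N [mN N0 subN]] := integrable_ae _ iS; first exact: measurable_Ipi.
have fS t : Ipi t -> ~ N t -> S t \is a fin_num.
  by move=> It Nt; apply: contrapT => h; apply: Nt; apply: subN => /(_ It).
pose c t := Num.sqrt (fine (S t)).
have dS t i : Ipi t -> ~ N t -> d i t <= fine (S t).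
  move=> It Nt; rewrite -lee_fin fineK ?fS//.
  apply: le_trans (nneseries_lim_ge i.+1 _); last by move=> *; rewrite lee_fin.
  rewrite big_nat_recr//= leeDr//.
  by apply: sume_ge0 => j _; rewrite lee_fin.
have cabs_le t i : Ipi t -> ~ N t -> cabs ((u i.+1 - u i) t) <= c t * 2^-1 ^+ i.
  move=> It Nt; rewrite -(ler_pXn2r (_ : (0 < 2)%N)) ?nnegrE ?cabs_ge0//; last first.
    by rewrite mulr_ge0 ?sqrtr_ge0 ?exprn_ge0.
  rewrite sqr_cabs exprMn sqr_sqrtr ?fine_ge0// -exprM mulnC exprM.
  have -> : (2^-1 ^+ 2 : R) = 4^-1 by field.
  rewrite exprVn ler_pdivlMr ?exprn_gt0// mulrC; exact: dS.
pose G := ~` N.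
pose hr j := (fun t => Re (u j t)) \_ G.
pose hi j := (fun t => Im (u j t)) \_ G.
have lim_of (h : nat -> R -> R) :
    (forall t j, Ipi t -> ~ N t -> `|h j.+1 t - h j t| <= c t * 2^-1 ^+ j) ->
    (forall j, measurable_fun Ipi (h j)) ->
    exists2 l : R -> R, measurable_fun Ipi l &
      forall t j, Ipi t -> ~ N t -> `|h j t - l t| <= 2 * c t * 2^-1 ^+ j.
  move=> hc mh.
  have hex t : exists l, Ipi t -> ~ N t -> forall j, `|h j t - l| <= 2 * c t * 2^-1 ^+ j.
    have [[It Nt]|h0] := pselect (Ipi t /\ ~ N t).
      by have [l lP] := geometric_cauchy (fun j => hc t j It Nt); exists l.
    by exists 0 => It Nt; case: h0.
  have [l lP] := choice hex.
  exists (l \_ G); last first.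
    by move=> t j It Nt; rewrite patchE mem_set//; exact: lP.
  apply: (@measurable_fun_cvg _ _ _ _ (fun j => h j \_ G)) => [j|t It].
    apply: (measurable_restrict (h j) _ _).1.
    - exact: measurableC.
    - exact: measurable_Ipi.
    - by apply: measurable_funS (mh j) => //; exact: measurable_Ipi.
  rewrite patchE; case: ifPn => [/set_mem Gt|Gt].
    apply: (@geometric_cvg _ (2 * c t)) => j; rewrite patchE mem_set//.
    exact: lP.
  rewrite (_ : (fun _ => _) = fun=> 0); first exact: cvg_cst.
  by apply/funext => j; rewrite patchE (negbTE Gt).
have [|//|lr mlr lrP] := lim_of (fun j t => Re (u j t)).
  move=> t j It Nt; apply: le_trans (cabs_le t j It Nt).
  apply: le_trans (Re_le_cabs _).
  by rewrite L2DE L2NE; case: (u j.+1 t) (u j t) => [? ?] [].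
have [|//|li mli liP] := lim_of (fun j t => Im (u j t)).
  move=> t j It Nt; apply: le_trans (cabs_le t j It Nt).
  apply: le_trans (Im_le_cabs _).
  by rewrite L2DE L2NE; case: (u j.+1 t) (u j t) => [? ?] [].
pose w t := lr t +i* li t.
have wP t j : Ipi t -> ~ N t ->
    ((normsq (u j t - w t))%:E <= (8 * (4^-1 ^+ j))%:E * S t)%E.
  move=> It Nt; rewrite -[S t]fineK ?fS// -EFinM lee_fin.
  have -> : 8 * 4^-1 ^+ j * fine (S t) = 2 * (2 * c t * 2^-1 ^+ j) ^+ 2.
    rewrite !exprMn sqr_sqrtr ?fine_ge0// -exprM mulnC exprM.
    have -> : (2^-1 ^+ 2 : R) = 4^-1 by field.
    ring.
  by apply: normsqB_le; [exact: lrP|exact: liP].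
have mS' j : measurable_fun Ipi (fun t => (8 * (4^-1 ^+ j))%:E * S t)%E.
  exact: measurable_funeM.
have S'0 j t : Ipi t -> (0 <= (8 * (4^-1 ^+ j))%:E * S t)%E.
  by move=> _; rewrite mule_ge0// lee_fin mulr_ge0// exprn_ge0.
have intS' j : (\int[mu]_(t in Ipi) ((8 * (4^-1 ^+ j))%:E * S t) <= (16 * 4^-1 ^+ j)%:E)%E.
  rewrite ge0_integralZl_EFin//; [|exact: measurable_Ipi].
  apply: (@le_trans _ _ ((8 * 4^-1 ^+ j)%:E * 2%:E)%E).
    by rewrite lee_pmul2l// ?lte_fin ?mulr_gt0// ?exprn_gt0 ?invr_gt0.
  by rewrite -EFinM lee_fin le_eqVlt; apply/orP; left; apply/eqP; ring.
have mr j : measurable_fun Ipi (fun t => Re (u j t - w t)).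
  rewrite (_ : (fun _ => _) = (fun t => Re (u j t)) \- lr); first exact: measurable_funB.
  by apply/funext => t /=; case: (u j t).
have mi j : measurable_fun Ipi (fun t => Im (u j t - w t)).
  rewrite (_ : (fun _ => _) = (fun t => Im (u j t)) \- li); first exact: measurable_funB.
  by apply/funext => t /=; case: (u j t).
have uw2 : inL2 (fun t => u 0%N t - w t).
  split=> //; apply: le_lt_trans (ltry (16 * 4^-1 ^+ 0)).
  apply: le_trans (intS' 0%N); apply: ae_ge0_le_integral => //.
  - exact: measurable_Ipi.
  - by move=> t _; rewrite lee_fin normsq_ge0.
  - by apply/measurable_EFinP; apply: measurable_normsq.
  - exact: S'0.
  - exact: mS'.
  - exists N; split => // t /= /not_implyP[It]; apply: contra_notP => Nt.
    exact: wP.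
exists (u 0%N - toL2 uw2), 4 => j.
rewrite -(ler_pXn2r (_ : (0 < 2)%N)) ?nnegrE ?nrm_ge0 ?mulr_ge0 ?exprn_ge0//.
rewrite exprMn -exprM mulnC exprM.
have -> : (2^-1 ^+ 2 : R) = 4^-1 by field.
have -> : (4 ^+ 2 : R) = 16 by ring.
rewrite -lee_fin; apply: le_trans (intS' j).
apply: (@nrm_ae_le _ _ N) => //; first exact: S'0.
move=> t It Nt.
have -> : (u j - (u 0%N - toL2 uw2)) t = u j t - w t.
  by rewrite !(L2DE, L2NE) /=; ring.
exact: wP.
Qed.

End Completeness.

(** * Exponentials and their inner products *)

Section Exponentials.
Context {R : realType}.
Local Notation mu := (@lebesgue_measure R).
Local Notation Ipi := (@Ipi R).
Implicit Types (a b c k l t x y : R) (u v w : @L2 R).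

Lemma Rintegral_FTC (f F : R -> R) x y : x < y -> continuous f ->
  (forall t, is_derive t 1 F (f t)) ->
  \int[mu]_(t in `]x, y[) f t = F y - F x.
Proof.
move=> xy cf dF.
have dF1 t : derivable F t 1 by have [] := dF t.
have cF : continuous F by move=> t; apply/differentiable_continuous/derivable1_diffP.
have cwf : {within `[x, y], continuous f} by exact: continuous_subspaceT.
have E : (\int[mu]_(t in `[x, y]) (f t)%:E = (F y)%:E - (F x)%:E)%E.
  apply: continuous_FTC2 => //; last by move=> t _; rewrite derive1E; case: (dF t).
  by split => //; [exact/cvg_at_right_filter/cF|exact/cvg_at_left_filter/cF].
have mf A : measurable_fun A (EFin \o f).
  by apply/measurable_EFinP; apply: measurable_funTS; exact: continuous_measurable_fun.
rewrite /Rintegral integral_itv_bndo_bndc; last exact: mf.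
by rewrite integral_itv_obnd_cbnd ?E -?EFinB//; exact: mf.
Qed.

Lemma is_derive_scale (f df : R -> R) k t :
  (forall x, is_derive x 1 f (df x)) ->
  is_derive t 1 (fun t => f (k * t)) (k * df (k * t)).
Proof.
move=> fdf; rewrite [X in is_derive _ _ X](_ : _ = f \o (k \*: id))//.
have h1 := fdf ((k \*: id) t).
have h2 : is_derive t 1 (k \*: id) (k *: 1) := is_deriveZ _ (is_derive_id _ _).
have := is_derive1_comp h1 h2.
by rewrite /GRing.scale /= mulr1 mulrC.
Qed.

Lemma is_derive_cmul (f : R -> R) c t d :
  is_derive t 1 f d -> is_derive t 1 (fun t => c * f t) (c * d).
Proof. by move=> fd; exact: (is_deriveZ c fd). Qed.

Lemma continuous_scale (f : R -> R) k : continuous f -> continuous (fun t => f (k * t)).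
Proof.
move=> cf t; apply: (@continuous_comp _ _ _ (fun t => k * t) f).
  exact: mulrl_continuous.
exact: cf.
Qed.

Lemma Rintegral_cos k x y : k != 0 -> x < y ->
  \int[mu]_(t in `]x, y[) cos (k * t) = (sin (k * y) - sin (k * x)) / k.
Proof.
move=> k0 xy.
have dF t : is_derive t 1 (fun t => k^-1 * sin (k * t)) (cos (k * t)).
  have := is_derive_cmul k^-1 (is_derive_scale k t (@is_derive_sin R)).
  by rewrite mulKf.
rewrite (Rintegral_FTC xy (continuous_scale (@continuous_cos R)) dF).
by rewrite -mulrBr mulrC.
Qed.

Lemma Rintegral_sin k x y : k != 0 -> x < y ->
  \int[mu]_(t in `]x, y[) sin (k * t) = (cos (k * x) - cos (k * y)) / k.
Proof.
move=> k0 xy.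
have dF t : is_derive t 1 (fun t => - k^-1 * cos (k * t)) (sin (k * t)).
  have := is_derive_cmul (- k^-1) (is_derive_scale k t (@is_derive_cos R)).
  by rewrite [X in is_derive _ _ _ X](_ : _ = sin (k * t))//=; field.
rewrite (Rintegral_FTC xy (continuous_scale (@continuous_sin R)) dF).
by ring.
Qed.

Lemma normsq_expi a t : normsq (expi a t) = 1.
Proof. by rewrite /normsq /= cos2Dsin2. Qed.

Lemma expi_mulJ a b t : expi a t * (expi b t)^* = expi (a - b) t.
Proof.
rewrite /expi; apply/eqP; rewrite eq_complex /= mulrBl cosB sinB.
by apply/andP; split; apply/eqP; ring.
Qed.

Lemma expiD a b t : expi (a + b) t = expi a t * expi b t.
Proof.
rewrite /expi; apply/eqP; rewrite eq_complex /= mulrDl cosD sinD.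
by apply/andP; split; apply/eqP; ring.
Qed.

Lemma measurable_cos_scale a A : measurable_fun A (fun t : R => cos (a * t)).
Proof.
apply: measurable_funTS; apply: continuous_measurable_fun.
by apply: continuous_scale; exact: continuous_cos.
Qed.

Lemma measurable_sin_scale a A : measurable_fun A (fun t : R => sin (a * t)).
Proof.
apply: measurable_funTS; apply: continuous_measurable_fun.
by apply: continuous_scale; exact: continuous_sin.
Qed.

Lemma inL2_expi a : inL2 (expi a).
Proof.
apply: (@inL2_bounded _ _ 1); first exact: measurable_cos_scale.
  exact: measurable_sin_scale.
by move=> t _; rewrite normsq_expi.
Qed.

Definition expL2 a : L2 := toL2 (inL2_expi a).

Definition sinc k : R := if k == 0 then 1 else sin (pi * k) / (pi * k).

Lemma ip_expL2 a b : ip (expL2 a) (expL2 b) = (2 * pi * sinc (a - b))%:C.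
Proof.
have npi : - pi < pi :> R by rewrite gtrN ?pi_gt0.
have pi0 : pi != 0 :> R by rewrite gt_eqF ?pi_gt0.
apply/eqP; rewrite eq_complex; apply/andP; split; apply/eqP.
  rewrite Re_ip; under eq_Rintegral do rewrite expi_mulJ /=.
  rewrite /sinc; case: eqVneq => [->|k0].
    under eq_Rintegral do rewrite mul0r cos0.
    rewrite Rintegral_cst; last exact: measurable_Ipi.
    by rewrite [fine _](congr1 fine lebesgue_Ipi) /= mul1r mulr1 mulr_natl.
  rewrite Rintegral_cos// mulrN sinN [pi * _]mulrC [RHS]/=.
  by move: (pi) pi0 => p p0; field; rewrite p0 k0.
rewrite Im_ip; under eq_Rintegral do rewrite expi_mulJ /=.
have [->|k0] := eqVneq (a - b) 0.
  under eq_Rintegral do rewrite mul0r sin0.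
  by rewrite Rintegral_cst ?mul0r//; exact: measurable_Ipi.
by rewrite Rintegral_sin// mulrN cosN subrr mul0r.
Qed.

Lemma sqr_nrm_le u (M : R) : (forall t, Ipi t -> normsq (u t) <= M) ->
  nrm u ^+ 2 <= M * (2 * pi).
Proof.
move=> uM; rewrite -lee_fin; have [mr mi _] := L2P u.
have m0 : 0 <= M.
  apply: le_trans (uM 0 _); rewrite ?normsq_ge0//.
  by rewrite /Defs.Ipi /= in_itv /= oppr_lt0 pi_gt0.
apply: le_trans (@nrm_ae_le _ u (cst M%:E) set0 _ _ _ _ _) _ => //.
- by move=> t It _; rewrite lee_fin uM.
rewrite integral_cst; last exact: measurable_Ipi.
have -> : (2 * pi : R) = pi *+ 2 by rewrite mulr_natl.
rewrite EFinM; exact: (eq_ind_r (fun m => (_ * m <= _)%E) (lexx _) lebesgue_Ipi).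
Qed.

Lemma inL2_trunc a b : inL2 (fun t => if t < b then expi a t else 0).
Proof.
have mb : measurable_fun Ipi (fun t => t < b).
  by apply: measurable_fun_ltr; [exact: measurable_id|exact: measurable_cst].
apply: (@inL2_bounded _ _ 1).
- rewrite (_ : (fun _ => _) = fun t => if t < b then cos (a * t) else 0).
    apply: measurable_fun_if => //; first exact: measurable_Ipi.
      exact: measurable_cos_scale.
  by apply/funext => t; case: ifP.
- rewrite (_ : (fun _ => _) = fun t => if t < b then sin (a * t) else 0).
    apply: measurable_fun_if => //; first exact: measurable_Ipi.
      exact: measurable_sin_scale.
  by apply/funext => t; case: ifP.
- by move=> t _; case: ifP; rewrite ?normsq_expi// /normsq /= expr0n addr0.
Qed.

(** Integration of a product over [[-pi, b[] becomes an inner product with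
    [trunc_expL2 a b], so that it is controlled by the Cauchy-Schwarz
    inequality. *)
Definition trunc_expL2 a b : L2 := toL2 (inL2_trunc a b).

Lemma ip_trunc_expL2 a b c : a != b -> Ipi c ->
  ip (expL2 a) (trunc_expL2 b c) =
    (0 -i* (a - b)^-1) * (expi (a - b) c - expi (a - b) (- pi)).
Proof.
move=> ab; rewrite /Defs.Ipi /= in_itv /= => /andP[pc cpi].
have k0 : a - b != 0 by rewrite subr_eq0.
have cut (f : R -> R) : \int[mu]_(t in Ipi) (if t < c then f t else 0) =
    \int[mu]_(t in `]- pi, c[) f t.
  have -> : [set` `]- pi, c[] = Ipi `&` [set t | t < c].
    apply/seteqP; split=> t; rewrite /Defs.Ipi /= !in_itv /=.
      by move=> /andP[-> tc]; rewrite tc (lt_trans tc).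
    by move=> [/andP[-> _] ->].
  rewrite Rintegral_mkcondr; apply: eq_Rintegral => t _.
  by rewrite patchE; case: ifPn => tc; [rewrite mem_set|rewrite memNset//; exact/negP].
apply/eqP; rewrite eq_complex; apply/andP; split; apply/eqP.
  rewrite Re_ip; transitivity (\int[mu]_(t in Ipi) (if t < c then cos ((a - b) * t) else 0)).
    apply: eq_Rintegral => t _ /=; case: ifP => _; last by rewrite rmorph0 mulr0.
    by rewrite (expi_mulJ a b t).
  rewrite cut Rintegral_cos//= /expi; field; exact: k0.
rewrite Im_ip; transitivity (\int[mu]_(t in Ipi) (if t < c then sin ((a - b) * t) else 0)).
  apply: eq_Rintegral => t _ /=; case: ifP => _; last by rewrite rmorph0 mulr0.
  by rewrite (expi_mulJ a b t).
by rewrite cut Rintegral_sin//= /expi; field; exact: k0.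
Qed.

Lemma nrm_trunc_expL2 a b : nrm (trunc_expL2 a b) ^+ 2 <= 2 * pi.
Proof.
rewrite -[leRHS]mul1r; apply: sqr_nrm_le => t _ /=.
by case: ifP; rewrite ?normsq_expi// /normsq /= expr0n addr0.
Qed.

End Exponentials.

(** * Fejer kernels and interpolation *)

Section Fejer.
Context {R : realType}.
Implicit Types (x y t a : R) (N : nat).

Definition cis x : R[i] := cos x +i* sin x.

Lemma cisD x y : cis (x + y) = cis x * cis y.
Proof.
rewrite /cis cosD sinD; apply/eqP; rewrite eq_complex /=.
by apply/andP; split; apply/eqP; ring.
Qed.

Lemma cis0 : cis 0 = 1.
Proof. by rewrite /cis cos0 sin0. Qed.

Lemma cisMn x n : cis (x *+ n) = cis x ^+ n.
Proof. by elim: n => [|n IH]; rewrite ?cis0// mulrS exprS cisD IH. Qed.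

Lemma conj_cis x : (cis x)^* = cis (- x).
Proof. by rewrite /cis cosN sinN. Qed.

Lemma cis2pi : cis (2 * pi) = 1.
Proof. by rewrite mulr_natl /cis cos2pi sin2pi. Qed.

Lemma normsq_sub1_cis x : normsq (1 - cis x) = 2 - 2 * cos x.
Proof.
rewrite /normsq /cis /=.
have h := cos2Dsin2 x.
have -> : (1 - cos x) ^+ 2 + (0 - sin x) ^+ 2 =
  1 - 2 * cos x + (cos x ^+ 2 + sin x ^+ 2) by ring.
by rewrite h; ring.
Qed.

Lemma cos_lt1 x : 0 < x < 2 * pi -> cos x < 1.
Proof.
move=> /andP[x0 x2]; have -> : x = (x / 2) *+ 2 by rewrite mulr2n -splitr.
have s0 : 0 < sin (x / 2).
  by apply: sin_gt0_pi; rewrite divr_gt0//= ltr_pdivrMr// mulrC.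
rewrite cos_mulr2n; have := cos2Dsin2 (x / 2).
have : 0 < sin (x / 2) ^+ 2 by rewrite exprn_gt0.
by move: (cos _ ^+ 2) (sin _ ^+ 2) => p q; lra.
Qed.

Lemma sum_cis_roots (N m : nat) : (0 < m < N)%N ->
  \sum_(j < N) cis (2 * pi * m%:R / N%:R * j%:R) = 0.
Proof.
move=> /andP[m0 mN]; have N0 : (0 < N)%N by exact: leq_ltn_trans mN.
have NR : N%:R != 0 :> R by rewrite pnatr_eq0 -lt0n.
set th := 2 * pi * m%:R / N%:R.
have -> : \sum_(j < N) cis (th * j%:R) = \sum_(j < N) cis th ^+ j.
  by apply: eq_bigr => j _; rewrite mulr_natr cisMn.
have wN : cis th ^+ N = 1.
  rewrite -cisMn -mulr_natr /th divfK// mulr_natr cisMn cis2pi expr1n//.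
have w1 : cis th - 1 != 0.
  rewrite subr_eq0; apply/eqP => w1.
  have : cos th < 1.
    apply: cos_lt1; rewrite /th; apply/andP; split.
      by rewrite !(divr_gt0, mulr_gt0)// ?pi_gt0 ?ltr0n.
    rewrite ltr_pdivrMr ?ltr0n// ltr_pM2l ?ltr_nat//.
    by rewrite mulr_gt0// pi_gt0.
  have -> : cos th = Re (cis th) by [].
  by rewrite w1 /= ltxx.
by apply: (mulfI w1); rewrite -subrX1 wN subrr mulr0.
Qed.

(** The Fejer kernel, up to normalisation, in the form which makes its
    positivity obvious. *)
Definition fejer N x : R := normsq (\sum_(l < N) cis (l%:R * x)) / N%:R ^+ 2.

Definition node N (j : nat) : R := 2 * pi / N%:R * j%:R - pi.

Lemma fejer_ge0 N x : 0 <= fejer N x.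
Proof. by rewrite /fejer divr_ge0 ?normsq_ge0// exprn_ge0. Qed.

Lemma normsq_sum_cis N x : (normsq (\sum_(l < N) cis (l%:R * x)))%:C =
  \sum_(l < N) \sum_(m < N) cis ((l%:R - m%:R) * x).
Proof.
rewrite -mulcJ rmorph_sum mulr_suml; apply: eq_bigr => l _.
rewrite mulr_sumr; apply: eq_bigr => m _.
transitivity (cis (l%:R * x) * conjc (cis (m%:R * x))); first by [].
by rewrite conj_cis -cisD -mulrBl.
Qed.

Lemma sum_cis_nodes N (l m : 'I_N) t :
  \sum_(j < N) cis ((l%:R - m%:R) * (t - node N j)) = (l == m)%:R * N%:R.
Proof.
have N0 : (0 < N)%N by case: N l {m} => [[]|].
have NR : N%:R != 0 :> R by rewrite pnatr_eq0 -lt0n.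
have [<-|lm] := eqVneq l m.
  under eq_bigr do rewrite subrr mul0r cis0.
  by rewrite sumr_const card_ord mul1r.
rewrite mul0r.
wlog ml : l m lm / (m < l)%N.
  move=> H; case: (ltngtP m l) => ml; first exact: H.
    have lm' : m != l by rewrite eq_sym.
    have := congr1 (@conjc R) (H m l lm' ml).
    rewrite rmorph0 rmorph_sum => h; apply: etrans h; apply: eq_bigr => j _.
    transitivity (cis ((m%:R - l%:R) * (t - node N j)))^*; last by [].
    by rewrite conj_cis -mulNr (opprB m%:R).
  by move: lm; rewrite (val_inj (esym ml)) eqxx.
have nm : l%:R - m%:R = (l - m)%N%:R :> R by rewrite natrB// ltnW.
rewrite nm.
have E j : cis ((l - m)%N%:R * (t - node N j)) = cis ((l - m)%N%:R * (t + pi)) *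
    conjc (cis (2 * pi * (l - m)%N%:R / N%:R * j%:R)).
  rewrite conj_cis -cisD; congr cis; rewrite /node; field; exact: NR.
under eq_bigr do rewrite E.
rewrite -mulr_sumr; apply/eqP; rewrite mulf_eq0; apply/orP; right; apply/eqP.
have := @sum_cis_roots N (l - m)%N; rewrite subn_gt0 ml /=.
have -> : (l - m < N)%N by apply: leq_ltn_trans (leq_subr _ _) _.
by move=> /(_ isT) h; have := congr1 (@conjc R) h; rewrite rmorph0 rmorph_sum.
Qed.

(** Fejer kernels sampled at the nodes form an exact partition of unity, so that
    the interpolation operator below is an average. *)
Lemma sum_fejer N t : (0 < N)%N -> \sum_(j < N) fejer N (t - node N j) = 1.
Proof.
move=> N0; have NR : N%:R != 0 :> R by rewrite pnatr_eq0 -lt0n.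
rewrite /fejer -mulr_suml.
suff -> : \sum_(j < N) normsq (\sum_(l < N) cis (l%:R * (t - node N j))) = N%:R ^+ 2.
  by rewrite divff// expf_neq0.
apply: (@complexI R); rewrite rmorph_sum.
transitivity (\sum_(j < N) \sum_(l < N) \sum_(m < N)
    cis ((l%:R - m%:R) * (t - node N j))).
  by apply: eq_bigr => j _; exact: normsq_sum_cis.
rewrite exchange_big /=.
under eq_bigr do rewrite exchange_big /=.
under eq_bigr do under eq_bigr do rewrite sum_cis_nodes.
transitivity (\sum_(l < N) (N%:R : R[i])).
  apply: eq_bigr => l _; rewrite (bigD1 l)//= eqxx mul1r big1 ?addr0// => m ml.
  by rewrite eq_sym (negbTE ml) mul0r.
by rewrite sumr_const card_ord rmorphXn rmorph_nat expr2 mulr_natr.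
Qed.

Lemma fejer_le N x : (0 < N)%N -> cos x < 1 ->
  fejer N x <= 4 / ((2 - 2 * cos x) * N%:R ^+ 2).
Proof.
move=> N0 c1.
have h : normsq (\sum_(l < N) cis (l%:R * x)) * (2 - 2 * cos x) = normsq (1 - cis x ^+ N).
  rewrite -normsq_sub1_cis -normsqM.
  have -> : \sum_(l < N) cis (l%:R * x) = \sum_(l < N) cis x ^+ l.
    by apply: eq_bigr => l _; rewrite mulr_natl cisMn.
  by congr normsq; rewrite -[RHS]opprB subrX1 -mulNr opprB mulrC.
have h4 : normsq (1 - cis x ^+ N) <= 4.
  rewrite -cisMn normsq_sub1_cis; have := cos_geN1 (x *+ N); lra.
have p0 : 0 < 2 - 2 * cos x by lra.
rewrite /fejer (invfM (2 - 2 * cos x)) mulrA ler_wpM2r ?invr_ge0 ?exprn_ge0//.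
by rewrite ler_pdivlMr// h.
Qed.

(** With a sum over the nodes in place of the convolution integral, this is visibly a
    trigonometric polynomial. *)
Definition fejer_approx (h : R -> R) N t : R :=
  \sum_(j < N) h (node N j) * fejer N (t - node N j).

Lemma cos_le_gap x e : 0 < e -> e <= pi -> e <= `|x| <= 2 * pi - e -> cos x <= cos e.
Proof.
move=> e0 epi /andP[ex xe]; rewrite -cos_norm.
have eI : e \in `[0, pi] by rewrite in_itv /= (ltW e0).
have [xpi|xpi] := leP `|x| pi.
  by rewrite leNgt ltr_cos ?in_itv /= ?normr_ge0// -leNgt.
rewrite -(cosN `|x|) -(cosD2pi (- `|x|)) -mulr_natl addrC.
rewrite leNgt ltr_cos// ?in_itv /=; first by rewrite -leNgt; lra.
by apply/andP; split; lra.
Qed.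

Lemma node_itv N j : (j < N)%N -> - pi <= node N j <= pi.
Proof.
move=> jN; have N0 : (0 < N)%N by exact: leq_ltn_trans jN.
rewrite /node; have h0 : 0 <= 2 * pi / N%:R * j%:R :> R.
  by rewrite !mulr_ge0 ?invr_ge0 ?pi_ge0.
have h1 : 2 * pi / N%:R * j%:R <= 2 * pi :> R.
  rewrite mulrAC ler_pdivrMr ?ltr0n// ler_pM2l ?mulr_gt0 ?pi_gt0//.
  by rewrite ler_nat ltnW.
by apply/andP; split; lra.
Qed.

Lemma fejer_approx_bounded (h : R -> R) M N t : (0 < N)%N ->
  (forall x, `|h x| <= M) -> `|fejer_approx h N t| <= M.
Proof.
move=> N0 hM; apply: le_trans (ler_norm_sum _ _ _) _.
rewrite -[M]mulr1 -(sum_fejer t N0) mulr_sumr; apply: ler_sum => j _.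
by rewrite normrM [X in _ * X]ger0_norm ?fejer_ge0// ler_wpM2r ?fejer_ge0.
Qed.

(** The nodes close to [t] contribute little because [h] is continuous, the other
    ones because there the kernel is of order [N ^- 2] and they number at most
    [N]. *)
Lemma fejer_approx_cvg (h : R -> R) (M : R) t : continuous h ->
  (forall x, `|h x| <= M) -> - pi < t < pi ->
  (fun n => fejer_approx h n.+1 t) @ \oo --> h t.
Proof.
move=> ch hM /andP[pt tp]; apply/cvgrPdist_le => e e0.
have M0 : 0 <= M by exact: le_trans (normr_ge0 _) (hM 0).
have e20 : 0 < e / 2 by rewrite divr_gt0.
have /cvgrPdist_le/(_ _ e20)/nbhs_ballP[d /= d0 hd] := ch t.
(* [eta] is also less than the distances from [t] to both endpoints: the kernel
   has period [2 * pi], and a node near one endpoint must not count as close to a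
   point near the other one. *)
pose eta := Num.min (d / 2) (Num.min (pi + t) (pi - t)).
have eta0 : 0 < eta by rewrite !lt_min divr_gt0//=; apply/andP; split; lra.
have etad : eta < d.
  by rewrite gt_min; apply/orP; left; rewrite ltr_pdivrMr// ltr_pMr// ltr1n.
have eta1 : eta <= pi + t by rewrite /eta !ge_min lexx !orbT.
have eta2 : eta <= pi - t by rewrite /eta !ge_min lexx !orbT.
have etapi : eta <= pi by lra.
have c1 : cos eta < 1 by apply: cos_lt1; rewrite eta0; have := pi_gt0 R; lra.
pose K := 8 * M / (2 - 2 * cos eta).
have K0 : 0 <= K by rewrite divr_ge0 ?mulr_ge0//; lra.
near=> n.
have nK : K <= e / 2 * n.+1%:R.
  rewrite mulrC -ler_pdivrMr//.
  near: n; exists (Num.truncn (K / (e / 2))) => // n /= hn.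
  by apply: ltW; rewrite -truncn_le_nat ?divr_ge0 ?(ltW e20)//.
have N0 : (0 < n.+1)%N by [].
have NR : 0 < n.+1%:R :> R by rewrite ltr0n.
have -> : h t - fejer_approx h n.+1 t =
    \sum_(j < n.+1) (h t - h (node n.+1 j)) * fejer n.+1 (t - node n.+1 j).
  under [RHS]eq_bigr do rewrite mulrBl.
  by rewrite sumrB -mulr_sumr sum_fejer// mulr1.
apply: le_trans (ler_norm_sum _ _ _) _.
apply: (@le_trans _ _ (\sum_(j < n.+1)
    (e / 2 * fejer n.+1 (t - node n.+1 j) + K / n.+1%:R ^+ 2))).
  apply: ler_sum => j _; rewrite normrM [X in _ * X]ger0_norm ?fejer_ge0//.
  have K1 : 0 <= K / n.+1%:R ^+ 2 by rewrite divr_ge0// exprn_ge0.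
  have [near_t|far_t] := ltP `|t - node n.+1 j| eta.
    rewrite ler_wpDr// ler_wpM2r ?fejer_ge0//.
    by apply: hd; rewrite /ball /=; exact: lt_trans near_t etad.
  have ef : 0 <= e / 2 * fejer n.+1 (t - node n.+1 j).
    by apply: mulr_ge0; [exact: ltW|exact: fejer_ge0].
  apply: ler_wpDl => //.
  have /andP[n1 n2] := node_itv (ltn_ord j).
  have cs : cos (t - node n.+1 j) <= cos eta.
    apply: cos_le_gap => //; rewrite far_t /= ler_norml; apply/andP; split; lra.
  have h2 : `|h t - h (node n.+1 j)| <= 2 * M.
    by apply: le_trans (ler_normB _ _) _; have := hM t; have := hM (node n.+1 j); lra.
  have h3 := fejer_le N0 (le_lt_trans cs c1).
  have p0 : 0 < 2 - 2 * cos eta by lra.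
  have h4 : 4 / ((2 - 2 * cos (t - node n.+1 j)) * n.+1%:R ^+ 2) <=
      4 / ((2 - 2 * cos eta) * n.+1%:R ^+ 2) :> R.
    rewrite ler_pM2l// lef_pV2 ?posrE ?mulr_gt0 ?exprn_gt0//; last lra.
    by rewrite ler_pM2r ?exprn_gt0//; lra.
  have h5 := ler_pM (normr_ge0 _) (fejer_ge0 n.+1 _) h2 (le_trans h3 h4).
  apply: le_trans h5 _; rewrite le_eqVlt /K; apply/orP; left; apply/eqP.
  by move: (n.+1%:R : R) (2 - 2 * cos eta) NR p0 => p q p1 q1; field; rewrite !gt_eqF.
rewrite big_split /= -mulr_sumr sum_fejer// mulr1 sumr_const card_ord.
rewrite -[_ *+ n.+1]mulr_natr.
have -> : K / n.+1%:R ^+ 2 * n.+1%:R = K / n.+1%:R.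
  by move: (n.+1%:R : R) NR => p p1; field; rewrite gt_eqF.
by rewrite [leRHS](splitr e) lerD2l ler_pdivrMr.
Unshelve. all: by end_near. Qed.

End Fejer.

(** * Closed linear spans *)

Section ClosedSpan.
Context {R : realType}.
Implicit Types (z : R[i]) (u v w : @L2 R).

(** The pairs list coefficients and indices; an index may occur several times, so
    that concatenation adds combinations. *)
Definition lincomb (I : Type) (f : I -> @L2 R) (p : seq (R[i] * I)) : L2 :=
  \sum_(x <- p) x.1 *: f x.2.

Definition cspan (I : Type) (f : I -> L2) v : Prop :=
  forall eps : R, 0 < eps -> exists p, nrm (v - lincomb f p) < eps.

Section OneFamily.
Context (I : Type) (f : I -> @L2 R).

Lemma lincombDZ z p q : exists r, lincomb f r = z *: lincomb f p + lincomb f q.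
Proof.
exists ([seq (z * x.1, x.2) | x <- p] ++ q).
rewrite /lincomb big_cat big_map scaler_sumr /=; congr (_ + _).
by apply: eq_bigr => x _; rewrite scalerA.
Qed.

Lemma cspan_lincomb p : cspan f (lincomb f p).
Proof. by move=> e e0; exists p; rewrite subrr nrm0. Qed.

Lemma cspan_gen i : cspan f (f i).
Proof. by move=> e e0; exists [:: (1, i)]; rewrite /lincomb big_seq1 scale1r subrr nrm0. Qed.

Lemma cspan0 : cspan f 0.
Proof. by move=> e e0; exists [::]; rewrite /lincomb big_nil subrr nrm0. Qed.

Lemma cspan_closed v :
  (forall eps : R, 0 < eps -> exists2 w, cspan f w & nrm (v - w) < eps) -> cspan f v.
Proof.
move=> H e e0; have e2 : 0 < e / 2 by rewrite divr_gt0.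
have [w fw vw] := H _ e2; have [p wp] := fw _ e2; exists p.
by apply: le_lt_trans (nrm_triangle w _ _) _; rewrite (splitr e) ltrD.
Qed.

Lemma cspanDZ z u v : cspan f u -> cspan f v -> cspan f (z *: u + v).
Proof.
move=> fu fv e e0; have e2 : 0 < e / 2 by rewrite divr_gt0.
have c0 : 0 < cabs z + 1 by rewrite ltr_wpDl ?cabs_ge0.
have [p up] := fu (e / 2 / (cabs z + 1)) (divr_gt0 e2 c0).
have [q vq] := fv _ e2.
have [r rE] := lincombDZ z p q; exists r; rewrite rE.
have -> : z *: u + v - (z *: lincomb f p + lincomb f q) =
    z *: (u - lincomb f p) + (v - lincomb f q).
  by rewrite scalerBr opprD addrACA.
apply: le_lt_trans (nrmD_le _ _) _; rewrite (splitr e) ler_ltD// nrmZ.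
apply: le_trans (_ : (cabs z + 1) * nrm (u - lincomb f p) <= _).
  by rewrite ler_wpM2r ?nrm_ge0// lerDl.
by rewrite mulrC -ler_pdivlMr// ltW.
Qed.

Lemma cspanZ z u : cspan f u -> cspan f (z *: u).
Proof. by move=> fu; rewrite -[_ *: _]addr0; apply: cspanDZ => //; exact: cspan0. Qed.

Lemma cspanD u v : cspan f u -> cspan f v -> cspan f (u + v).
Proof. by move=> fu fv; rewrite -[u]scale1r; exact: cspanDZ. Qed.

Lemma cspanB u v : cspan f u -> cspan f v -> cspan f (u - v).
Proof. by move=> fu fv; rewrite addrC -scaleN1r; exact: cspanDZ. Qed.

Lemma cspan_sum (J : Type) (s : seq J) (g : J -> L2) :
  (forall j, cspan f (g j)) -> cspan f (\sum_(j <- s) g j).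
Proof.
move=> fg; elim: s => [|j s IH]; first by rewrite big_nil; exact: cspan0.
rewrite big_cons; exact: cspanD (fg j) IH.
Qed.

Lemma cspan_trans (J : Type) (g : J -> L2) v :
  (forall j, cspan f (g j)) -> cspan g v -> cspan f v.
Proof.
move=> fg gv; apply: cspan_closed => e e0; have [p vp] := gv _ e0.
by exists (lincomb g p) => //; apply: cspan_sum => x; apply: cspanZ.
Qed.

End OneFamily.

(** The list of indices and the coefficients do not depend on [f], so that two
    families can be compared on one combination. *)
Lemma lincomb_uniq (I : eqType) (p : seq (R[i] * I)) :
  exists s c, uniq s /\
    forall f : I -> @L2 R, lincomb f p = \sum_(i <- s) c i *: f i.
Proof.
exists (undup [seq x.2 | x <- p]), (fun i => \sum_(x <- p | x.2 == i) x.1).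
split=> [|f]; first exact: undup_uniq.
under eq_bigr do rewrite scaler_suml.
rewrite (exchange_big_dep xpredT)//= /lincomb.
apply: eq_big_seq => x xp.
rewrite big_mkcond (bigD1_seq x.2) ?undup_uniq ?mem_undup ?map_f//= eqxx.
by rewrite big1 ?addr0// => i; rewrite eq_sym => /negbTE ->.
Qed.

End ClosedSpan.

(** * Density of trigonometric polynomials *)

Section TrigonometricDensity.
Context {R : realType}.
Local Notation mu := (@lebesgue_measure R).
Local Notation Ipi := (@Ipi R).
Implicit Types (z : R[i]) (u v w : @L2 R).

Lemma dominated_nrm_small (u : nat -> @L2 R) (G : R -> R) :
  mu.-integrable Ipi (EFin \o G) ->
  (forall n t, Ipi t -> normsq (u n t) <= G t) ->
  (forall t, Ipi t -> (fun n => normsq (u n t)) @ \oo --> (0 : R)) ->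
  forall eps : R, 0 < eps -> exists n, nrm (u n) < eps.
Proof.
move=> iG uG u0 e e0.
have mu_ n : measurable_fun Ipi (fun t => (normsq (u n t))%:E).
  have [mr mi _] := L2P (u n).
  by apply/measurable_EFinP; apply: measurable_normsq.
have [||||||_ _] := @dominated_convergence _ _ _ mu Ipi _
  (fun n t => (normsq (u n t))%:E) (cst 0%E) (EFin \o G) => //.
- exact: measurable_Ipi.
- by apply: aeW => t It; apply/fine_cvgP; split; [exact: nearW|exact: u0].
- apply: aeW => t It n; rewrite /= ger0_norm ?normsq_ge0// lee_fin; exact: uG.
rewrite integral0 => /fine_cvgP[_ /cvgrPdist_lt /(_ _ (exprn_gt0 2 e0))].
move=> [n _ /(_ n (leqnn n))]; rewrite /= -sqr_nrm_integral /= sub0r normrN.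
rewrite ger0_norm ?sqr_ge0// => h; exists n.
by rewrite -(ltr_pXn2r (_ : (0 < 2)%N)) ?nnegrE ?nrm_ge0 ?(ltW e0).
Qed.

Definition expL2Z (n : int) : @L2 R := expL2 n%:~R.

Lemma inL2_real (h : R -> R) M : measurable_fun Ipi h ->
  (forall t, Ipi t -> `|h t| <= M) -> inL2 (fun t => (h t)%:C).
Proof.
move=> mh hM; apply: (@inL2_bounded _ _ (M ^+ 2)); [exact: mh|exact: measurable_cst|].
move=> t It; rewrite /normsq /= expr0n addr0 -real_normK ?num_real//.
have := hM _ It; have := normr_ge0 (h t); move: `|h t| => x x0 xM.
by rewrite ler_pXn2r ?nnegrE// (le_trans x0).
Qed.

Lemma fejer_approx_cspan (h : R -> R) N : exists2 w, cspan expL2Z w &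
  forall t, w t = (fejer_approx h N t)%:C.
Proof.
exists (\sum_(j < N) (h (node N j) / N%:R ^+ 2)%:C *: \sum_(l < N) \sum_(m < N)
   cis (- ((l%:R - m%:R) * node N j)) *: expL2Z (l%:Z - m%:Z)).
  apply: cspan_sum => j; apply: cspanZ; apply: cspan_sum => l.
  by apply: cspan_sum => m; apply: cspanZ; exact: cspan_gen.
move=> t; rewrite L2_sumE /fejer_approx rmorph_sum; apply: eq_bigr => j _.
rewrite L2ZE /fejer.
have -> : h (node N j) * (normsq (\sum_(l < N) cis (l%:R * (t - node N j))) / N%:R ^+ 2)
  = h (node N j) / N%:R ^+ 2 * normsq (\sum_(l < N) cis (l%:R * (t - node N j))) by ring.
rewrite [RHS]rmorphM; congr (_ * _); rewrite [RHS]normsq_sum_cis.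
rewrite L2_sumE; apply: eq_bigr => l _; rewrite L2_sumE; apply: eq_bigr => m _.
rewrite L2ZE /expL2Z /= /expi -/(cis _) -cisD rmorphB /=.
by congr cis; rewrite -!pmulrn; ring.
Qed.

(** The Fejer approximants are bounded by [M], so that pointwise convergence on the
    open interval implies convergence in norm. *)
Lemma continuous_cspan (h : R -> R) M u : continuous h ->
  (forall t, `|h t| <= M) -> (forall t, u t = (h t)%:C) -> cspan expL2Z u.
Proof.
move=> ch hM uh.
have approx N : exists w, cspan expL2Z w /\ forall t, w t = (fejer_approx h N.+1 t)%:C.
  by have [w h1 h2] := fejer_approx_cspan h N.+1; exists w.
have [w wP] := choice approx.
have d t n : normsq ((u - w n) t) = (h t - fejer_approx h n.+1 t) ^+ 2.
  rewrite L2DE L2NE uh (wP n).2 -rmorphB /normsq /= expr0n addr0//.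
apply: cspan_closed => e e0.
have [|||n ne] := @dominated_nrm_small (fun n => u - w n) (cst ((2 * M) ^+ 2)) _ _ _ e e0.
- apply: (@bounded_integrable_Ipi _ _ `|(2 * M) ^+ 2|) => //; exact: measurable_cst.
- move=> n t _; rewrite d -real_normK ?num_real//=.
  have b : `|h t - fejer_approx h n.+1 t| <= 2 * M.
    apply: le_trans (ler_normB _ _) _.
    by have := hM t; have := @fejer_approx_bounded _ h M n.+1 t isT hM; lra.
  by rewrite ler_pXn2r ?nnegrE// (le_trans _ b).
- move=> t It; under eq_fun do rewrite d.
  have It' : - pi < t < pi by [].
  have c := fejer_approx_cvg ch hM It'.
  under eq_fun do rewrite expr2.
  have -> : (0 : R) = (h t - h t) * (h t - h t) by rewrite subrr mulr0.
  by apply: cvgM; apply: cvgB => //; exact: cvg_cst.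
by exists (w n) => //; have [] := wP n.
Qed.

Lemma clip_continuous (g : R -> R) M : continuous g ->
  continuous (fun t => Num.max (- M) (Num.min M (g t))).
Proof.
move=> cg t.
apply: (@continuous_max _ _ (cst (- M)) (cst M \min g)); first exact: cvg_cst.
by apply: (@continuous_min _ _ (cst M) g); [exact: cvg_cst|exact: cg].
Qed.

Lemma clipP (M x : R) : 0 <= M -> `|Num.max (- M) (Num.min M x)| <= M.
Proof.
move=> M0; rewrite ler_norml ge_max le_max lexx /= ge_min lexx /= andbT.
by rewrite ge0_cp.
Qed.

Lemma clip_dist (M x y : R) : `|x| <= M ->
  `|x - Num.max (- M) (Num.min M y)| <= `|x - y|.
Proof.
rewrite ler_norml => /andP[x1 x2].
have [yM|My] := leP M y.
  have -> : Num.max (- M) M = M by apply/max_idPr; lra.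
  by rewrite !ler0_norm; lra.
have [yM|My'] := leP (- M) y; first by [].
by rewrite !ger0_norm; lra.
Qed.

(** Continuous functions approximate [f] for the L1 norm. Cutting the approximants
    off at height [M] brings them closer to [f], and makes the squared distance at
    most [2 * M] times the distance. *)
Lemma bounded_cspan (f : R -> R) M u : measurable_fun Ipi f ->
  (forall t, Ipi t -> `|f t| <= M) -> (forall t, u t = (f t)%:C) -> cspan expL2Z u.
Proof.
move=> mf fM uf.
have M0 : 0 <= M.
  by apply: le_trans (normr_ge0 _) (fM 0 _); rewrite /Defs.Ipi /= in_itv /= oppr_lt0 pi_gt0.
have intf := bounded_integrable_Ipi mf fM.
have [||g [cg ig gf]] := approximation_continuous_integrable _ _ intf.
- exact: measurable_Ipi.
- exact: (eq_ind_r (fun x => (x < +oo)%E) (ltry _) lebesgue_Ipi).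
apply: cspan_closed => e e0.
have d0 : 0 < e ^+ 2 / (2 * M + 1) by rewrite divr_gt0 ?exprn_gt0//; lra.
have iB n : mu.-integrable Ipi (EFin \o (fun t => f t - g n t)).
  have := integrable_IpiD intf (integrable_IpiZ (-1) (ig n)).
  by congr (integrable _ _ (_ \o _)); apply/funext => t; rewrite mulN1r.
move/fine_cvgP: gf => [_ /cvgrPdist_lt /(_ _ d0)[n _ /(_ n (leqnn n))]].
rewrite /= sub0r normrN => gn.
pose h t := Num.max (- M) (Num.min M (g n t)).
have ch : continuous h by exact: clip_continuous.
have hM t : `|h t| <= M by exact: clipP.
have mh : measurable_fun Ipi h.
  by apply: measurable_funTS; exact: continuous_measurable_fun.
pose w := toL2 (inL2_real mh (fun t _ => hM t)).
exists w; first by apply: (continuous_cspan ch hM).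
have nG : ((nrm (u - w) ^+ 2)%:E <= \int[mu]_(t in Ipi) ((2 * M) * `|f t - g n t|)%:E)%E.
  apply: (@nrm_ae_le _ _ _ set0) => //.
  - apply/measurable_EFinP; apply: measurable_funM; first exact: measurable_cst.
    apply: measurableT_comp => //; apply: measurable_funB => //.
    by apply: measurable_funTS; exact: continuous_measurable_fun.
  - by move=> t _; rewrite lee_fin mulr_ge0// mulr_ge0.
  - move=> t It _; rewrite lee_fin L2DE L2NE uf -rmorphB /normsq /= expr0n addr0.
    rewrite -real_normK ?num_real// expr2; apply: ler_pM => //.
      by apply: le_trans (ler_normB _ _) _; have := fM _ It; have := hM t; lra.
    by apply: clip_dist; exact: fM.
rewrite -(ltr_pXn2r (_ : (0 < 2)%N)) ?nnegrE ?nrm_ge0 ?(ltW e0)//.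
rewrite -lte_fin; apply: le_lt_trans nG _.
under eq_integral do rewrite EFinM.
rewrite ge0_integralZl_EFin//; first last.
- by rewrite mulr_ge0.
- apply/measurable_EFinP; apply: measurableT_comp => //; apply: measurable_funB => //.
  by apply: measurable_funTS; exact: continuous_measurable_fun.
- exact: measurable_Ipi.
have fin : (\int[mu]_(t in Ipi) `|f t - g n t|%:E)%E \is a fin_num.
  apply: integrable_fin_num; first exact: measurable_Ipi.
  exact: integrable_norm.
move: gn; rewrite ger0_norm; last by apply: fine_ge0; apply: integral_ge0.
rewrite -{2}(fineK fin) -EFinM lte_fin.
set I := fine _ => gn.
have I0 : 0 <= I by apply: fine_ge0; apply: integral_ge0 => t _; rewrite lee_fin.
move: gn; rewrite ltr_pdivlMr; last lra.
by apply: le_lt_trans; rewrite mulrC ler_wpM2l//; lra.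
Qed.

Lemma real_cspan u : (forall t, Im (u t) = 0) -> cspan expL2Z u.
Proof.
move=> iu; have [mr mi _] := L2P u.
pose f n t : R := if `|Re (u t)| <= n%:R then Re (u t) else 0.
have mf n : measurable_fun Ipi (f n).
  apply: measurable_fun_if => //; [exact: measurable_Ipi| |].
    by apply: measurable_fun_ler => //; apply: measurableT_comp.
  by apply: measurable_funS mr => //; exact: measurable_Ipi.
have fM n t : `|f n t| <= n%:R by rewrite /f; case: ifP => //; rewrite normr0.
pose w n := toL2 (inL2_real (mf n) (fun t _ => fM n t)).
have uw n t : (u - w n) t = (if `|Re (u t)| <= n%:R then 0 else Re (u t))%:C.
  rewrite L2DE L2NE /= /f; have := iu t; case: (u t) => a b /= ->.
  by case: ifP => _; apply/eqP; rewrite eq_complex /= ?subrr ?subr0 !eqxx.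
apply: cspan_closed => e e0.
have [|||n ne] := @dominated_nrm_small (fun n => u - w n) (fun t => normsq (u t)) _ _ _ e e0.
- exact: inL2_integrable (L2P u).
- move=> n t _; rewrite uw; case: ifP => _.
    by rewrite [leLHS](_ : _ = 0) ?normsq_ge0// /normsq /= expr0n addr0.
  by rewrite /normsq /= expr0n addr0 lerDl sqr_ge0.
- move=> t _; apply/cvgrPdist_lt => eps eps0; exists (Num.truncn `|Re (u t)|).+1 => // n /= hn.
  have un := uw n t; rewrite ifT in un.
    by rewrite [normsq _](congr1 normsq un) /normsq /= expr0n addr0 subrr normr0.
  by apply: ltW; apply: lt_le_trans (truncnS_gt _) _; rewrite ler_nat.
by exists (w n) => //; apply: (bounded_cspan (mf n) (fun t _ => fM n t)).
Qed.

Lemma trigonometric_density u : cspan expL2Z u.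
Proof.
have [mr mi fin] := L2P u.
have re2 : inL2 (fun t => (Re (u t))%:C).
  apply: (inL2_dominated _ _ (inL2_integrable (L2P u))); [exact: mr|exact: measurable_cst|].
  by move=> t _; rewrite /normsq /= expr0n addr0 lerDl sqr_ge0.
have im2 : inL2 (fun t => (Im (u t))%:C).
  apply: (inL2_dominated _ _ (inL2_integrable (L2P u))); [exact: mi|exact: measurable_cst|].
  by move=> t _; rewrite /normsq /= expr0n addr0 lerDr sqr_ge0.
have uE t : u t = ('i *: toL2 im2 + toL2 re2) t.
  rewrite L2DE L2ZE /=; case: (u t) => a b; apply/eqP; rewrite eq_complex /=.
  by apply/andP; split; apply/eqP; ring.
have -> : u = 'i *: toL2 im2 + toL2 re2 by apply: val_inj; exact: funext uE.
by apply: cspanDZ; apply: real_cspan.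
Qed.

End TrigonometricDensity.

(** * Orthonormal families with dense span *)

Section Orthonormal.
Context {R : realType} (I : eqType) (e : I -> @L2 R).
Hypothesis e_on : forall i j, ip (e i) (e j) = (i == j)%:R.
Hypothesis e_dense : forall v, cspan e v.
Implicit Types (u v w : @L2 R) (s : seq I) (c : I -> R[i]).

Definition proj s v : L2 := \sum_(i <- s) ip v (e i) *: e i.

Lemma ip_sum_e s c i : uniq s -> i \in s ->
  ip (\sum_(j <- s) c j *: e j) (e i) = c i.
Proof.
move=> us si; rewrite ip_suml (bigD1_seq i)//= big1 ?addr0 => [|j ji].
  by rewrite ipZl e_on eqxx mulr1.
by rewrite ipZl e_on (negbTE ji) mulr0.
Qed.

Lemma sqr_nrm_sum_e s c : uniq s ->
  nrm (\sum_(i <- s) c i *: e i) ^+ 2 = \sum_(i <- s) normsq (c i).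
Proof.
move=> us; apply: (@complexI R); rewrite -ip_self ip_sumr rmorph_sum.
apply: eq_big_seq => i si.
by rewrite ipZr ip_sum_e// mulrC mulcJ.
Qed.

Lemma ip_sub_proj s v i : uniq s -> i \in s -> ip (v - proj s v) (e i) = 0.
Proof. by move=> us si; rewrite ipBl ip_sum_e// subrr. Qed.

(** [v - proj s v] is orthogonal to all [e i] with [i] in [s]. *)
Lemma pythagoras s v c : uniq s -> nrm (v - \sum_(i <- s) c i *: e i) ^+ 2 =
  nrm (v - proj s v) ^+ 2 + \sum_(i <- s) normsq (ip v (e i) - c i).
Proof.
move=> us; have -> : v - \sum_(i <- s) c i *: e i =
    (v - proj s v) + \sum_(i <- s) (ip v (e i) - c i) *: e i.
  under [X in _ = _ + X]eq_bigr do rewrite scalerBl.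
  by rewrite sumrB addrA subrK.
rewrite sqr_nrmD sqr_nrm_sum_e// ip_sumr big_seq big1 => [|i si].
  by rewrite mulr0 addr0.
by rewrite ipZr ip_sub_proj// mulr0.
Qed.

Lemma bessel_eq s v : uniq s ->
  nrm v ^+ 2 = nrm (v - proj s v) ^+ 2 + \sum_(i <- s) normsq (ip v (e i)).
Proof.
move=> us; have := pythagoras v (fun=> 0) us.
rewrite big1 ?subr0 => [|i _]; last by rewrite scale0r.
by under [in X in _ -> X]eq_bigr do rewrite -[ip _ _]subr0.
Qed.

(** Among the combinations of the [e i] with [i] in [s], [proj s v] is the closest
    to [v]. *)
Lemma proj_approx v (eps : R) : 0 < eps -> exists s0, forall s, uniq s ->
  {subset s0 <= s} -> nrm (v - proj s v) < eps.
Proof.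
move=> e0; have [p vp] := e_dense v e0.
have [s0 [c [us0 pE]]] := lincomb_uniq p; exists s0 => s us s0s.
apply: le_lt_trans vp.
pose c' i := if i \in s0 then c i else 0.
have -> : lincomb e p = \sum_(i <- s) c' i *: e i.
  rewrite pE [RHS](bigID (mem s0))/= [X in _ = _ + X]big1 ?addr0 => [|i /negbTE is0].
    rewrite -[RHS]big_filter; transitivity (\sum_(i <- s0) c' i *: e i).
      by apply: eq_big_seq => i is0; rewrite /c' is0.
    apply: perm_big; apply: uniq_perm => // [|i]; first exact: filter_uniq.
    rewrite mem_filter /=; case: (boolP (i \in s0)) => //= /s0s -> //.
  by rewrite /c' is0 scale0r.
rewrite -(ler_pXn2r (_ : (0 < 2)%N)) ?nnegrE ?nrm_ge0// [leRHS](pythagoras _ _ us).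
by rewrite lerDl sumr_ge0// => i _; exact: normsq_ge0.
Qed.

(** This is how norms are estimated from coordinates: only finite partial sums
    occur. *)
Lemma nrm_le_bessel v (T : R) :
  (forall s, uniq s -> \sum_(i <- s) normsq (ip v (e i)) <= T) -> nrm v ^+ 2 <= T.
Proof.
move=> vT; rewrite leNgt; apply/negP => h.
have e0 : 0 < Num.sqrt (nrm v ^+ 2 - T) by rewrite sqrtr_gt0 subr_gt0.
have [s0 H] := proj_approx v e0.
have sub : {subset s0 <= undup s0} by move=> i; rewrite mem_undup.
have lt := H _ (undup_uniq s0) sub.
have : nrm (v - proj (undup s0) v) ^+ 2 < nrm v ^+ 2 - T.
  by rewrite -[ltRHS]sqr_sqrtr ?subr_ge0 ?(ltW h)// ltr_pXn2r ?nnegrE ?nrm_ge0 ?sqrtr_ge0.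
have := vT _ (undup_uniq s0); rewrite (bessel_eq v (undup_uniq s0)).
by move: (nrm _ ^+ 2) (\sum_(_ <- _) _) => x y; lra.
Qed.

Lemma parseval_ip u v (eps : R) : 0 < eps -> exists s0, forall s, uniq s ->
  {subset s0 <= s} ->
  cabs (ip u v - \sum_(i <- s) ip u (e i) * conjc (ip v (e i))) < eps.
Proof.
move=> e0; have n0 : 0 < nrm v + 1 by rewrite ltr_wpDl ?nrm_ge0.
have [s0 s0P] := proj_approx u (divr_gt0 e0 n0); exists s0 => s us ss.
have -> : ip u v - \sum_(i <- s) ip u (e i) * conjc (ip v (e i)) = ip (u - proj s u) v.
  rewrite ipBl ip_suml; congr (_ - _); apply: eq_bigr => i _.
  by rewrite ipZl [ip (e i) v]ipC.
apply: le_lt_trans (cabs_ip_le _ _) _.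
have := s0P s us ss; rewrite ltr_pdivlMr//; apply: le_lt_trans.
by rewrite ler_wpM2l ?nrm_ge0// lerDl.
Qed.

End Orthonormal.

(** * Translated integer frequencies *)

Section Modulation.
Context {R : realType}.
Local Notation mu := (@lebesgue_measure R).
Local Notation Ipi := (@Ipi R).
Implicit Types (a b : R) (u v w : @L2 R).

Lemma inL2_modulate a u : inL2 (expi a * u).
Proof.
apply: (@inL2M _ _ 1); [exact: measurable_cos_scale|exact: measurable_sin_scale| |exact: L2P].
by move=> t _; rewrite normsq_expi.
Qed.

(** Multiplication by [expi a] is a unitary operator which translates the
    frequencies of exponentials by [a]. *)
Definition modulate a u : L2 := toL2 (inL2_modulate a u).

Lemma modulateE a u t : modulate a u t = expi a t * u t. Proof. by []. Qed.

Lemma modulate_expL2 a b : modulate a (expL2 b) = expL2 (a + b).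
Proof. by apply: L2_ext => t; rewrite modulateE /= expiD. Qed.

Lemma modulateK a u : modulate a (modulate (- a) u) = u.
Proof.
apply: L2_ext => t; rewrite !modulateE mulrA -expiD subrr.
by rewrite /expi mul0r cos0 sin0 mul1r.
Qed.

Lemma modulate_linear a (z : R[i]) u v :
  modulate a (z *: u + v) = z *: modulate a u + modulate a v.
Proof.
by apply: L2_ext => t; rewrite modulateE !L2DE !L2ZE !modulateE mulrDr mulrCA.
Qed.

Lemma nrm_modulate a u : nrm (modulate a u) = nrm u.
Proof.
rewrite /nrm /normL2; congr Num.sqrt; apply: eq_Rintegral => t _ /=.
by rewrite normsqM normsq_expi mul1r.
Qed.

Lemma modulate_lincomb a (I : Type) (f : I -> L2) p :
  modulate a (lincomb f p) = lincomb (fun i => modulate a (f i)) p.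
Proof.
rewrite /lincomb; elim: p => [|x p IH]; last first.
  rewrite !big_cons -IH; exact: modulate_linear.
by rewrite !big_nil; apply: L2_ext => t; rewrite modulateE /= mulr0.
Qed.

Lemma cspan_modulate a (I : Type) (f : I -> L2) u :
  cspan f (modulate (- a) u) -> cspan (fun i => modulate a (f i)) u.
Proof.
move=> fu e e0; have [p up] := fu _ e0; exists p.
rewrite -modulate_lincomb -(nrm_modulate (- a)).
have -> : u - modulate a (lincomb f p) = modulate a (modulate (- a) u - lincomb f p).
  rewrite [in RHS]addrC -[in RHS]scaleN1r modulate_linear modulateK scaleN1r.
  by rewrite addrC.
by rewrite nrm_modulate -{1}(opprK a) nrm_modulate.
Qed.

(** With this normalisation the Gram matrices of families of exponentials have
    entries given by [sinc], which vanishes at the nonzero integers. *)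
Definition uexp a : @L2 R := ((Num.sqrt (2 * pi))^-1)%:C *: expL2 a.

Lemma sqrt2pi_gt0 : 0 < Num.sqrt (2 * pi) :> R.
Proof. by rewrite sqrtr_gt0 mulr_gt0 ?pi_gt0. Qed.

Lemma ip_uexp a b : ip (uexp a) (uexp b) = (sinc (a - b))%:C.
Proof.
rewrite /uexp ipZl ipZr ip_expL2 conjc_real -!rmorphM /=; congr (_%:C).
have E2 : Num.sqrt (2 * pi) ^+ 2 = 2 * pi :> R by rewrite sqr_sqrtr// mulr_ge0 ?pi_ge0.
have p0 := sqrt2pi_gt0; set q := Num.sqrt (2 * pi) in E2 p0 *; rewrite -E2.
by move: q p0 {E2} => q q0; field; rewrite gt_eqF.
Qed.

Lemma sinc0 : sinc 0 = 1 :> R. Proof. by rewrite /sinc eqxx. Qed.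

Lemma sin_pi_int (n : int) : sin (pi * n%:~R) = 0 :> R.
Proof.
have nat_case (m : nat) : sin (pi * m%:R) = 0 :> R.
  rewrite mulr_natr; elim: m => [|m IH]; first by rewrite sin0.
  by rewrite mulrSr sinD IH sinpi mul0r mulr0 addr0.
case: n => m; first exact: nat_case.
by rewrite NegzE mulrNz mulrN sinN nat_case oppr0.
Qed.

Lemma sinc_int (n : int) : sinc n%:~R = (n == 0)%:R :> R.
Proof.
by rewrite /sinc intr_eq0; case: eqVneq => // n0; rewrite sin_pi_int mul0r.
Qed.

Lemma uexp_orthonormal a (m n : int) :
  ip (uexp (a + m%:~R)) (uexp (a + n%:~R)) = (m == n)%:R.
Proof.
rewrite ip_uexp opprD addrACA subrr add0r -intrB sinc_int subr_eq0.
by case: eqP.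
Qed.

Lemma cspan_uexp (I : Type) (nu : I -> R) v :
  cspan (fun i => expL2 (nu i)) v -> cspan (fun i => uexp (nu i)) v.
Proof.
apply: cspan_trans => i.
have -> : expL2 (nu i) = (Num.sqrt (2 * pi))%:C *: uexp (nu i).
  by rewrite /uexp scalerA -rmorphM divff ?scale1r// gt_eqF// sqrt2pi_gt0.
by apply: cspanZ; exact: (cspan_gen (fun i => uexp (nu i))).
Qed.

Lemma expL2_dense a v : cspan (fun n : int => expL2 (a + n%:~R)) v.
Proof.
have := cspan_modulate (trigonometric_density (modulate (- a) v)).
by under eq_fun do rewrite modulate_expL2.
Qed.

Lemma uexp_dense a v : cspan (fun n : int => uexp (a + n%:~R)) v.
Proof. exact/cspan_uexp/expL2_dense. Qed.

End Modulation.

(** * Extending operators by continuity *)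

Section Extension.
Context {R : realType} (I : Type) (e f : I -> @L2 R) (C : R).
Hypothesis e_dense : forall v, cspan e v.
Hypothesis fe_le : forall p, nrm (lincomb f p) <= C * nrm (lincomb e p).
Implicit Types (u v w : @L2 R).

(** The closure of the graph of the linear map sending [e i] to [f i]. *)
Definition graph_closure u w := forall eps : R, 0 < eps ->
  exists p, nrm (u - lincomb e p) < eps /\ nrm (w - lincomb f p) < eps.

Lemma graph_closure_linear z u v w x : graph_closure u w -> graph_closure v x ->
  graph_closure (z *: u + v) (z *: w + x).
Proof.
move=> uw vx eps e0; have e2 : 0 < eps / 2 by rewrite divr_gt0.
have c0 : 0 < cabs z + 1 by rewrite ltr_wpDl ?cabs_ge0.
have [p [up wp]] := uw (eps / 2 / (cabs z + 1)) (divr_gt0 e2 c0).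
have [q [vq xq]] := vx _ e2.
pose r := [seq (z * y.1, y.2) | y <- p] ++ q.
have rE h : lincomb h r = z *: lincomb h p + lincomb h q :> @L2 R.
  rewrite /lincomb big_cat big_map scaler_sumr /=; congr (_ + _).
  by apply: eq_bigr => y _; rewrite scalerA.
have aux a b c d : nrm (a - c) < eps / 2 / (cabs z + 1) -> nrm (b - d) < eps / 2 ->
    nrm (z *: a + b - (z *: c + d)) < eps :> R.
  move=> h1 h2; have -> : z *: a + b - (z *: c + d) = z *: (a - c) + (b - d) :> @L2 R.
    by rewrite scalerBr opprD addrACA.
  apply: le_lt_trans (nrmD_le _ _) _; rewrite (splitr eps) ler_ltD// nrmZ.
  apply: le_trans (_ : (cabs z + 1) * nrm (a - c) <= _).
    by rewrite ler_wpM2r ?nrm_ge0// lerDl.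
  by rewrite mulrC -ler_pdivlMr// ltW.
by exists r; rewrite !rE; split; apply: aux.
Qed.

(** The bound passes to the closure, hence two values at the same vector are at
    distance zero. *)
Lemma graph_closure_bounded u w : graph_closure u w -> nrm w <= `|C| * nrm u.
Proof.
move=> uw; apply/ler_addgt0Pr => eps e0.
have c0 : 0 < 1 + `|C| by rewrite ltr_wpDr.
have [p [up wp]] := uw _ (divr_gt0 e0 c0).
apply: (@le_trans _ _ (nrm (w - lincomb f p) + nrm (lincomb f p))).
  by rewrite -{1}[w](subrK (lincomb f p)) nrmD_le.
have h1 : nrm (lincomb f p) <= `|C| * nrm (lincomb e p).
  by apply: le_trans (fe_le p) _; rewrite ler_wpM2r ?nrm_ge0// ler_norm.
have h2 : nrm (lincomb e p) <= nrm u + nrm (u - lincomb e p).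
  by rewrite nrmB -{1}[lincomb e p](subrK u) addrC nrmD_le.
have h3 : `|C| * nrm (lincomb e p) <= `|C| * (nrm u + nrm (u - lincomb e p)).
  by rewrite ler_wpM2l.
move: (ltW up) (ltW wp); set d := eps / _ => up' wp'.
have -> : eps = d + `|C| * d by rewrite /d; field; rewrite gt_eqF.
have h4 : `|C| * nrm (u - lincomb e p) <= `|C| * d by rewrite ler_wpM2l.
lra.
Qed.

Lemma graph_closure_fun u w x : graph_closure u w -> graph_closure u x -> nrm (w - x) = 0.
Proof.
move=> uw ux; have := graph_closure_linear (-1) ux uw.
rewrite !scaleN1r addNr addrC => /graph_closure_bounded.
by rewrite nrm0 mulr0 => h; apply/eqP; rewrite eq_le h nrm_ge0.
Qed.

(** Combinations of the [e i] converging to [u] geometrically are mapped by a bounded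
    map to a sequence with geometrically small increments. *)
Lemma graph_closure_total u : exists w, graph_closure u w.
Proof.
(* The denominator absorbs the factor [C] and the triangle inequality. *)
have c0 : 0 < 2 * (1 + `|C|) :> R by rewrite mulr_gt0// ltr_wpDr.
have d0 j : 0 < 4^-1 ^+ j / (2 * (1 + `|C|)) :> R by rewrite divr_gt0// exprn_gt0.
have [p pP] := choice (fun j => e_dense u (d0 j)).
have lincombB h j k : lincomb h (p j ++ [seq (- y.1, y.2) | y <- p k]) =
    lincomb h (p j) - lincomb h (p k) :> @L2 R.
  rewrite /lincomb big_cat big_map /= -sumrN; congr (_ + _).
  by apply: eq_bigr => y _; rewrite scaleNr.
have [j|w [K wK]] := @L2_complete _ (fun j => lincomb f (p j)).
  rewrite -lincombB; apply: le_trans (fe_le _) _; rewrite lincombB.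
  apply: le_trans (_ : `|C| * nrm (lincomb e (p j.+1) - lincomb e (p j)) <= _).
    by rewrite ler_wpM2r ?nrm_ge0// ler_norm.
  have h1 : nrm (lincomb e (p j.+1) - lincomb e (p j)) <=
      4^-1 ^+ j.+1 / (2 * (1 + `|C|)) + 4^-1 ^+ j / (2 * (1 + `|C|)).
    apply: le_trans (nrm_triangle u _ _) _; rewrite nrmB.
    by apply: lerD; apply: ltW; exact: pP.
  apply: le_trans (ler_wpM2l (normr_ge0 _) h1) _.
  have q0 : 0 <= 4^-1 ^+ j :> R by rewrite exprn_ge0.
  have -> : `|C| * (4^-1 ^+ j.+1 / (2 * (1 + `|C|)) + 4^-1 ^+ j / (2 * (1 + `|C|))) =
      (5 / 8 * (`|C| / (1 + `|C|))) * 4^-1 ^+ j.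
    by rewrite exprS; field; rewrite gt_eqF// ltr_wpDr.
  rewrite ler_piMl//; have : `|C| / (1 + `|C|) <= 1.
    by rewrite ler_pdivrMr ?ltr_wpDr// mul1r lerDr.
  by lra.
exists w => eps e0.
have cv1 : (fun j => nrm (u - lincomb e (p j))) @ \oo --> (0 : R).
  apply: (@geometric_cvg _ _ 1) => j; rewrite subr0 mul1r ger0_norm ?nrm_ge0//.
  apply: le_trans (ltW (pP j)) _; rewrite ler_pdivrMr//.
  have h2 : 4^-1 ^+ j <= 2^-1 ^+ j :> R by rewrite lerXn2r ?nnegrE//; lra.
  have h3 : 0 <= 2^-1 ^+ j :> R by rewrite exprn_ge0.
  by apply: le_trans h2 _; rewrite ler_peMr//; have := normr_ge0 C; lra.
have cv2 : (fun j => nrm (w - lincomb f (p j))) @ \oo --> (0 : R).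
  apply: (@geometric_cvg _ _ K) => j; rewrite subr0 ger0_norm ?nrm_ge0//.
  by rewrite nrmB.
move/cvgrPdist_lt: cv1 => /(_ _ e0)[n1 _ h1].
move/cvgrPdist_lt: cv2 => /(_ _ e0)[n2 _ h2].
exists (p (maxn n1 n2)).
have := h1 (maxn n1 n2) (leq_maxl _ _); have := h2 (maxn n1 n2) (leq_maxr _ _).
by rewrite !sub0r !normrN !ger0_norm ?nrm_ge0.
Qed.

Lemma graph_closure_gen i : graph_closure (e i) (f i).
Proof.
by move=> eps e0; exists [:: (1, i)]; rewrite /lincomb !big_seq1 !scale1r !subrr !nrm0.
Qed.

End Extension.

(** * Riesz families and Riesz bases *)

Section RieszBasis.
Context {R : realType}.
Local Notation mu := (@lebesgue_measure R).
Local Notation Ipi := (@Ipi R).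
Implicit Types (u v w : @L2 R).

Lemma eqL2_nrm u v : nrm (u - v) = 0 -> eqL2 u v.
Proof.
move=> uv0; pose d := u - v; have dE t : d t = u t - v t by rewrite L2DE L2NE.
have [mr mi _] := L2P d.
have : ae_eq mu Ipi (fun t => (normsq (d t))%:E) (cst 0%E).
  apply/ae_eq_integral_abs; first exact: measurable_Ipi.
    by apply/measurable_EFinP; apply: measurable_normsq.
  under eq_integral do rewrite gee0_abs ?lee_fin ?normsq_ge0//.
  by rewrite -sqr_nrm_integral uv0 expr0n.
apply: filterS => t h It.
have [nz] : (normsq (d t))%:E = 0%:E := h It.
by apply/eqP; rewrite -subr_eq0 -cabs_eq0 -sqrf_eq0 sqr_cabs -dE nz.
Qed.

(** Riesz bases by their two-sided inequality. In this form, in which no operator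
    is mentioned, the property can be checked on finite sums. *)
Definition riesz (I : eqType) (f : I -> @L2 R) :=
  (forall v, cspan f v) /\
  exists2 K : R, 0 < K & forall s c, uniq s ->
    nrm (\sum_(i <- s) c i *: f i) ^+ 2 <= K * \sum_(i <- s) normsq (c i) /\
    \sum_(i <- s) normsq (c i) <= K * nrm (\sum_(i <- s) c i *: f i) ^+ 2.

(** Zero is a default value outside of the square-integrable functions. *)
Definition extend (W : L2 -> L2) (h : R -> R[i]) : R -> R[i] :=
  match pselect (inL2 h) with left h2 => W (toL2 h2) | right _ => 0 end.

Lemma extendE W h (h2 : inL2 h) : extend W h = W (toL2 h2).
Proof.
rewrite /extend; case: pselect => [h2'|[]]; last exact: h2.
by congr (L2fun (W _)); exact: L2_ext.
Qed.

Lemma extend_L2 W u : extend W u = W u.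
Proof. by rewrite (extendE W (L2P u)); congr (L2fun (W _)); exact: L2_ext. Qed.

Lemma bounded_extend W (C : R) :
  (forall (z : R[i]) u v, nrm (W (z *: u + v) - (z *: W u + W v)) = 0) ->
  (forall u, nrm (W u) <= C * nrm u) -> bounded_operator (extend W).
Proof.
move=> linW bdW; split.
- by move=> h h2; rewrite (extendE W h2); exact: L2P.
- move=> a h k h2 k2; rewrite (extendE W h2) (extendE W k2).
  have hkE : (fun t => a * h t + k t) = L2fun (a *: toL2 h2 + toL2 k2).
    by apply/funext => t; rewrite L2DE L2ZE.
  have WE : (fun t => a * W (toL2 h2) t + W (toL2 k2) t)
      = L2fun (a *: W (toL2 h2) + W (toL2 k2)).
    by apply/funext => t; rewrite L2DE L2ZE.
  by rewrite hkE WE extend_L2; exact/eqL2_nrm/linW.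
- exists C => h h2; rewrite (extendE W h2).
  exact: (bdW (toL2 h2)).
Qed.

Section FromRiesz.
Context (I : eqType) (e f : I -> @L2 R).
Hypothesis e_on : forall i j, ip (e i) (e j) = (i == j)%:R.
Hypothesis e_dense : forall v, cspan e v.
Hypothesis f_riesz : riesz f.

Lemma le_sqrtM (a b K : R) : 0 <= a -> 0 <= b -> 0 <= K ->
  a ^+ 2 <= K * b ^+ 2 -> a <= Num.sqrt K * b.
Proof.
move=> a0 b0 K0 h; have s0 := sqrtr_ge0 K.
by rewrite -(ler_pXn2r (_ : (0 < 2)%N)) ?nnegrE ?mulr_ge0// exprMn sqr_sqrtr.
Qed.

Lemma riesz_lincomb : exists C : R,
  (forall p, nrm (lincomb f p) <= C * nrm (lincomb e p)) /\
  (forall p, nrm (lincomb e p) <= C * nrm (lincomb f p)).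
Proof.
have [_ [K K0 KP]] := f_riesz; exists (Num.sqrt K).
split=> p; have [s [c [us pE]]] := lincomb_uniq p; rewrite !pE;
  have [h1 h2] := KP s c us; have se := sqr_nrm_sum_e e_on c us.
  by apply: le_sqrtM; rewrite ?nrm_ge0 ?(ltW K0)// se.
by apply: le_sqrtM; rewrite ?nrm_ge0 ?(ltW K0)// se.
Qed.

Lemma orthonormal_basis_L2 : orthonormal_basis (fun i => L2fun (e i)).
Proof.
split=> [i|i j|h h2 eps eps0]; [exact: L2P|exact: e_on|].
have [p hp] := e_dense (toL2 h2) eps0.
have [s [c [us pE]]] := lincomb_uniq p; exists s, c.
have E : (fun t => h t - \sum_(i <- s) c i * e i t) =
    L2fun (toL2 h2 - \sum_(i <- s) c i *: e i).
  by apply/funext => t; rewrite L2DE L2NE L2_sumE.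
by rewrite E -pE.
Qed.

(** The two inequalities make [e i |-> f i] and [f i |-> e i] bounded on
    combinations; their extensions by continuity are mutually inverse because the
    closures of their graphs are transposed. *)
Lemma riesz_basis_of_riesz : riesz_basis (fun i => L2fun (f i)).
Proof.
split=> [i|]; first exact: L2P.
have [C [fe ef]] := riesz_lincomb.
have f_dense := f_riesz.1.
have [U UP] := choice (graph_closure_total e_dense fe).
have [V VP] := choice (graph_closure_total f_dense ef).
have sym a b : graph_closure e f a b -> graph_closure f e b a.
  by move=> ab eps e0; have [p [h1 h2]] := ab _ e0; exists p.
have sym' a b : graph_closure f e a b -> graph_closure e f b a.
  by move=> ab eps e0; have [p [h1 h2]] := ab _ e0; exists p.
exists (fun i => L2fun (e i)), (extend U); split.
- exact: orthonormal_basis_L2.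
- split.
    apply: (@bounded_extend U `|C|) => [z u v|u].
      exact: (graph_closure_fun fe (UP _) (graph_closure_linear z (UP u) (UP v))).
    exact: graph_closure_bounded fe _ _ (UP u).
  exists (extend V); split.
  + apply: (@bounded_extend V `|C|) => [z u v|u].
      exact: (graph_closure_fun ef (VP _) (graph_closure_linear z (VP u) (VP v))).
    exact: graph_closure_bounded ef _ _ (VP u).
  + move=> h h2; rewrite (extendE U h2) extend_L2.
    exact: (eqL2_nrm (graph_closure_fun ef (VP _) (sym _ _ (UP (toL2 h2))))).
  + move=> h h2; rewrite (extendE V h2) extend_L2.
    exact: (eqL2_nrm (graph_closure_fun fe (UP _) (sym' _ _ (VP (toL2 h2))))).
- move=> i; rewrite extend_L2.
  exact: (eqL2_nrm (graph_closure_fun fe (UP _) (graph_closure_gen e f i))).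
Qed.

End FromRiesz.
End RieszBasis.

(** * Perturbation of orthonormal bases *)

Section PerturbationOfOrthonormalBases.
Context {R : realType}.
Implicit Types (u v w : @L2 R).

Section Stability.
Context (I : eqType) (e f : I -> @L2 R) (lam : R).
Hypothesis e_on : forall i j, ip (e i) (e j) = (i == j)%:R.
Hypothesis e_dense : forall v, cspan e v.
Hypothesis lam_ge0 : 0 <= lam.
Hypothesis lam_lt1 : lam < 1.
Hypothesis ef_close : forall s c, uniq s ->
  nrm (\sum_(i <- s) c i *: (e i - f i)) ^+ 2 <= lam ^+ 2 * \sum_(i <- s) normsq (c i).

Lemma close_nrm s c : uniq s ->
  nrm (\sum_(i <- s) c i *: e i - \sum_(i <- s) c i *: f i) <=
  lam * nrm (\sum_(i <- s) c i *: e i).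
Proof.
move=> us; have h := ef_close c us; have se := sqr_nrm_sum_e e_on c us.
have -> : \sum_(i <- s) c i *: e i - \sum_(i <- s) c i *: f i =
    \sum_(i <- s) c i *: (e i - f i).
  by rewrite -sumrB; apply: eq_bigr => i _; rewrite scalerBr.
by move: h; rewrite -se -exprMn ler_pXn2r ?nnegrE ?nrm_ge0 ?mulr_ge0 ?nrm_ge0.
Qed.

(** The approximation of [v] by a combination of the [e i] is carried over to the
    [f i]; the factor, slightly more than [lam], leaves room for its error. *)
Lemma contract v : exists p, nrm (v - lincomb f p) <= (1 + lam) / 2 * nrm v.
Proof.
have [v0|v0] := eqVneq (nrm v) 0.
  by exists [::]; rewrite /lincomb big_nil subr0 v0 mulr0.
have vp : 0 < nrm v by rewrite lt_neqAle eq_sym v0 nrm_ge0.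
have d0 : 0 < (1 - lam) / 4 * nrm v by rewrite mulr_gt0// divr_gt0// subr_gt0.
have [p vp'] := e_dense v d0; exists p.
have [s [c [us pE]]] := lincomb_uniq p.
have h1 := close_nrm c us; rewrite -!pE in h1.
have h2 : nrm (lincomb e p) <= nrm v + nrm (v - lincomb e p).
  by rewrite nrmB -{1}[lincomb e p](subrK v) addrC nrmD_le.
have h3 := nrm_triangle (lincomb e p) v (lincomb f p).
have h4 : lam * nrm (lincomb e p) <= lam * (nrm v + nrm (v - lincomb e p)).
  by rewrite ler_wpM2l.
have h5 : lam * nrm (v - lincomb e p) <= nrm (v - lincomb e p).
  by rewrite ler_piMl ?nrm_ge0// ltW.
move: h1 h2 h3 h4 h5 vp'; move: (nrm (v - lincomb f p)) (nrm (v - lincomb e p))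
  (nrm (lincomb e p - lincomb f p)) (nrm (lincomb e p)) (nrm v) => A B C D N.
by lra.
Qed.

Lemma contract_iter v k : exists p, nrm (v - lincomb f p) <= ((1 + lam) / 2) ^+ k * nrm v.
Proof.
elim: k => [|k [p IH]].
  by exists [::]; rewrite /lincomb big_nil subr0 expr0 mul1r.
have [q qP] := contract (v - lincomb f p).
have [r rE] := lincombDZ f 1 p q; exists r; rewrite rE scale1r opprD addrA exprS -mulrA.
by apply: le_trans qP _; rewrite ler_wpM2l// divr_ge0// addr_ge0.
Qed.

(** Paley and Wiener: a family close to an orthonormal basis has a dense span
    since subtracting the image of an approximation contracts distances. *)
Lemma riesz_of_close : riesz f.
Proof.
split=> [v eps e0|].
  have l1 : `|(1 + lam) / 2| < 1.
    by have := lam_ge0; have := lam_lt1 => h1 h2; rewrite ger0_norm; lra.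
  have : (fun k => ((1 + lam) / 2) ^+ k * nrm v) @ \oo --> (0 : R).
    by rewrite -[0](mul0r (nrm v)); apply: cvgMl; exact: cvg_expr.
  move/cvgrPdist_lt => /(_ _ e0)[k _ /(_ k (leqnn k))].
  have [p pP] := contract_iter v k; rewrite sub0r normrN => h; exists p.
  exact: le_lt_trans pP (le_lt_trans (ler_norm _) h).
have q0 : 0 < (1 - lam) ^+ 2 by rewrite exprn_gt0// subr_gt0.
exists (4 + (1 - lam) ^- 2); first by rewrite ltr_wpDr// invr_ge0 ltW.
move=> s c us; rewrite -(sqr_nrm_sum_e e_on c us).
have h := close_nrm c us.
set x := \sum_(i <- s) c i *: e i in h *; set y := \sum_(i <- s) c i *: f i in h *.
have hy : nrm y <= nrm x + nrm (x - y).
  by rewrite nrmB -{1}[y](subrK x) addrC nrmD_le.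
have hx : nrm x <= nrm y + nrm (x - y).
  by rewrite -{1}[x](subrK y) addrC nrmD_le.
have x0 := nrm_ge0 x; have y0 := nrm_ge0 y.
have lx : lam * nrm x <= nrm x by rewrite ler_piMl// ltW.
have l0 := lam_ge0; have l1 := lam_lt1.
move: lx hx hy h x0 y0; move: (nrm x) (nrm y) (nrm (x - y)) => X Y Z lx hx hy h x0 y0.
split; rewrite mulrDl.
  rewrite ler_wpDr ?mulr_ge0 ?invr_ge0 ?sqr_ge0 ?(ltW q0)//.
  have -> : 4 * X ^+ 2 = (2 * X) ^+ 2 by ring.
  by rewrite ler_pXn2r ?nnegrE ?mulr_ge0//; lra.
rewrite ler_wpDl ?mulr_ge0 ?sqr_ge0// mulrC ler_pdivlMr// -exprMn.
by rewrite ler_pXn2r ?nnegrE ?mulr_ge0//; lra.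
Qed.

End Stability.

(** Induction on the list: the new cross terms are a multiple of the weighted sum of
    the squares [(x i - x j) ^+ 2]. *)
Lemma weighted_cauchy_schwarz (J : Type) (s : seq J) (a x : J -> R) :
  (forall j, 0 <= a j) ->
  (\sum_(j <- s) a j * x j) ^+ 2 <=
  (\sum_(j <- s) a j) * \sum_(j <- s) a j * x j ^+ 2.
Proof.
move=> a0; elim: s => [|j s IH]; first by rewrite !big_nil expr0n mul0r.
rewrite !big_cons; move: IH.
have : 0 <= \sum_(i <- s) a i * (x i - x j) ^+ 2.
  by apply: sumr_ge0 => i _; rewrite mulr_ge0 ?sqr_ge0.
have -> : \sum_(i <- s) a i * (x i - x j) ^+ 2 = \sum_(i <- s) a i * x i ^+ 2
    - 2 * x j * (\sum_(i <- s) a i * x i) + x j ^+ 2 * \sum_(i <- s) a i.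
  rewrite !mulr_sumr -sumrB -big_split /=; apply: eq_bigr => i _; ring.
move: (\sum_(_ <- _) _) (\sum_(_ <- _) _) (\sum_(_ <- _) _) (a0 j) => P Q T aj h1 h2.
have h3 := mulr_ge0 aj h1; rewrite -subr_ge0 in h2; rewrite -subr_ge0.
have -> : (a j + P) * (a j * x j ^+ 2 + T) - (a j * x j + Q) ^+ 2 =
  (P * T - Q ^+ 2) + a j * (T - 2 * x j * Q + x j ^+ 2 * P) by ring.
exact: addr_ge0.
Qed.

Lemma cabsE (z : R[i]) : (cabs z)%:C = `|z|.
Proof. by rewrite normc_def. Qed.

Lemma cabs_sum_le (J : Type) (s : seq J) (z : J -> R[i]) :
  cabs (\sum_(j <- s) z j) <= \sum_(j <- s) cabs (z j).
Proof.
rewrite -lecR cabsE rmorph_sum; apply: le_trans (ler_norm_sum _ _ _) _.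
by apply: ler_sum => j _; rewrite -cabsE.
Qed.

(** The weighted Cauchy-Schwarz inequality on each row uses the bound of the row
    sums; exchanging the two sums then leaves the column sums. *)
Lemma schur_test (I J : Type) (s : seq I) (S : seq J) (A al : J -> I -> R)
    (c : I -> R[i]) (sig : R) : 0 <= sig ->
  (forall m n, `|A m n| <= al m n) ->
  (forall m, \sum_(n <- s) al m n <= sig) ->
  (forall n, \sum_(m <- S) al m n <= sig) ->
  \sum_(m <- S) normsq (\sum_(n <- s) c n * (A m n)%:C) <=
  sig ^+ 2 * \sum_(n <- s) normsq (c n).
Proof.
move=> sig0 Aal rows cols.
have al0 m n : 0 <= al m n by exact: le_trans (normr_ge0 _) (Aal m n).
apply: (@le_trans _ _ (\sum_(m <- S) sig * \sum_(n <- s) al m n * normsq (c n))).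
  apply: ler_sum => m _.
  have h1 : cabs (\sum_(n <- s) c n * (A m n)%:C) <= \sum_(n <- s) al m n * cabs (c n).
    apply: le_trans (cabs_sum_le _ _) _; apply: ler_sum => n _.
    by rewrite cabsM cabsR mulrC ler_wpM2r ?cabs_ge0.
  have h2 := weighted_cauchy_schwarz s (fun n => cabs (c n)) (al0 m).
  have h0 : 0 <= \sum_(n <- s) al m n * cabs (c n).
    by apply: sumr_ge0 => n _; rewrite mulr_ge0 ?cabs_ge0.
  rewrite -sqr_cabs; apply: le_trans (_ : (\sum_(n <- s) al m n * cabs (c n)) ^+ 2 <= _).
    by rewrite ler_pXn2r ?nnegrE ?cabs_ge0.
  apply: le_trans h2 _.
  have -> : \sum_(n <- s) al m n * cabs (c n) ^+ 2 = \sum_(n <- s) al m n * normsq (c n).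
    by apply: eq_bigr => n _; rewrite sqr_cabs.
  by rewrite ler_wpM2r// sumr_ge0// => n _; rewrite mulr_ge0 ?normsq_ge0.
rewrite -mulr_sumr exchange_big /= expr2 -mulrA ler_wpM2l//.
rewrite mulr_sumr; apply: ler_sum => n _.
by rewrite -mulr_suml ler_wpM2r ?normsq_ge0.
Qed.

End PerturbationOfOrthonormalBases.

(** * Trigonometric inequalities *)

Section TrigonometricInequalities.
Context {R : realType}.
Implicit Types x y d L : R.

Lemma sin_mvt x : 0 < x -> exists2 y, 0 < y < x & sin x = x * cos y.
Proof.
move=> x0; have cs : {within `[0, x], continuous (@sin R)}.
  by apply: continuous_subspaceT; exact: continuous_sin.
have [y yI] := MVT x0 (fun t _ => is_derive_sin t) cs.
rewrite sin0 !subr0 mulrC => sxE; exists y => //.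
Qed.

Lemma sin_le_id x : 0 <= x -> sin x <= x.
Proof.
rewrite le_eqVlt => /orP[/eqP <-|x0]; first by rewrite sin0.
have [y _ ->] := sin_mvt x0.
by rewrite ler_piMr ?cos_le1// ltW.
Qed.

Lemma mulr_cos_le_sin x : 0 <= x <= pi -> x * cos x <= sin x.
Proof.
move=> /andP[]; rewrite le_eqVlt => /orP[/eqP <-|x0 xpi].
  by rewrite mul0r sin0.
have [y /andP[y0 yx] ->] := sin_mvt x0.
have ypi : y <= pi by exact: le_trans (ltW yx) xpi.
rewrite ler_pM2l// leNgt ltr_cos ?in_itv /= ?(ltW x0) ?(ltW y0)//.
by rewrite -leNgt ltW.
Qed.

Lemma sin_lt_cos x : 0 <= x < pi / 4 -> sin x < cos x.
Proof.
move=> /andP[x0 x4]; have p0 := pi_gt0 R.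
have -> : cos x = sin (pi / 2 - x) by rewrite -cosN -sinDpihalf addrC.
rewrite ltr_sin ?in_itv /=; [lra|apply/andP; split; lra..].
Qed.

(** For [x = pi * d] and [pi * L = x + h], the addition formula gives
    [sin (x + h) <= sin x + h * cos x], and [x * cos x <= sin x]. *)
Lemma sinc_decreasing d L : 0 <= d <= L -> L <= 1 / 2 -> sinc L <= sinc d.
Proof.
move=> /andP[d0 dL] L2; have p0 := pi_gt0 R.
have [L0|L0] := eqVneq L 0; first by have -> : d = L by lra.
have Lp : 0 < L by rewrite lt_neqAle eq_sym L0 (le_trans d0).
rewrite /sinc (negbTE L0); have [d00|dn0] := eqVneq d 0.
  by rewrite ler_pdivrMr ?mulr_gt0// mul1r sin_le_id// mulr_ge0// ltW.
have dp : 0 < d by rewrite lt_neqAle eq_sym dn0.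
pose x := pi * d; pose h := pi * (L - d).
have x0 : 0 < x by rewrite mulr_gt0.
have h0 : 0 <= h by rewrite mulr_ge0 ?(ltW p0)// subr_ge0.
have -> : pi * L = x + h by rewrite /x /h; ring.
have xpi : x <= pi / 2.
  have := ler_wpM2l (ltW p0) (le_trans dL L2); rewrite -/x; lra.
have sx : 0 <= sin x by apply: sin_ge0_pi; rewrite (ltW x0)/=; lra.
have cx : 0 <= cos x by apply: cos_ge0_pihalf; apply/andP; split; lra.
have xh0 : 0 < x + h by rewrite ltr_wpDr.
rewrite ler_pdivrMr// mulrAC ler_pdivlMr// -/x.
rewrite sinD.
have h1 : sin x * cos h <= sin x by rewrite ler_piMr ?cos_le1.
have h2 : cos x * sin h <= cos x * h by rewrite ler_wpM2l ?sin_le_id.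
have h3 : x * cos x <= sin x by apply: mulr_cos_le_sin; rewrite (ltW x0)/=; lra.
have h4 := ler_wpM2r h0 h3; have h5 := ler_wpM2r (ltW x0) (lerD h1 h2).
apply: le_trans h5 _.
by rewrite mulrDr mulrDl [cos x * h * x]mulrAC [cos x * x]mulrC lerD2l.
Qed.

(** The derivative [cos (pi * d) - pi * d * sin (pi * d)] is positive because
    [pi * d < 1] and the sine is less than the cosine. The finite increment is
    estimated by the same two inequalities. *)
Lemma mulr_cos_increasing d L : 0 <= d <= L -> L < 1 / 4 ->
  d * cos (pi * d) <= L * cos (pi * L).
Proof.
move=> /andP[d0 dL] L4; have p0 := pi_gt0 R.
have p4 : pi <= 4 :> R by have := pihalf_lt2 R; lra.
have L0 : 0 <= L by exact: le_trans dL.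
pose a := pi * ((L + d) / 2); pose b := pi * ((L - d) / 2).
have -> : pi * d = a - b by rewrite /a /b; field.
have E : pi * L = a + b by rewrite /a /b; field.
have b0 : 0 <= b by rewrite /b mulr_ge0 ?(ltW p0)//; lra.
have hpL : pi * L < pi / 4 by have := ltr_pM2l p0 L (1 / 4); rewrite L4 => /idP; lra.
have hL : sin (pi * L) < cos (pi * L).
  by apply: sin_lt_cos; rewrite hpL mulr_ge0// ltW.
have a0 : 0 <= a by rewrite /a mulr_ge0 ?(ltW p0)//; lra.
have aL : a <= pi * L by rewrite E; lra.
have sa : sin a <= sin (pi * L).
  rewrite leNgt ltr_sin ?in_itv /=; [by rewrite -leNgt|apply/andP; split; lra..].
have sL : 0 <= sin (pi * L) by apply: sin_ge0_pi; rewrite mulr_ge0 ?(ltW p0)//=; lra.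
have cd : cos (a - b) - cos (pi * L) = 2 * (sin a * sin b).
  by rewrite E cosB cosD; ring.
have sb0 : 0 <= sin b by apply: sin_ge0_pi; rewrite b0 /=; lra.
have h1 : sin a * sin b <= sin (pi * L) * b.
  by apply: (le_trans (ler_wpM2r sb0 sa)); rewrite ler_wpM2l ?sin_le_id.
have pd : pi * d <= 1.
  have h2 : pi * d <= pi * L by rewrite ler_wpM2l ?(ltW p0).
  by lra.
have h2 : d * (2 * (sin a * sin b)) <= d * (2 * (sin (pi * L) * b)).
  by rewrite ler_wpM2l// ler_wpM2l.
have h3 : d * (2 * (sin (pi * L) * b)) = (pi * d) * (sin (pi * L) * (L - d)).
  by rewrite /b; field.
have h4 : (pi * d) * (sin (pi * L) * (L - d)) <= sin (pi * L) * (L - d).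
  by rewrite ler_piMl ?mulr_ge0// subr_ge0.
have h5 : sin (pi * L) * (L - d) <= cos (pi * L) * (L - d).
  by rewrite ler_wpM2r ?subr_ge0// ltW.
have -> : cos (a - b) = cos (pi * L) + 2 * (sin a * sin b) by rewrite -cd; ring.
move: h2 h3 h4 h5; move: (cos (pi * L)) (sin (pi * L)) (sin a * sin b) => c t q h2 h3 h4 h5.
by rewrite mulrDr; move: h3 => h3; lra.
Qed.

End TrigonometricInequalities.

(** * Kadec's one quarter theorem *)

Section Kadec.
Context {R : realType}.
Implicit Types (a d L x y : R) (j m n : int).

Lemma sum_sub_le (I : eqType) (s t : seq I) (F : I -> R) : uniq s -> uniq t ->
  {subset s <= t} -> (forall i, 0 <= F i) ->
  \sum_(i <- s) F i <= \sum_(i <- t) F i.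
Proof.
move=> us ut st F0; rewrite [leRHS](bigID (mem s))/= -[X in X + _]big_filter.
have -> : \sum_(i <- [seq i <- t | i \in s]) F i = \sum_(i <- s) F i.
  apply: perm_big; apply: uniq_perm => // [|i]; first exact: filter_uniq.
  by rewrite mem_filter /=; case: (boolP (i \in s)) => //= /st ->.
by rewrite lerDl sumr_ge0.
Qed.

Lemma limit_sum_le (I : eqType) (F : I -> R) (S : R) : (forall i, 0 <= F i) ->
  (forall eps : R, 0 < eps -> exists s0 : seq I, forall s : seq I, uniq s ->
    {subset s0 <= s} -> `|S - \sum_(i <- s) F i| < eps) ->
  forall s : seq I, uniq s -> \sum_(i <- s) F i <= S.
Proof.
move=> F0 lim s us; apply/ler_addgt0Pr => eps /lim[s0 H].
pose t := undup (s0 ++ s).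
have s0t : {subset s0 <= t} by move=> i si; rewrite mem_undup mem_cat si.
have st : {subset s <= t} by move=> i si; rewrite mem_undup mem_cat si orbT.
have := H t (undup_uniq _) s0t; rewrite ltr_norml => /andP[h _].
apply: le_trans (sum_sub_le us (undup_uniq _) st F0) _.
by rewrite addrC -lerBlDr -[leLHS]opprB lerNl ltW.
Qed.

(** Parseval's identity for the exponentials of frequencies [x] and [y] in the
    orthonormal basis of frequencies [a + n]. *)
Lemma sinc_parseval a x y (eps : R) : 0 < eps ->
  exists s0 : seq int, forall s, uniq s -> {subset s0 <= s} ->
  `|sinc (x - y) - \sum_(n <- s) sinc (x - (a + n%:~R)) * sinc (y - (a + n%:~R))| < eps.
Proof.
move=> e0; have [s0 H] := parseval_ip (uexp_orthonormal a) (uexp_dense a) (uexp x) (uexp y) e0.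
exists s0 => s us ss; have := H s us ss.
rewrite ip_uexp.
have -> : \sum_(n <- s)
    ip (uexp x) (uexp (a + n%:~R)) * conjc (ip (uexp y) (uexp (a + n%:~R)))
   = (\sum_(n <- s) sinc (x - (a + n%:~R)) * sinc (y - (a + n%:~R)))%:C.
  rewrite rmorph_sum; apply: eq_bigr => n _.
  by rewrite !ip_uexp conjc_real [RHS]rmorphM.
by rewrite -rmorphB cabsR.
Qed.

Lemma sincN x : sinc (- x) = sinc x :> R.
Proof.
rewrite /sinc oppr_eq0; case: eqP => // x0.
by rewrite mulrN sinN invrN mulrNN.
Qed.

Lemma sincE x : x != 0 -> sinc x = sin (pi * x) / (pi * x) :> R.
Proof. by rewrite /sinc => /negbTE ->. Qed.

Lemma cos_pi_int_sq n : cos (pi * n%:~R) ^+ 2 = 1 :> R.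
Proof. by have := cos2Dsin2 (pi * n%:~R : R); rewrite sin_pi_int expr0n addr0. Qed.

Lemma sin_piD_int x n : sin (pi * (x + n%:~R)) = cos (pi * n%:~R) * sin (pi * x) :> R.
Proof. by rewrite mulrDr sinD sin_pi_int mulr0 addr0 mulrC. Qed.

Lemma sin_piB_int x n : sin (pi * (x - n%:~R)) = cos (pi * n%:~R) * sin (pi * x) :> R.
Proof. by rewrite mulrBr sinB sin_pi_int mulr0 subr0 mulrC. Qed.

Lemma cos_pi_half n : cos (pi * (n%:~R + 1 / 2)) = 0 :> R.
Proof.
by rewrite mulrDr mulrA mulr1 cosDpihalf sin_pi_int oppr0.
Qed.

Lemma sin_pi_half_sq n : sin (pi * (n%:~R + 1 / 2)) ^+ 2 = 1 :> R.
Proof.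
by have := cos2Dsin2 (pi * (n%:~R + 1 / 2) : R); rewrite cos_pi_half expr0n add0r.
Qed.

Lemma int_sqr_ge1 n : n != 0 -> 1 <= n%:~R ^+ 2 :> R.
Proof.
move=> n0; rewrite -rmorphXn -[1]/(1%:~R) ler_int.
by rewrite -gtz0_ge1 lt_neqAle eq_sym expf_neq0//= sqr_ge0.
Qed.

Lemma half_sqr_ge n : 1 / 4 <= (n%:~R + 1 / 2) ^+ 2 :> R.
Proof.
have : (0 : R) <= (n * (n + 1))%:~R.
  rewrite ler0z; case: (leP 0 n) => n0; first by rewrite mulr_ge0 ?addr_ge0.
  by rewrite mulr_le0 ?(ltW n0)// lezD1.
rewrite intrM intrD => h.
have -> : (n%:~R + 1 / 2) ^+ 2 = n%:~R * (n%:~R + 1) + 1 / 4 :> R by field.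
by rewrite lerDr.
Qed.

(** Up to sign, [alpha L j] and [beta L j] are the coordinates, in the bases
    shifted by [0] and [1 / 2], of the parts even and odd in [L] of the difference
    [uexp a - uexp (a + L)]. *)
Definition alpha L j : R :=
  if j == 0 then 1 - sinc L else L * sin (pi * L) / (pi * (j%:~R ^+ 2 - L ^+ 2)).

Definition beta L j : R :=
  L * cos (pi * L) / (pi * ((j%:~R + 1 / 2) ^+ 2 - L ^+ 2)).

Section Bounds.
Variable L : R.
Hypothesis L_gt0 : 0 < L.
Hypothesis L_lt : L < 1 / 4.

Let piL0 : 0 < pi * L. Proof. by rewrite mulr_gt0 ?pi_gt0. Qed.
Let piL4 : pi * L < pi / 4.
Proof. by rewrite ltr_pM2l ?pi_gt0//; move: L_lt; rewrite mul1r. Qed.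
Let sL0 : 0 < sin (pi * L).
Proof. by apply: sin_gt0_pi; rewrite piL0 /=; have := piL4; have := pi_gt0 R; lra. Qed.
Let cL0 : 0 < cos (pi * L).
Proof. by apply: lt_trans sL0 _; apply: sin_lt_cos; rewrite (ltW piL0) piL4. Qed.
Let L_sqr : L ^+ 2 < 1 / 16.
Proof.
have -> : 1 / 16 = (1 / 4) ^+ 2 :> R by field.
by rewrite ltr_pXn2r ?nnegrE ?(ltW L_gt0).
Qed.

Lemma alpha_ge0 j : 0 <= alpha L j.
Proof.
rewrite /alpha; case: eqVneq => [_|j0].
  rewrite subr_ge0 sincE ?gt_eqF// ler_pdivrMr// mul1r; exact: sin_le_id (ltW piL0).
have := int_sqr_ge1 j0; have := L_sqr => h1 h2.
by rewrite divr_ge0 ?mulr_ge0 ?pi_ge0 ?(ltW L_gt0) ?(ltW sL0)//; lra.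
Qed.

Lemma beta_ge0 j : 0 <= beta L j.
Proof.
have := half_sqr_ge j; have := L_sqr => h1 h2.
by rewrite /beta divr_ge0 ?mulr_ge0 ?pi_ge0 ?(ltW L_gt0) ?(ltW cL0)//; lra.
Qed.

(** Parseval's identity for the two exponentials of frequencies [L] and [- L] is
    the partial fraction expansion of the cotangent at [pi * L]. *)
Lemma sum_alpha_le (s : seq int) : uniq s -> \sum_(j <- s) alpha L j <= 1 - cos (pi * L).
Proof.
have s2L : sinc (2 * L) = sinc L * cos (pi * L) :> R.
  rewrite !sincE ?gt_eqF ?mulr_gt0//.
  have -> : pi * (2 * L) = (pi * L) *+ 2 by rewrite mulrCA mulr_natl.
  rewrite sin_mulr2n; move: (pi * L) piL0 (sin _) (cos _) => p p0 sp cp.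
  by rewrite !mulr2n; field; rewrite !gt_eqF ?addr_gt0.
have sLp : 0 < sinc L by rewrite sincE ?gt_eqF// divr_gt0.
pose F j := if j == 0 then 0 else alpha L j.
have F0 j : 0 <= F j by rewrite /F; case: ifP => // _; exact: alpha_ge0.
have FE j : j != 0 -> F j * sinc L = - (sinc (L - (0 + j%:~R)) * sinc (- L - (0 + j%:~R))).
  move=> j0; rewrite /F /alpha (negbTE j0) add0r.
  have j2 := int_sqr_ge1 j0; have L2 := L_sqr.
  have jL : j%:~R ^+ 2 - L ^+ 2 != 0 by rewrite gt_eqF//; lra.
  have fac : j%:~R ^+ 2 - L ^+ 2 = - ((L - j%:~R) * (L + j%:~R)) by ring.
  move: (jL); rewrite fac oppr_eq0 mulf_eq0 negb_or => /andP[n1 n2].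
  have Ln : L != 0 by rewrite gt_eqF.
  rewrite -[- L - _]opprD sincN !sincE//.
  rewrite sin_piB_int sin_piD_int.
  have c2 := cos_pi_int_sq j.
  have pn : pi != 0 :> R by rewrite gt_eqF ?pi_gt0.
  move: (pi) pn (sin _) (cos _) c2 => p pn sp cp c2.
  have -> : - (cp * sp / (p * (L - j%:~R)) * (cp * sp / (p * (L + j%:~R)))) =
    - (cp ^+ 2 * sp ^+ 2 / (p ^+ 2 * ((L - j%:~R) * (L + j%:~R)))).
    by field; rewrite pn n1 n2.
  by rewrite c2; field; rewrite Ln pn n1 n2.
have bound : forall t : seq int, uniq t ->
    \sum_(j <- t) F j * sinc L <= sinc L ^+ 2 - sinc (2 * L).
  apply: (@limit_sum_le _ (fun j => F j * sinc L)) => [i|eps e0].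
    by rewrite mulr_ge0 ?(ltW sLp).
  have [s0 H] := sinc_parseval 0 L (- L) e0.
  exists (0 :: s0) => t ut st; have t0 : 0 \in t by apply: st; rewrite inE eqxx.
  have st0 : {subset s0 <= t} by move=> i i0; apply: st; rewrite inE i0 orbT.
  have z0 : sinc (L - (0 + 0%:~R)) * sinc (- L - (0 + 0%:~R)) = sinc L ^+ 2.
    by rewrite mulr0z addr0 !subr0 sincN.
  have := H t ut st0; rewrite (bigD1_seq 0)//= z0 => {}H.
  rewrite (bigD1_seq 0)//= {1}/F eqxx mul0r add0r (eq_bigr _ FE) sumrN opprK.
  have E2 : L - - L = 2 * L by ring.
  move: H; rewrite E2 -normrN; congr (`|_| < _); ring.
move=> us.
have F_le : \sum_(j <- s) F j <= sinc L - cos (pi * L).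
  have := bound s us; rewrite -mulr_suml -ler_pdivlMr// s2L => h.
  apply: le_trans h _; rewrite le_eqVlt; apply/orP; left; apply/eqP.
  by field; rewrite gt_eqF.
have [s0|s0] := boolP (0 \in s); last first.
  rewrite big_seq (eq_bigr F) => [|j js]; last first.
    by rewrite /F; case: eqP js s0 => // -> ->.
  rewrite -big_seq; apply: le_trans F_le _; rewrite lerD2r.
  have := alpha_ge0 0; rewrite /alpha eqxx; lra.
rewrite (bigD1_seq 0)//= {1}/alpha eqxx.
have := F_le; rewrite (bigD1_seq 0)//= {1}/F eqxx add0r.
rewrite (eq_bigr (alpha L)) => [h|j j0]; last by rewrite /F (negbTE j0).
by move: (\sum_(_ <- _ | _) _) h => S h; lra.
Qed.

(** The same identity in the basis shifted by [1 / 2] is the partial fraction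
    expansion of the tangent at [pi * L]. *)
Lemma sum_beta_le (s : seq int) : uniq s -> \sum_(j <- s) beta L j <= sin (pi * L).
Proof.
have p0 := pi_gt0 R.
pose k := cos (pi * L) / (pi * L).
have k0 : 0 < k by rewrite divr_gt0.
have betaE j : beta L j * k = sinc (L - (1 / 2 + j%:~R)) * sinc (- L - (1 / 2 + j%:~R)).
  rewrite [1 / 2 + _]addrC /beta; set x : R := j%:~R + 1 / 2.
  have x2 : 1 / 4 <= x ^+ 2 := half_sqr_ge j; have L2 := L_sqr.
  have cx : cos (pi * x) = 0 := cos_pi_half j.
  have sx : sin (pi * x) ^+ 2 = 1 := sin_pi_half_sq j.
  rewrite /k.
  have xL : x ^+ 2 - L ^+ 2 != 0 by rewrite gt_eqF//; lra.
  have fac : x ^+ 2 - L ^+ 2 = - ((L - x) * (L + x)) by ring.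
  move: (xL); rewrite fac oppr_eq0 mulf_eq0 negb_or => /andP[n1 n2].
  rewrite -[- L - _]opprD sincN !sincE//.
  have -> : sin (pi * (L - x)) = - (cos (pi * L) * sin (pi * x)).
    by rewrite mulrBr sinB cx mulr0 sub0r.
  have -> : sin (pi * (L + x)) = cos (pi * L) * sin (pi * x).
    by rewrite mulrDr sinD cx mulr0 add0r.
  have Ln : L != 0 by rewrite gt_eqF.
  have pn : pi != 0 :> R by rewrite gt_eqF ?pi_gt0.
  move: (pi) pn (sin _) (cos _) sx => p pn sp cp c2.
  have -> : - (cp * sp) / (p * (L - x)) * (cp * sp / (p * (L + x))) =
    - (cp ^+ 2 * sp ^+ 2 / (p ^+ 2 * ((L - x) * (L + x)))).
    by field; rewrite pn n1 n2.
  by rewrite c2; field; rewrite Ln pn n1 n2.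
have bound : forall t : seq int, uniq t ->
    \sum_(j <- t) beta L j * k <= sinc (2 * L).
  apply: (@limit_sum_le _ (fun j => beta L j * k)) => [i|eps e0].
    by rewrite mulr_ge0 ?beta_ge0 ?(ltW k0).
  have [s0 H] := sinc_parseval (1 / 2) L (- L) e0.
  exists s0 => t ut st; rewrite (eq_bigr _ (fun j _ => betaE j)).
  have -> : 2 * L = L - - L by ring.
  exact: H.
move=> us; have := bound s us; rewrite -mulr_suml -ler_pdivlMr// => h.
apply: le_trans h _; rewrite le_eqVlt; apply/orP; left; apply/eqP.
rewrite sincE ?gt_eqF ?mulr_gt0// /k.
have -> : pi * (2 * L) = (pi * L) *+ 2 by rewrite mulrCA mulr_natl.
rewrite sin_mulr2n; move: (pi * L) piL0 (sin _) (cos _) cL0 => p pp sp cp c0.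
by rewrite !mulr2n; field; rewrite !gt_eqF ?addr_gt0.
Qed.

End Bounds.

Lemma denominators_neq0 L d x : 0 <= d <= L -> L < 1 / 4 -> 1 / 4 <= x ^+ 2 ->
  [/\ x + d != 0, x - d != 0 & 0 < x ^+ 2 - L ^+ 2 <= x ^+ 2 - d ^+ 2].
Proof.
move=> /andP[d0 dL] L4 x4; have L0 := le_trans d0 dL.
have L2 : L ^+ 2 < 1 / 4.
  have : L ^+ 2 <= (1 / 4) ^+ 2 by rewrite ler_pXn2r ?nnegrE// ltW.
  by rewrite !expr2; lra.
have d2 : d ^+ 2 <= L ^+ 2 by rewrite ler_pXn2r ?nnegrE.
have : (x + d) * (x - d) != 0.
  have -> : (x + d) * (x - d) = x ^+ 2 - d ^+ 2 by ring.
  by rewrite gt_eqF//; lra.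
by rewrite mulf_eq0 negb_or => /andP[-> ->]; split => //; apply/andP; split; lra.
Qed.

(** The entry is computed by the addition formulas; numerator and denominator of its
    absolute value are monotone in the displacement [`|d|], so that [L] is the worst
    one. *)
Lemma cosine_entry_le L d j : 0 < L -> L < 1 / 4 -> `|d| <= L ->
  `|sinc j%:~R - (sinc (j%:~R + d) + sinc (j%:~R - d)) / 2| <= alpha L j.
Proof.
move=> L0 L4; wlog d0 : d / 0 <= d.
  move=> H dL; have [d0|/ltW d0] := leP 0 d; first exact: H.
  have := H (- d); rewrite oppr_ge0 normrN opprK => /(_ d0 dL).
  by rewrite [sinc (_ - d) + _]addrC.
rewrite ger0_norm// => dL; have p0 := pi_gt0 R.
have L2 : L <= 1 / 2 by lra.
rewrite /alpha; case: eqVneq => [->|j0].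
  rewrite mulr0z add0r sub0r sincN sinc0.
  have -> : (sinc d + sinc d) / 2 = sinc d by field.
  have d1 : sinc d <= 1 by rewrite -sinc0; apply: sinc_decreasing; lra.
  by rewrite ger0_norm ?subr_ge0// lerD2l lerN2 sinc_decreasing// d0.
have j4 : 1 / 4 <= j%:~R ^+ 2 :> R by have := int_sqr_ge1 j0; lra.
have dL' : 0 <= d <= L by rewrite d0.
have [n1 n2 /andP[n3 n4]] := denominators_neq0 dL' L4 j4.
have n2' : d - j%:~R != 0 by rewrite -opprB oppr_eq0.
rewrite sinc_int (negbTE j0) -[j%:~R - d]opprB sincN !sincE//.
rewrite [j%:~R + d]addrC sin_piD_int sin_piB_int.
have pn : pi != 0 :> R by rewrite gt_eqF.
have n5 : j%:~R ^+ 2 - d ^+ 2 != 0 by rewrite gt_eqF//; lra.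
have n1' : d + j%:~R != 0 by rewrite addrC.
have -> : 0 - (cos (pi * j%:~R) * sin (pi * d) / (pi * (d + j%:~R)) +
    cos (pi * j%:~R) * sin (pi * d) / (pi * (d - j%:~R))) / 2 =
  cos (pi * j%:~R) * (d * sin (pi * d) / (pi * (j%:~R ^+ 2 - d ^+ 2))).
  have fac : j%:~R ^+ 2 - d ^+ 2 = - ((d + j%:~R) * (d - j%:~R)) by ring.
  rewrite fac; move: (pi) pn (cos _) (sin _) => p pn' cp sp.
  by field; rewrite pn' n1' n2'.
have pd0 : 0 <= pi * d by rewrite mulr_ge0// ltW.
have pL4 : pi * L < pi / 4 by have := L4; rewrite -(ltr_pM2l p0) mul1r.
have pdL : pi * d <= pi * L by rewrite ler_pM2l.
have s0 : 0 <= sin (pi * d) by apply: sin_ge0_pi; rewrite pd0 /=; lra.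
have sdL : sin (pi * d) <= sin (pi * L).
  by rewrite leNgt ltr_sin ?in_itv /= -?leNgt//; apply/andP; split; lra.
have q0 : 0 <= d * sin (pi * d) / (pi * (j%:~R ^+ 2 - d ^+ 2)).
  by rewrite divr_ge0 ?mulr_ge0 ?pi_ge0//; lra.
rewrite normrM (ger0_norm q0).
apply: le_trans (_ : 1 * (d * sin (pi * d) / (pi * (j%:~R ^+ 2 - d ^+ 2))) <= _).
  by rewrite ler_wpM2r ?cos_max.
rewrite mul1r; apply: ler_pM; rewrite ?mulr_ge0 ?invr_ge0 ?mulr_ge0 ?pi_ge0//; first lra.
  exact: ler_pM.
have m1 : 0 < pi * (j%:~R ^+ 2 - d ^+ 2) by rewrite mulr_gt0//; lra.
have m2 : 0 < pi * (j%:~R ^+ 2 - L ^+ 2) by rewrite mulr_gt0.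
by rewrite lef_pV2 ?posrE// ler_pM2l.
Qed.

(** At the half-integers it is the cosine of [pi * d] that factors out, and
    [d * cos (pi * d)] increases with [d] as long as [L < 1 / 4]. *)
Lemma sine_entry_le L d j : 0 < L -> L < 1 / 4 -> `|d| <= L ->
  `|(sinc (j%:~R + 1 / 2 - d) - sinc (j%:~R + 1 / 2 + d)) / 2| <= beta L j.
Proof.
move=> L0 L4; wlog d0 : d / 0 <= d.
  move=> H dL; have [d0|/ltW d0] := leP 0 d; first exact: H.
  have := H (- d); rewrite oppr_ge0 normrN opprK => /(_ d0 dL).
  by rewrite -normrN -mulNr opprB.
rewrite ger0_norm// => dL; have p0 := pi_gt0 R.
rewrite /beta; set x : R := j%:~R + 1 / 2.
have x4 : 1 / 4 <= x ^+ 2 := half_sqr_ge j.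
have cx : cos (pi * x) = 0 := cos_pi_half j.
have dL' : 0 <= d <= L by rewrite d0.
have [n1 n2 /andP[n3 n4]] := denominators_neq0 dL' L4 x4.
rewrite !sincE//.
have -> : sin (pi * (x - d)) = sin (pi * x) * cos (pi * d).
  by rewrite mulrBr sinB cx mul0r subr0.
have -> : sin (pi * (x + d)) = sin (pi * x) * cos (pi * d).
  by rewrite mulrDr sinD cx mul0r addr0.
have pn : pi != 0 :> R by rewrite gt_eqF.
have -> : (sin (pi * x) * cos (pi * d) / (pi * (x - d)) -
    sin (pi * x) * cos (pi * d) / (pi * (x + d))) / 2 =
  sin (pi * x) * (d * cos (pi * d) / (pi * (x ^+ 2 - d ^+ 2))).
  have fac : x ^+ 2 - d ^+ 2 = (x + d) * (x - d) by ring.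
  rewrite fac; move: (pi) pn (cos _) (sin _) => p pn' cp sp.
  by field; rewrite pn' n1 n2.
have pd0 : 0 <= pi * d by rewrite mulr_ge0// ltW.
have pL4 : pi * L < pi / 4 by have := L4; rewrite -(ltr_pM2l p0) mul1r.
have pdL : pi * d <= pi * L by rewrite ler_pM2l.
have c0 : 0 <= cos (pi * d) by apply: cos_ge0_pihalf; apply/andP; split; lra.
have q0 : 0 <= d * cos (pi * d) / (pi * (x ^+ 2 - d ^+ 2)).
  by rewrite divr_ge0 ?mulr_ge0 ?pi_ge0//; lra.
rewrite normrM (ger0_norm q0).
apply: le_trans (_ : 1 * (d * cos (pi * d) / (pi * (x ^+ 2 - d ^+ 2))) <= _).
  by rewrite ler_wpM2r ?sin_max.
rewrite mul1r; apply: ler_pM; rewrite ?mulr_ge0 ?invr_ge0 ?mulr_ge0 ?pi_ge0//; first lra.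
  exact: mulr_cos_increasing.
have m1 : 0 < pi * (x ^+ 2 - d ^+ 2) by rewrite mulr_gt0//; lra.
have m2 : 0 < pi * (x ^+ 2 - L ^+ 2) by rewrite mulr_gt0.
by rewrite lef_pV2 ?posrE// ler_pM2l.
Qed.

Lemma sum_translate_le (h : int -> R) (S : R) (s : seq int) (f : int -> int) :
  (forall t, uniq t -> \sum_(j <- t) h j <= S) -> injective f -> uniq s ->
  \sum_(n <- s) h (f n) <= S.
Proof.
move=> hS fi us; rewrite -(big_map f xpredT h); apply: hS.
by rewrite map_inj_uniq.
Qed.

(** The difference of the two exponentials of index [n] is split into its parts even
    and odd in the displacement. The coordinates of the odd part in the basis
    [uexp (a + m)] decay too slowly to be summed absolutely, but those in the shifted
    basis [uexp (a + 1 / 2 + m)] decay quadratically, like those of the even part in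
    the first basis. *)
Theorem kadec a L (nu : int -> R) : 0 < L -> L < 1 / 4 ->
  (forall n, `|nu n - (a + n%:~R)| <= L) -> riesz (fun n => uexp (nu n)).
Proof.
move=> L0 L4 nuL; have p0 := pi_gt0 R.
have pL4 : pi * L < pi / 4 by have := L4; rewrite -(ltr_pM2l p0) mul1r.
have pL0 : 0 < pi * L by rewrite mulr_gt0.
have sc : sin (pi * L) < cos (pi * L) by apply: sin_lt_cos; rewrite ltW.
have s0 : 0 <= sin (pi * L) by apply: sin_ge0_pi; rewrite (ltW pL0)/=; lra.
have c1 : 0 <= 1 - cos (pi * L) by rewrite subr_ge0 cos_le1.
apply: (@riesz_of_close _ _ (fun n => uexp (a + n%:~R)) _ (1 - cos (pi * L) + sin (pi * L))).
- exact: uexp_orthonormal.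
- exact: uexp_dense.
- exact: addr_ge0.
- by lra.
move=> s c us; set T := \sum_(i <- s) normsq (c i).
have T0 : 0 <= T by apply: sumr_ge0 => i _; exact: normsq_ge0.
pose d n := nu n - (a + n%:~R).
pose half : R[i] := (1 / 2 : R)%:C.
pose w1 := \sum_(n <- s) c n *: (uexp (a + n%:~R) -
  half *: (uexp (a + n%:~R + d n) + uexp (a + n%:~R - d n))).
pose w2 := \sum_(n <- s) c n *: (half *: (uexp (a + n%:~R - d n) - uexp (a + n%:~R + d n))).
have wE : \sum_(n <- s) c n *: (uexp (a + n%:~R) - uexp (nu n)) = w1 + w2.
  rewrite /w1 /w2 -big_split; apply: eq_bigr => n _.
  rewrite [RHS]/= -[RHS]scalerDr; congr (_ *: _).
  have -> : nu n = a + n%:~R + d n by rewrite /d; ring.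
  move: (uexp (a + n%:~R)) (uexp (a + n%:~R + d n)) (uexp (a + n%:~R - d n)) => x y z.
  have -> : x - y = x - (half + half) *: y by rewrite /half -rmorphD -splitr scale1r.
  rewrite scalerDl scalerDr scalerBr; move: (half *: y) (half *: z) => y' z'.
  by rewrite !opprD !addrA subrK.
have halfM x : half * x%:C = (x / 2)%:C.
  by rewrite /half -rmorphM; congr (_%:C); field.
have h1 : nrm w1 ^+ 2 <= (1 - cos (pi * L)) ^+ 2 * T.
  apply: (nrm_le_bessel (uexp_orthonormal a) (uexp_dense a)) => t ut.
  pose A (m n : int) := sinc (n - m)%:~R -
    (sinc ((n - m)%:~R + d n) + sinc ((n - m)%:~R - d n)) / 2.
  have AE m : ip w1 (uexp (a + m%:~R)) = \sum_(n <- s) c n * (A m n)%:C.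
    rewrite ip_suml; apply: eq_bigr => n _; rewrite ipZl ipBl ipZl ipDl !ip_uexp.
    have -> : a + n%:~R - (a + m%:~R) = (n - m)%:~R :> R by rewrite intrB; ring.
    have -> : a + n%:~R + d n - (a + m%:~R) = (n - m)%:~R + d n by rewrite intrB; ring.
    have -> : a + n%:~R - d n - (a + m%:~R) = (n - m)%:~R - d n by rewrite intrB; ring.
    by rewrite -rmorphD halfM -rmorphB.
  rewrite (eq_bigr (fun m => normsq (\sum_(n <- s) c n * (A m n)%:C))); last first.
    by move=> m _; rewrite AE.
  apply: (@schur_test _ _ _ _ _ A (fun m n => alpha L (n - m))) => //.
  - by move=> m n; apply: cosine_entry_le => //; exact: nuL.
  - move=> m; apply: (@sum_translate_le (alpha L) _ _ (fun n => n - m)) => //.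
      by move=> r ur; exact: sum_alpha_le.
    exact: addIr.
  - move=> n; apply: (@sum_translate_le (alpha L) _ _ (fun m => n - m)) => //.
      by move=> r ur; exact: sum_alpha_le.
    by move=> x y /addrI /oppr_inj.
have h2 : nrm w2 ^+ 2 <= sin (pi * L) ^+ 2 * T.
  apply: (nrm_le_bessel (uexp_orthonormal (a + 1 / 2)) (uexp_dense (a + 1 / 2))) => t ut.
  pose A (m n : int) := (sinc ((n - m - 1)%:~R + 1 / 2 - d n) -
    sinc ((n - m - 1)%:~R + 1 / 2 + d n)) / 2.
  have AE m : ip w2 (uexp (a + 1 / 2 + m%:~R)) = \sum_(n <- s) c n * (A m n)%:C.
    rewrite ip_suml; apply: eq_bigr => n _; rewrite ipZl ipZl ipBl !ip_uexp.
    have -> : a + n%:~R - d n - (a + 1 / 2 + m%:~R) = (n - m - 1)%:~R + 1 / 2 - d n.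
      by rewrite !intrB; field.
    have -> : a + n%:~R + d n - (a + 1 / 2 + m%:~R) = (n - m - 1)%:~R + 1 / 2 + d n.
      by rewrite !intrB; field.
    by rewrite -rmorphB halfM.
  rewrite (eq_bigr (fun m => normsq (\sum_(n <- s) c n * (A m n)%:C))); last first.
    by move=> m _; rewrite AE.
  apply: (@schur_test _ _ _ _ _ A (fun m n => beta L (n - m - 1))) => //.
  - by move=> m n; apply: sine_entry_le => //; exact: nuL.
  - move=> m; apply: (@sum_translate_le (beta L) _ _ (fun n => n - m - 1)) => //.
      by move=> r ur; exact: sum_beta_le.
    by move=> x y /addIr /addIr.
  - move=> n; apply: (@sum_translate_le (beta L) _ _ (fun m => n - m - 1)) => //.
      by move=> r ur; exact: sum_beta_le.
    by move=> x y /addIr /addrI /oppr_inj.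
rewrite wE; have l0 := sqrtr_ge0 T.
have sT : Num.sqrt T ^+ 2 = T by exact: sqr_sqrtr.
have b1 : nrm w1 <= (1 - cos (pi * L)) * Num.sqrt T.
  by rewrite -(ler_pXn2r (_ : (0 < 2)%N)) ?nnegrE ?nrm_ge0 ?mulr_ge0// exprMn sT.
have b2 : nrm w2 <= sin (pi * L) * Num.sqrt T.
  by rewrite -(ler_pXn2r (_ : (0 < 2)%N)) ?nnegrE ?nrm_ge0 ?mulr_ge0// exprMn sT.
have b : nrm (w1 + w2) <= (1 - cos (pi * L) + sin (pi * L)) * Num.sqrt T.
  by apply: le_trans (nrmD_le _ _) _; rewrite mulrDl lerD.
rewrite -[X in _ * X]sT -exprMn ler_pXn2r ?nnegrE ?nrm_ge0//.
by rewrite mulr_ge0// addr_ge0.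
Qed.

End Kadec.

(** * Replacing one member of a Riesz family *)

Section RieszFamilies.
Context {R : realType}.
Implicit Types (u v w h : @L2 R).

Lemma riesz_scale (I : eqType) (f : I -> @L2 R) (z : R[i]) :
  z != 0 -> riesz f -> riesz (fun i => z *: f i).
Proof.
move=> z0 [fd [K K0 fK]]; split=> [v|].
  apply: cspan_trans (fd v) => i.
  have -> : f i = z^-1 *: (z *: f i) by rewrite scalerA mulVf// scale1r.
  by apply: cspanZ; exact: (cspan_gen (fun i => z *: f i)).
have q0 : 0 < normsq z.
  by rewrite -sqr_cabs exprn_gt0// lt_neqAle eq_sym cabs_eq0 z0 cabs_ge0.
exists (K * normsq z + K / normsq z); first by rewrite addr_gt0 ?divr_gt0 ?mulr_gt0.
move=> s c us; have [h1 h2] := fK s c us.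
have -> : \sum_(i <- s) c i *: (z *: f i) = z *: \sum_(i <- s) c i *: f i.
  by rewrite scaler_sumr; apply: eq_bigr => i _; rewrite !scalerA mulrC.
have T0 : 0 <= \sum_(i <- s) normsq (c i) by apply: sumr_ge0 => i _; exact: normsq_ge0.
have X0 := sqr_ge0 (nrm (\sum_(i <- s) c i *: f i)).
rewrite nrmZ exprMn sqr_cabs.
set T := \sum_(i <- s) normsq (c i) in T0 h1 h2 *.
set X := nrm _ ^+ 2 in X0 h1 h2 *; clearbody X T.
move: (normsq z) q0 => q q0; have q0' := ltW q0; have K0' := ltW K0.
split; rewrite mulrDl.
  apply: ler_wpDr; first by rewrite mulr_ge0// divr_ge0.
  have -> : K * q * T = q * (K * T) by ring.
  by rewrite ler_pM2l.
apply: ler_wpDl; first by rewrite !mulr_ge0.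
by have -> : K / q * (q * X) = K * X by field; rewrite gt_eqF.
Qed.

Lemma riesz_reindex (I J : eqType) (f : J -> @L2 R) (phi : I -> J) (psi : J -> I) :
  cancel phi psi -> cancel psi phi -> riesz f -> riesz (fun i => f (phi i)).
Proof.
move=> phiK psiK [fd [K K0 fK]]; split=> [v|].
  apply: cspan_trans (fd v) => j; rewrite -(psiK j).
  exact: (cspan_gen (fun i => f (phi i))).
exists K => // s c us.
have us' : uniq (map phi s) by rewrite map_inj_uniq//; exact: can_inj phiK.
have := fK (map phi s) (fun j => c (psi j)) us'; rewrite !big_map.
rewrite (eq_bigr (fun i => c i *: f (phi i))) => [|i _]; last by rewrite phiK.
by rewrite (eq_bigr (fun i => normsq (c i))) => [|i _]; last by rewrite phiK.
Qed.

Lemma not_cspan_dist (I : Type) (f : I -> @L2 R) h : ~ cspan f h ->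
  exists2 d : R, 0 < d & forall p, d <= nrm (h - lincomb f p).
Proof.
move=> /existsNP[d /not_implyP[d0 H]]; exists d => // p.
by rewrite leNgt; apply/negP => lt; apply: H; exists p.
Qed.

Section ReplaceOne.
Context (I : eqType) (f : I -> @L2 R) (i0 : I) (h : @L2 R).
Hypothesis f_riesz : riesz f.

Definition others (j : {i : I | i != i0}) : L2 := f (val j).
Definition replaced (i : I) : L2 := if i == i0 then h else f i.

Lemma cspan_others (s : seq I) (c : I -> R[i]) : cspan others
  (\sum_(i <- s | i != i0) c i *: f i) /\
  exists p, lincomb others p = \sum_(i <- s | i != i0) c i *: f i.
Proof.
suff H : exists p, lincomb others p = \sum_(i <- s | i != i0) c i *: f i.
  by split=> //; have [p <-] := H; exact: cspan_lincomb.
elim: s => [|i s [p IH]]; first by exists [::]; rewrite /lincomb !big_nil.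
have [ii0|ii0] := eqVneq i i0.
  by exists p; rewrite big_cons ii0 eqxx.
exists ((c i, exist _ i ii0) :: p).
by rewrite /lincomb !big_cons ii0 -IH.
Qed.

Lemma split_comb (g : I -> L2) (s : seq I) (c : I -> R[i]) : uniq s -> i0 \in s ->
  \sum_(i <- s) c i *: g i = c i0 *: g i0 + \sum_(i <- s | i != i0) c i *: g i.
Proof. by move=> us si; rewrite (bigD1_seq i0). Qed.

(** The distance from [h] to the span of the other members controls the coefficient
    of [h] in a combination by its norm, and forces [h] to have a nonzero component
    along [f i0], so that [f i0] can be recovered from [h] and the other members. *)
Lemma riesz_replaced : ~ cspan others h -> riesz replaced.
Proof.
move=> /not_cspan_dist[d d0 dist]; have [fd [K K0 fK]] := f_riesz.
have far s c (b : R[i]) : cabs b * d <=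
    nrm (b *: h + \sum_(i <- s | i != i0) c i *: f i).
  have [->|b0] := eqVneq b 0; first by rewrite cabs0 mul0r nrm_ge0.
  have [_ [p pE]] := cspan_others s (fun i => - (b^-1 * c i)).
  have -> : b *: h + \sum_(i <- s | i != i0) c i *: f i = b *: (h - lincomb others p).
    rewrite pE scalerBr scaler_sumr; congr (_ + _); rewrite -sumrN.
    by apply: eq_bigr => i _; rewrite scalerA mulrN mulrA divff// mul1r scaleNr opprK.
  by rewrite nrmZ ler_wpM2l ?cabs_ge0.
have gen_others i : i != i0 -> cspan replaced (f i).
  move=> ii0; have -> : f i = replaced i by rewrite /replaced (negbTE ii0).
  exact: cspan_gen.
have gen_h : cspan replaced h.
  by have -> : h = replaced i0; [rewrite /replaced eqxx|exact: cspan_gen].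
have gen0 : cspan replaced (f i0).
  apply: cspan_closed => e e0.
  have n0 : 0 < nrm (f i0) + 1 by rewrite ltr_wpDl ?nrm_ge0.
  (* An approximation of [h] within [d / 2] has a coefficient [b] at [i0] which is
     bounded below; the second bound is for the error divided by [b]. *)
  pose eta := Num.min (d / 2) (e * (d / 2 / (nrm (f i0) + 1))).
  have eta0 : 0 < eta by rewrite lt_min !(divr_gt0, mulr_gt0).
  have [p hp] := fd h eta eta0; have [s0 [c0 [us0 pE]]] := lincomb_uniq p.
  pose b := if i0 \in s0 then c0 i0 else 0.
  pose y := \sum_(i <- s0 | i != i0) c0 i *: f i.
  have pE' : lincomb f p = b *: f i0 + y.
    rewrite pE /b; case: ifPn => [si|si]; first exact: split_comb.
    rewrite scale0r add0r /y big_seq [RHS]big_seq_cond; apply: eq_bigl => i.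
    by case: (boolP (i \in s0)) => //= is0; apply/esym; apply: contraNneq si => <-.
  have hy : d <= nrm (h - y).
    have := far s0 (fun i => - c0 i) 1; rewrite cabs1 mul1r scale1r.
    by under eq_bigr do rewrite scaleNr; rewrite sumrN.
  rewrite pE' opprD addrA in hp.
  have hb : d / 2 <= cabs b * nrm (f i0).
    rewrite -nrmZ; have := nrmD_le (h - b *: f i0 - y) (b *: f i0).
    rewrite addrAC subrK => h3; have eta_d : eta <= d / 2 by rewrite ge_min lexx.
    move: h3 hy hp eta_d; move: (nrm (h - y)) (nrm (_ - y)) (nrm (b *: _)) => A B D.
    lra.
  have cb0 : 0 < cabs b.
    rewrite lt_neqAle cabs_ge0 andbT eq_sym; apply/eqP => cb.
    by move: hb; rewrite cb mul0r leNgt divr_gt0.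
  have b0 : b != 0 by rewrite -cabs_eq0 gt_eqF.
  exists (b^-1 *: (h - y)).
    apply: cspanZ; apply: cspanB; first exact: gen_h.
    have [/cspan_trans yo _] := cspan_others s0 c0; apply: yo => -[i ii0].
    exact: gen_others.
  have -> : f i0 - b^-1 *: (h - y) = - b^-1 *: (h - b *: f i0 - y).
    by rewrite [h - _ - y]addrAC scaleNr [in RHS]scalerBr scalerA mulVf// scale1r opprB.
  rewrite nrmZ -mulN1r cabsM -(rmorphN1 (real_complex R)) cabsR normrN1 mul1r cabsV.
  rewrite mulrC ltr_pdivrMr//.
  have eta_e : eta <= e * (d / 2 / (nrm (f i0) + 1)) by rewrite ge_min lexx orbT.
  apply: lt_le_trans hp (le_trans eta_e _); rewrite ler_pM2l// ler_pdivrMr//.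
  by apply: le_trans hb _; rewrite ler_pM2l// lerDl.
split=> [v|].
  apply: cspan_trans (fd v) => i.
  by have [->|] := eqVneq i i0; [exact: gen0|exact: gen_others].
have H0 := nrm_ge0 h.
pose up := 2 * nrm h ^+ 2 + 2 * K; pose lo := d ^- 2 + K * (1 + nrm h / d) ^+ 2.
have up0 : 0 <= up by rewrite addr_ge0 ?mulr_ge0 ?sqr_ge0 ?(ltW K0).
have lo0 : 0 <= lo.
  apply: addr_ge0; first by rewrite invr_ge0 sqr_ge0.
  by apply: mulr_ge0; [exact: ltW|exact: sqr_ge0].
exists (K + up + lo); first by rewrite -addrA ltr_wpDr// addr_ge0.
move=> s c us.
have [si|si] := boolP (i0 \in s); last first.
  have -> : \sum_(i <- s) c i *: replaced i = \sum_(i <- s) c i *: f i.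
    apply: eq_big_seq => i is_; rewrite /replaced ifN//.
    by apply: contraNneq si => <-.
  have [h1 h2] := fK s c us.
  have T0 : 0 <= \sum_(i <- s) normsq (c i) by apply: sumr_ge0 => i _; exact: normsq_ge0.
  have X0 := sqr_ge0 (nrm (\sum_(i <- s) c i *: f i)).
  split; [apply: le_trans h1 _|apply: le_trans h2 _];
    by rewrite ler_wpM2r// -addrA lerDl addr_ge0.
rewrite (split_comb _ _ us si) /replaced eqxx (bigD1_seq i0)//=.
rewrite (eq_bigr (fun i => c i *: f i)) => [|i ii0]; last by rewrite (negbTE ii0).
have dist_h := far s c (c i0).
have [h1 h2] := fK [seq i <- s | i != i0] c (filter_uniq _ us).
rewrite !big_filter in h1 h2.
set y := \sum_(i <- s | i != i0) c i *: f i in h1 h2 dist_h *.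
set T := \sum_(i <- s | i != i0) normsq (c i) in h1 h2 *.
have T0 : 0 <= T by apply: sumr_ge0 => i _; exact: normsq_ge0.
have h3 := nrmD_le (c i0 *: h) y.
have h4 : nrm y <= nrm (c i0 *: h + y) + nrm (c i0 *: h).
  have := nrmD_le (c i0 *: h + y) (- (c i0 *: h)).
  by rewrite nrmN addrC addKr.
rewrite nrmZ in h3 h4; rewrite -sqr_cabs.
have b0 := cabs_ge0 (c i0); have Y0 := nrm_ge0 y.
have X0 := nrm_ge0 (c i0 *: h + y).
move: h1 h2 h3 h4 dist_h b0 Y0 X0 H0 up0 lo0; rewrite /up /lo.
move: (nrm (c i0 *: h + y)) (nrm y) (cabs (c i0)) (nrm h) => X Y b H.
move=> h1 h2 h3 h4 h5 b0 Y0 X0 H0 up0 lo0; have K0' := ltW K0.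
split.
  apply: (@le_trans _ _ ((2 * H ^+ 2 + 2 * K) * (b ^+ 2 + T))); last first.
    by rewrite ler_wpM2r ?addr_ge0 ?sqr_ge0// addrAC lerDr addr_ge0.
  apply: (@le_trans _ _ ((b * H + Y) ^+ 2)).
    by rewrite ler_pXn2r ?nnegrE// addr_ge0 ?mulr_ge0.
  apply: (@le_trans _ _ (2 * (b * H) ^+ 2 + 2 * Y ^+ 2)).
    by have := sqr_ge0 (b * H - Y); rewrite sqrrB sqrrD => hh; lra.
  have q1 : 0 <= 2 * H ^+ 2 * T by rewrite !mulr_ge0 ?sqr_ge0.
  have q2 : 0 <= 2 * K * b ^+ 2 by rewrite !mulr_ge0 ?sqr_ge0.
  have -> : (2 * H ^+ 2 + 2 * K) * (b ^+ 2 + T) =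
    2 * (b * H) ^+ 2 + 2 * (K * T) + (2 * H ^+ 2 * T + 2 * K * b ^+ 2) by ring.
  by lra.
apply: (@le_trans _ _ ((d ^- 2 + K * (1 + H / d) ^+ 2) * X ^+ 2)); last first.
  by rewrite ler_wpM2r ?sqr_ge0// lerDr addr_ge0.
have bd : b <= X / d by rewrite ler_pdivlMr.
have Y1 : Y <= (1 + H / d) * X.
  apply: le_trans h4 _; rewrite mulrDl mul1r lerD2l mulrAC [H * X]mulrC mulrAC.
  by rewrite ler_wpM2r.
rewrite mulrDl lerD//.
  rewrite mulrC -expr_div_n ler_pXn2r ?nnegrE// divr_ge0//; exact: ltW.
apply: le_trans h2 _; rewrite -mulrA ler_wpM2l// -exprMn ler_pXn2r ?nnegrE//.
by rewrite mulr_ge0// addr_ge0// divr_ge0// ltW.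
Qed.

End ReplaceOne.
End RieszFamilies.

(** * Replacing the frequencies of exponentials *)

Section ReplacingFrequencies.
Context {R : realType}.
Local Notation Ipi := (@Ipi R).
Implicit Types (u v w : @L2 R) (b : R).

(** The value on exponential sums of the Volterra operator mapping [u] to
    [t |-> i * expi b t * \int_(-pi)^t u s * expi (- b) s ds], which sends each
    [expL2 a] to [(a - b)^-1] times itself modulo [expL2 b]. *)
Definition volterra b (p : seq (R[i] * R)) : @L2 R :=
  \sum_(x <- p) (x.1 * ((x.2 - b)^-1)%:C) *:
    (expL2 x.2 - expi (x.2 - b) (- pi) *: expL2 b).

Lemma volterraE b p t : (forall x, x \in p -> x.2 != b) -> Ipi t ->
  volterra b p t = expi b t * 'i%C * ip (lincomb expL2 p) (trunc_expL2 b t).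
Proof.
move=> pb It; rewrite /volterra /lincomb L2_sumE ip_suml mulr_sumr.
apply: eq_big_seq => x xp; rewrite L2ZE L2DE L2NE L2ZE /= ipZl ip_trunc_expL2 ?pb//.
have -> : expi x.2 t = expi b t * expi (x.2 - b) t by rewrite -expiD addrC subrK.
have ii : ((x.2 - b)^-1)%:C = 'i%C * (0 -i* (x.2 - b)^-1) :> R[i].
  by apply/eqP; rewrite eq_complex /=; apply/andP; split; apply/eqP; ring.
rewrite ii; move: (0 -i* _) ('i%C) (expi b t) (expi _ t) (expi _ _) => y z a c d.
by ring.
Qed.

(** By the Cauchy-Schwarz inequality the operator is bounded, even into the
    uniform norm. *)
Lemma nrm_volterra b p : (forall x, x \in p -> x.2 != b) ->
  nrm (volterra b p) <= 2 * pi * nrm (lincomb expL2 p).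
Proof.
move=> pb; have p0 : 0 <= 2 * pi :> R by rewrite mulr_ge0 ?pi_ge0.
have h : nrm (volterra b p) ^+ 2 <= (nrm (lincomb expL2 p) ^+ 2 * (2 * pi)) * (2 * pi).
  apply: sqr_nrm_le => t It; rewrite volterraE// !normsqM normsq_expi mul1r.
  have -> : normsq ('i%C : R[i]) = 1 by rewrite /normsq /= expr0n expr1n add0r.
  rewrite mul1r; apply: le_trans (cauchy_schwarz _ _) _.
  by rewrite ler_wpM2l ?sqr_ge0// nrm_trunc_expL2.
rewrite -(ler_pXn2r (_ : (0 < 2)%N)) ?nnegrE ?nrm_ge0 ?mulr_ge0 ?nrm_ge0 ?pi_ge0//.
by apply: le_trans h _; rewrite le_eqVlt; apply/orP; left; apply/eqP; ring.
Qed.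

Section NotInSpan.
Context (I : eqType) (nu : I -> R) (i0 : I) (b : R).
Hypothesis nu_riesz : riesz (fun i => expL2 (nu i)).
Hypothesis nu_b : forall i, nu i != b.

Local Notation Wgens := (@others R I (fun i => expL2 (nu i)) i0).
Local Notation W := (cspan Wgens).

Lemma W_gen i : i != i0 -> W (expL2 (nu i)).
Proof. by move=> ii0; exact: (cspan_gen Wgens (exist _ i ii0)). Qed.

(** Containing [expL2 b], the closed span [W] of the other exponentials is stable
    under the Volterra operator. On the quotient by [W], spanned by [expL2 (nu i0)],
    this operator is multiplication by [(nu i0 - b)^-1]; but it multiplies the class
    of [expL2 a] by [(a - b)^-1], hence this class is zero. *)
Lemma W_contains_exponentials : W (expL2 b) -> forall a, a != nu i0 -> W (expL2 a).
Proof.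
move=> Wb a a0; have [->//|ab] := eqVneq a b.
have k0 : nu i0 - b != 0 by rewrite subr_eq0.
have ka : a - b != 0 by rewrite subr_eq0.
pose kap : R := (a - b)^-1 - (nu i0 - b)^-1.
have kap0 : kap != 0.
  by rewrite subr_eq0 (inj_eq invr_inj) (inj_eq (addIr _)).
apply: cspan_closed => e e0.
pose M := 2 * pi + `|(nu i0 - b)^-1|.
have M0 : 0 < M by rewrite ltr_wpDr// mulr_gt0 ?pi_gt0.
have eta0 : 0 < e * `|kap| / M by rewrite divr_gt0// mulr_gt0// normr_gt0.
have [p pP] := nu_riesz.1 (expL2 a) _ eta0.
(* The operator minus its scalar is applied to a small vector, [expL2 a] minus a
   combination of the [expL2 (nu i)]; the result is [kap] times [expL2 a] up to an
   element of [W]. *)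
pose q := (1, a) :: [seq (- x.1, nu x.2) | x <- p].
have qE : lincomb expL2 q = expL2 a - lincomb (fun i => expL2 (nu i)) p.
  rewrite /lincomb big_cons big_map scale1r -sumrN; congr (_ + _).
  by apply: eq_bigr => x _; rewrite scaleNr.
have qb x : x \in q -> x.2 != b.
  by rewrite inE => /orP[/eqP ->//|/mapP[y _ ->]]; exact: nu_b.
have bound : nrm (volterra b q - ((nu i0 - b)^-1)%:C *: lincomb expL2 q) < e * `|kap|.
  have h1 := nrm_volterra qb.
  have h2 : nrm (volterra b q - ((nu i0 - b)^-1)%:C *: lincomb expL2 q) <=
      M * nrm (lincomb expL2 q).
    apply: le_trans (nrmD_le _ _) _; rewrite nrmN nrmZ cabsR /M mulrDl.
    by rewrite lerD2r.
  apply: le_lt_trans h2 _; rewrite mulrC -ltr_pdivlMr//.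
  by rewrite qE.
pose term x := (x.1 * ((x.2 - b)^-1)%:C) *: (expL2 x.2 - expi (x.2 - b) (- pi) *: expL2 b)
  - ((nu i0 - b)^-1)%:C *: (x.1 *: expL2 x.2) : L2.
have termE x : term x = (x.1 * ((x.2 - b)^-1 - (nu i0 - b)^-1)%:C) *: expL2 x.2
    - (x.1 * ((x.2 - b)^-1)%:C * expi (x.2 - b) (- pi)) *: expL2 b.
  rewrite /term scalerBr !scalerA addrAC -scalerBl; congr (_ *: _ - _).
  by rewrite rmorphB /= mulrBr [x.1 * ((nu i0 - b)^-1)%:C]mulrC.
pose w := (((a - b)^-1)%:C * expi (a - b) (- pi)) *: expL2 b
  - \sum_(x <- p) term (- x.1, nu x.2) : L2.
have sumE : volterra b q - ((nu i0 - b)^-1)%:C *: lincomb expL2 q = kap%:C *: expL2 a - w.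
  rewrite /volterra /lincomb scaler_sumr -sumrB big_cons big_map.
  rewrite -/(term (1, a)) termE !mul1r /w opprB addrA addrAC; congr (_ + _).
have Ww : W w.
  apply: cspanB; first exact: cspanZ.
  apply: cspan_sum => x; rewrite termE; apply: cspanB; last exact: cspanZ.
  have [->|xi] := eqVneq x.2 i0; last by apply: cspanZ; exact: W_gen.
  by rewrite subrr mulr0 scale0r; exact: cspan0.
have kc0 : kap%:C != 0 :> R[i] by rewrite -cabs_eq0 cabsR normr_eq0.
exists ((kap%:C)^-1 *: w); first exact: cspanZ.
have -> : expL2 a - (kap%:C)^-1 *: w = (kap%:C)^-1 *: (kap%:C *: expL2 a - w).
  by rewrite [RHS]scalerBr scalerA mulVf// scale1r.
rewrite -sumE nrmZ cabsV cabsR mulrC ltr_pdivrMr//.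
by rewrite normr_gt0.
Qed.

(** The lower bound for combinations with coefficient [1] at [i0] keeps
    [expL2 (nu i0)] away from the span of the other ones. *)
Lemma not_W_gen0 : ~ W (expL2 (nu i0)).
Proof.
move=> W0; have [_ [K K0 fK]] := nu_riesz.
(* Any distance whose square is less than [K^-1] would do. *)
have e0 : 0 < (1 + K)^-1 by rewrite invr_gt0 addr_gt0.
have [p pP] := W0 _ e0; have [s [c [us pE]]] := lincomb_uniq p.
pose c' i := if i == i0 then 1 else if insub i is Some j then - c j else 0 : R[i].
have c'expL2 (j : {i : I | i != i0}) : c' (val j) = - c j.
  by rewrite /c' (negbTE (valP j)) valK.
have c'0 : c' i0 = 1 by rewrite /c' eqxx.
have us' : uniq (i0 :: map val s).
  rewrite /= map_inj_uniq ?us ?andbT//; last exact: val_inj.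
  by apply/mapP => -[j _ ij]; have /eqP := valP j; apply; exact: esym ij.
have [_] := fK _ c' us'.
rewrite !big_cons !big_map !c'0 scale1r.
have -> : \sum_(j <- s) c' (val j) *: expL2 (nu (val j)) =
    - lincomb Wgens p.
  rewrite pE -sumrN; apply: eq_bigr => j _; rewrite c'expL2 scaleNr//.
move=> h; have T0 : 0 <= \sum_(j <- s) normsq (c' (val j)).
  by apply: sumr_ge0 => j _; exact: normsq_ge0.
have n1 : normsq (1 : R[i]) = 1 by rewrite /normsq /= expr0n expr1n addr0.
move: h; rewrite n1 => h.
have h1 : 1 <= K * nrm (expL2 (nu i0) - lincomb Wgens p) ^+ 2.
  by apply: le_trans h; rewrite lerDl.
have h2 : nrm (expL2 (nu i0) - lincomb Wgens p) ^+ 2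
    <= (1 + K)^-1 ^+ 2.
  by rewrite ler_pXn2r ?nnegrE ?nrm_ge0 ?invr_ge0 ?addr_ge0 ?(ltW K0)// ltW.
have h3 := le_trans h1 (ler_wpM2l (ltW K0) h2).
move: h3; rewrite exprVn ler_pdivlMr ?exprn_gt0 ?addr_gt0// mul1r sqrrD expr1n => h3.
have := sqr_ge0 K; move: h3; rewrite mul1r mulr2n; lra.
Qed.

(** Otherwise [W] contains the exponentials of frequencies [nu i0 + 1 / 2 + n], none
    of which is [nu i0], and these span a dense subspace. *)
Lemma exponential_not_in_span : ~ W (expL2 b).
Proof.
move=> Wb; apply: not_W_gen0.
apply: cspan_trans (expL2_dense (nu i0 + 1 / 2) _) => n.
apply: W_contains_exponentials => //.
apply/eqP => h; have n0 : n%:~R + 1 / 2 = 0 :> R.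
  by apply: (addrI (nu i0)); rewrite addr0 -[RHS]h [n%:~R + _]addrC addrA.
by have := @half_sqr_ge R n; rewrite n0 expr0n /= leNgt divr_gt0.
Qed.

End NotInSpan.

(** The frequencies are replaced one at a time; the intermediate families keep
    distinct frequencies because the new ones differ from each other and from all
    the old ones. *)
Lemma riesz_replace_frequencies (I : eqType) (nu mu : I -> R) (s : seq I) :
  riesz (fun i => expL2 (nu i)) -> uniq s -> injective mu ->
  (forall i j, i \in s -> mu i != nu j) ->
  riesz (fun i => expL2 (if i \in s then mu i else nu i)).
Proof.
move=> nuR us mu_inj; elim: s us => [|i0 s IH]; first by [].
move=> /= /andP[i0s us] mu_nu.
have {}IH := IH us (fun i j is_ => mu_nu i j (mem_behead (s := i0 :: s) is_)).
pose nu' i := if i \in s then mu i else nu i.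
have nu'_b i : nu' i != mu i0.
  rewrite /nu'; case: ifPn => is_.
    by apply: contraNneq i0s => /mu_inj <-.
  by rewrite eq_sym mu_nu// mem_head.
have := riesz_replaced IH (@exponential_not_in_span I nu' i0 (mu i0) IH nu'_b).
congr riesz; apply/funext => i; rewrite /replaced inE.
by case: eqVneq => [->|].
Qed.

End ReplacingFrequencies.

(** * Reindexing by the integers *)

Section Reindexing.
Context (k N0 : nat).

(** Position of each index of the family in the lattice: the frequency of [i] is
    close to [(place i)%:~R + k%:R / 2] for all but finitely many [i], and the
    [k] new frequencies fill the gap left between the two shifted halves. *)
Definition place (i : 'I_k + int) : int :=
  match i with
  | inl j => - (N0%:Z) - j%:Z
  | inr n => if - N0%:Z < n then n else n - k%:Z
  end.

Definition unplace (m : int) : 'I_k + int :=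
  if - N0%:Z < m then inr m
  else if insub (absz (- N0%:Z - m)%R) is Some j then inl j else inr (m + k%:Z).

Lemma placeK : cancel place unplace.
Proof.
move=> [j|n]; rewrite /unplace /place.
  have jk := ltn_ord j.
  rewrite ifF; last by apply/negbTE; lia.
  have -> : absz (- N0%:Z - (- N0%:Z - j%:Z))%R = j by lia.
  by rewrite valK.
have [h|h] := boolP (- N0%:Z < n); first by rewrite h.
rewrite ifF; last by apply/negbTE; lia.
by rewrite insubN ?subrK//; lia.
Qed.

Lemma unplaceK : cancel unplace place.
Proof.
move=> m; rewrite /unplace; case: ifPn => h; first by rewrite /place h.
case: insubP => [j jk jE|jk]; rewrite /place; first by rewrite jE; lia.
by rewrite ifF; [lia|apply/negbTE; lia].
Qed.

End Reindexing.

Lemma avoid_finite (R : realType) (s : seq R) (L : R) : 0 < L ->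
  exists2 th, 0 < th <= L & th \notin s.
Proof.
move=> L0; suff [th /andP[t0 tL] H] : exists2 th, 0 < th <= L &
    forall x, x \in s -> 0 < x -> th < x.
  exists th; first by rewrite t0.
  by apply/negP => /H /(_ t0); rewrite ltxx.
elim: s => [|x s [th /andP[t0 tL] H]]; first by exists L; rewrite ?L0 ?lexx.
have [x0|x0] := ltP 0 x; last first.
  exists th; first by rewrite t0.
  by move=> y; rewrite inE => /orP[/eqP ->|/H//]; rewrite ltNge x0.
exists (Num.min th (x / 2)); first by rewrite lt_min t0 divr_gt0//= ge_min tL.
move=> y; rewrite inE gt_min => /orP[/eqP -> _|ys y0]; last by rewrite H.
by rewrite ltr_pdivrMr// ltr_pMr// ltr1n orbT.
Qed.

(** * Odd sequences asymptotic to a translate of the integers *)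

Theorem lemma8p4 (R : realType) (x : int -> R) (k N0 : nat) (delta : R)
    (x' : 'I_k -> R)
    (x_inj : injective x)
    (x_odd : forall n : int, x (- n) = - x n)
    (k_gt0 : (0 < k)%N)
    (delta_gt0 : 0 < delta) (delta_lt : delta < 1 / 4)
    (x_asymp : forall n : int, N0%:Z <= n ->
       `|x n - n%:~R - k%:R / 2| <= 1 / 4 - delta)
    (x'_inj : injective x')
    (x'_notin : forall (j : 'I_k) (n : int), x' j <> x n) :
  riesz_basis (fun i : 'I_k + int =>
    match i with
    | inl j => expi (x' j)
    | inr n => expi (x n)
    end).
Proof.
pose freq (i : 'I_k + int) := match i with inl j => x' j | inr n => x n end.
have freq_inj : injective freq.
  move=> [j|n] [j'|n'] /=; [by move=> /x'_inj ->| | |by move=> /x_inj ->].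
    by move/x'_notin.
  by move/esym/x'_notin.
pose L := 1 / 4 - delta.
have L0 : 0 < L by rewrite subr_gt0.
have L4 : L < 1 / 4 by rewrite ltrBlDr ltrDl.
pose pos (i : 'I_k + int) : R := k%:R / 2 + (place N0 i)%:~R.
(* The indices whose frequencies may be far from their positions. *)
pose D : seq ('I_k + int) := undup ([seq inl j | j <- enum 'I_k] ++
  [seq inr (m%:Z - N0%:Z) | m <- iota 0 (N0.*2).+1]).
(* The exceptional frequencies start at lattice points moved by [th], so chosen
   that they differ from all the final ones. *)
have [th /andP[th0 thL] th_s] :=
  avoid_finite [seq freq p.1 - pos p.2 | p <- [seq (i, j) | i <- D, j <- D]] L0.
have near_pos i : i \notin D -> `|freq i - pos i| <= L.
  rewrite mem_undup mem_cat negb_or => /andP[iD1 iD2].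
  case: i iD1 iD2 => [j|n] iD1 iD2.
    by case/negP: iD1; rewrite mem_map ?mem_enum//; exact: inl_inj.
  have nN : (N0%:Z < n) || (n < - N0%:Z).
    rewrite -[_ || _]negbK negb_or -!leNgt; apply/negP => /andP[n1 n2].
    case/negP: iD2; apply/mapP; exists (absz (n + N0%:Z)%R); first by rewrite mem_iota; lia.
    by congr inr; lia.
  rewrite /pos /freq /place; case/orP: nN => nN.
    rewrite ifT; last by lia.
    have -> : x n - (k%:R / 2 + n%:~R) = x n - n%:~R - k%:R / 2 by ring.
    by apply: x_asymp; rewrite ltW.
  rewrite ifF; last by apply/negbTE; lia.
  have -> : x n - (k%:R / 2 + (n - k%:Z)%:~R) = - (x (- n) - (- n)%:~R - k%:R / 2).
    by rewrite x_odd intrB mulrNz -pmulrn; field.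
  by rewrite normrN; apply: x_asymp; lia.
pose start i := if i \in D then pos i + th else freq i.
have startR : riesz (fun i => expL2 (start i)).
  have kad : riesz (fun m => uexp (start (unplace k N0 m))).
    apply: (@kadec R (k%:R / 2) L) => // m.
    have -> : k%:R / 2 + m%:~R = pos (unplace k N0 m) by rewrite /pos unplaceK.
    rewrite /start; case: ifPn => [_|]; last exact: near_pos.
    by rewrite addrAC subrr add0r ger0_norm// ltW.
  have := riesz_reindex (@placeK k N0) (@unplaceK k N0) kad.
  move/(riesz_scale (_ : (Num.sqrt (2 * pi))%:C != 0 :> R[i])).
  have s0 : (Num.sqrt (2 * pi))%:C != 0 :> R[i].
    by rewrite -cabs_eq0 cabsR normr_eq0 gt_eqF// sqrt2pi_gt0.
  move=> /(_ s0); congr riesz; apply/funext => i.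
  by rewrite placeK /uexp scalerA -rmorphM divff ?scale1r// gt_eqF// sqrt2pi_gt0.
have finalR : riesz (fun i => expL2 (freq i)).
  have := @riesz_replace_frequencies R _ start freq D startR (undup_uniq _) freq_inj.
  have sep i j : i \in D -> freq i != start j.
    move=> iD; rewrite /start; case: ifPn => [jD|jD].
      apply: contraNneq th_s => fi; apply/mapP; exists (i, j) => /=.
        by apply/allpairsP; exists (i, j).
      by rewrite fi addrAC subrr add0r.
    by apply: contraNneq jD => /freq_inj <-.
  move=> /(_ sep); congr riesz; apply/funext => i; rewrite /start.
  by case: (i \in D).
pose e (i : 'I_k + int) := uexp (0 + (place N0 i)%:~R) : @L2 R.
have e_on i j : ip (e i) (e j) = (i == j)%:R.
  by rewrite /e uexp_orthonormal (inj_eq (can_inj (@placeK k N0))).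
have e_dense v : cspan e v.
  apply: cspan_trans (uexp_dense 0 v) => m; rewrite -[m](@unplaceK k N0).
  exact: (cspan_gen e).
have := riesz_basis_of_riesz e_on e_dense finalR.
by congr riesz_basis; apply/funext => -[j|n].
Qed.
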